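(* Let $\mathcal G$ be a connected noncompact metric graph with no terminal point, not satisfying Assumption (H), and having more than one halfline, and consider the critical energy ($p=6$). If $\mu_{\mathcal G}<\mu_{\mathbb R}$, then $-\infty<\mathcal E_{\mathcal G}(\mu)<0$ for every $\mu\in(\mu_{\mathcal G},\mu_{\mathbb R}]$, and $\mathcal E_{\mathcal G}(\mu)$ is attained if and only if $\mu\in[\mu_{\mathcal G},\mu_{\mathbb R}]$.
   Context: Metric graphs have finitely many edges and vertices, bounded edges identified with $[0,\ell_e]$ and halflines with $[0,\infty)$ (far endpoints: vertices at infinity). A terminal point is a vertex of degree one that is not a vertex at infinity. A trail is a path of adjacent edges traversing each edge exactly once. Assumption (H): every point of $\mathcal G$ lies on a trail containing two halflines (equivalently, after identifying all vertices at infinity, $\mathcal G$ admits a covering by cycles). $H^1_\mu(\mathcal G)$: continuous functions, $H^1$ on each edge, $\|u\|_2^2=\mu$. $E(u,\mathcal G)=\frac12\int|u'|^2-\frac16\int|u|^6$, $\mathcal E_{\mathcal G}(\mu)=\inf_{H^1_\mu(\mathcal G)}E(\cdot,\mathcal G)$, defined for $\mu>0$. For a graph $X$, $K_X=\sup_{u\in H^1(X),u\ne0}\frac{\|u\|_6^6}{\|u\|_2^4\|u'\|_2^2}$ and $\mu_X=\sqrt{3/K_X}$; $\mu_{\mathbb R}=\pi\sqrt3/2$. *)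

(* Defs.v *)
From HB Require Import structures.
From mathcomp Require Import all_boot all_order all_algebra.
From mathcomp Require Import all_classical all_reals all_analysis.
Set Implicit Arguments. Unset Strict Implicit. Unset Printing Implicit Defensive.
Import Order.TTheory GRing.Theory Num.Theory.
Import numFieldNormedType.Exports.
Local Open Scope classical_set_scope.
Local Open Scope ring_scope.

(* A metric graph with finitely many vertices 'I_nV and edges 'I_nE.
   Each edge e starts at the vertex [src e] (coordinate 0).  If [tgt e = Some v]
   the edge is bounded, identified with [0, len e], and ends at v;
   if [tgt e = None] the edge is a halfline [0, +oo) whose far endpoint is its own
   vertex at infinity.  Loops and multiple edges are allowed. *)
Record mgraph (R : realType) := MGraph {
  nV : nat;
  nE : nat;
  src : 'I_nE -> 'I_nV;
  tgt : 'I_nE -> option 'I_nV;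
  len : 'I_nE -> R;
  len_gt0 : forall e, tgt e != None -> 0 < len e }.

Arguments src {R} m _.
Arguments tgt {R} m _.
Arguments len {R} m _.
Arguments nV {R} m.
Arguments nE {R} m.

Section Graph.
Context {R : realType} (G : mgraph R).

Definition is_halfline (e : 'I_(nE G)) : bool := tgt G e == None.

Definition edge_dom (e : 'I_(nE G)) : set R :=
  if tgt G e is Some _ then `[0, len G e] else `[0, +oo[.

(* vertices, including the vertices at infinity (one per halfline: inr e) *)
Definition gvert := ('I_(nV G) + 'I_(nE G))%type.
Definition endA (e : 'I_(nE G)) : gvert := inl (src G e).
Definition endB (e : 'I_(nE G)) : gvert :=
  if tgt G e is Some v then inl v else inr e.

Definition ofrom (a : 'I_(nE G) * bool) : gvert :=
  if a.2 then endA a.1 else endB a.1.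
Definition oto (a : 'I_(nE G) * bool) : gvert :=
  if a.2 then endB a.1 else endA a.1.

Fixpoint consecutive (s : seq ('I_(nE G) * bool)) : bool :=
  match s with
  | a :: ((b :: _) as t) => (oto a == ofrom b) && consecutive t
  | _ => true
  end.

Definition walk (x y : gvert) (s : seq ('I_(nE G) * bool)) : Prop :=
  if s is a :: t then [/\ consecutive s, ofrom a = x & oto (last a t) = y]
  else False.

Definition trail (s : seq ('I_(nE G) * bool)) : Prop :=
  (exists x y, walk x y s) /\ uniq (map fst s).

Definition gconnected : Prop :=
  forall v w : 'I_(nV G), v = w \/ exists s, walk (inl v) (inl w) s.

Definition nhalflines : nat := #|[pred e | is_halfline e]|.

Definition noncompact : Prop := exists e, is_halfline e.

(* degree of a (finite) vertex; a loop counts twice *)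
Definition degree (v : 'I_(nV G)) : nat :=
  #|[pred e | src G e == v]| + #|[pred e | tgt G e == Some v]|.

(* terminal point: vertex of degree one that is not a vertex at infinity *)
Definition no_terminal_point : Prop := forall v, degree v != 1%N.

Definition assumptionH : Prop :=
  forall (e : 'I_(nE G)) (x : R), edge_dom e x ->
    exists s, [/\ trail s, e \in map fst s & (2 <= count is_halfline (map fst s))%N].

(* u e : R -> R is the restriction of u to the edge e (only its values on
   edge_dom e matter); g e is its (weak) derivative. *)
Definition H1 (u g : 'I_(nE G) -> R -> R) : Prop :=
  (exists phi : 'I_(nV G) -> R, forall e,
      u e 0 = phi (src G e) /\
      (forall v, tgt G e = Some v -> u e (len G e) = phi v)) /\
  (forall e,
    [/\ measurable_fun (edge_dom e) (g e),
        (lebesgue_measure).-integrable (edge_dom e) (fun x => ((g e x) ^+ 2)%:E),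
        (lebesgue_measure).-integrable (edge_dom e) (fun x => ((u e x) ^+ 2)%:E) &
        forall x, edge_dom e x ->
          u e x = u e 0 + Rintegral lebesgue_measure `[0, x] (g e)]).

Local Open Scope ereal_scope.

Definition gint (f : 'I_(nE G) -> R -> R) : \bar R :=
  \sum_(e < nE G) \int[lebesgue_measure]_(x in edge_dom e) (f e x)%:E.

Definition L2sq (u : 'I_(nE G) -> R -> R) : \bar R := gint (fun e x => (u e x ^+ 2)%R).
Definition L6pow (u : 'I_(nE G) -> R -> R) : \bar R := gint (fun e x => (u e x ^+ 6)%R).

Definition energy (u g : 'I_(nE G) -> R -> R) : \bar R :=
  (2^-1)%:E * L2sq g - (6^-1)%:E * L6pow u.

Definition H1mu (mu : R) (u g : 'I_(nE G) -> R -> R) : Prop :=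
  H1 u g /\ L2sq u = mu%:E.

Definition groundE (mu : R) : \bar R :=
  ereal_inf [set E | exists u g, H1mu mu u g /\ E = energy u g].

Definition attained (mu : R) : Prop :=
  exists u g, H1mu mu u g /\ energy u g = groundE mu.

Definition KG : \bar R :=
  ereal_sup [set r%:E | r in [set r : R | exists u g, [/\ H1 u g,
      (exists e x, edge_dom e x /\ u e x <> 0%R) &
      r = (fine (L6pow u) / ((fine (L2sq u)) ^+ 2 * fine (L2sq g)))%R]]].

Local Close Scope ereal_scope.

Definition muG : R := Num.sqrt (3 / fine KG).
End Graph.

Definition muR {R : realType} : R := pi * Num.sqrt 3 / 2.

(* Main.v *)
Require Import Defs.
From HB Require Import structures.
From mathcomp Require Import all_boot all_order all_algebra.
From mathcomp Require Import all_classical all_reals all_analysis.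
From mathcomp Require Import measurable_realfun ring lra.
Set Implicit Arguments. Unset Strict Implicit. Unset Printing Implicit Defensive.
Import Order.TTheory GRing.Theory Num.Theory.
Import numFieldNormedType.Exports.
Local Open Scope classical_set_scope.
Local Open Scope ring_scope.

(* Rearrangements are replaced by a calibration argument. The soliton of height N solves
   phi' = - psi0 N phi with psi0 N t = t sqrt ((N^4 - t^4) / 3), and Young's inequality
   g^2 / 2 + psi0 N |u| ^2 / 2 >= psi0 N |u| |g| bounds the energy from below by the total
   variation of Psi |u|, where Psi' = psi0 N and 2 Psi N = N^4 muR / 6. If N = max |u| and
   every level is crossed twice, this reads E u >= N^4 (muR - mu) / 6.
   With no terminal point, levels above m := max over bounded edges of min |u| are crossed
   twice because every vertex has degree >= 2; the defect below m is compensated by the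
   mass >= m^2 l on an edge of length l where |u| >= m, which is exploited by a slightly
   weaker calibration. Hence functions of mass <= muR and energy <= - c are bounded.
   With two half-lines, levels reached on half-lines are crossed twice, which excludes the
   loss of a maximizing sequence for KG at the threshold mass muG.
   Ground states are then obtained by the direct method: mass escaping along a half-line
   carries asymptotically nonnegative energy, and scaling a limit of smaller mass up to
   mass mu does not increase a nonpositive energy.
   Above muR, truncated concentrated solitons have energy tending to -oo. *)

(** * Integration *)

(* [lebesgue_measure] lives on [measurableTypeR R], whose display differs from the
   default one inferred for [R]; the two structures are convertible. *)
Local Notation lmset D := (@measurable _ (measurableTypeR _) D).
Local Notation lmfun D g := (@measurable_fun _ _ (measurableTypeR _) _ D g).

(** The exponent is critical: on a half-line, replacing [u] by [sqrt lam * u (lam x)] keeps the mass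
    and multiplies the energy by [lam^2], so neither the mass nor an upper bound on the energy keeps
    a minimizing sequence from concentrating. Excluding this is the crux. Let [M] be the maximum of
    [|u|] and [m] the level below which a crossing may be single. The calibration [psi0] alone loses
    about [M^2 m^2], which is harmless only if it is small. The weaker calibration costs a further
    term of order [y = m M^2] and gains one of order [y^2]; this bounds [y], and then
    [M^2 = y^2 / (M m)^2] is bounded because a negative energy keeps [M m] away from 0. At mass
    [muG] the ground energy is 0 and [M m] has no such lower bound; there the strict inequality
    [muG < muR] leaves a positive multiple of [M^4] in the energy estimate, and this bounds [M]. *)

Section Integration.
Context {R : realType}.
Implicit Types (D : set R) (f h u g : R -> R) (x y z : R).
Local Notation leb := (@lebesgue_measure R).

Definition rint D f := leb.-integrable D (EFin \o f).
Definition RI D f : R := Rintegral leb D f.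

Lemma rint_meas D f : rint D f -> lmfun D f.
Proof. by move=> /integrableP[/measurable_EFinP]. Qed.

Lemma lmfunS D D' f : lmset D -> D' `<=` D -> lmfun D f -> lmfun D' f.
Proof. by move=> mD sD mf; apply: (measurable_funS mD _ mf). Qed.

Lemma rintD D f h : lmset D -> rint D f -> rint D h ->
  rint D (fun x => f x + h x).
Proof. by move=> mD fi hi; exact: (integrableD mD fi hi). Qed.

Lemma rintZ D k f : lmset D -> rint D f -> rint D (fun x => k * f x).
Proof. by move=> mD fi; exact: (integrableZl mD k fi). Qed.

Lemma rint_le D f h : lmset D -> lmfun D f ->
  (forall x, D x -> `|f x| <= h x) -> rint D h -> rint D f.
Proof.
move=> mD mf fh; apply: le_integrable => //; first exact/measurable_EFinP.
by move=> x Dx /=; rewrite lee_fin (le_trans (fh _ Dx))// ler_norm.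
Qed.

Lemma rintS D D' f : lmset D -> lmset D' -> D' `<=` D ->
  rint D f -> rint D' f.
Proof. exact: integrableS. Qed.

Lemma rint_cst a b k : rint `[a, b] (fun=> k).
Proof.
apply: continuous_compact_integrable; first exact: segment_compact.
by apply: continuous_subspaceT => x; exact: cvg_cst.
Qed.

Lemma RI_cst a b k : a <= b -> RI `[a, b] (fun=> k) = k * (b - a).
Proof.
move=> ab; rewrite /RI Rintegral_cst//; congr (_ * _).
have /= -> := @lebesgue_measure_itv R `[a, b].
by rewrite lte_fin; case: ltgtP ab => //= ->; rewrite subrr.
Qed.

Lemma RID D f h : lmset D -> rint D f -> rint D h ->
  RI D (fun x => f x + h x) = RI D f + RI D h.
Proof. exact: RintegralD. Qed.

Lemma RIZ D k f : lmset D -> rint D f -> RI D (fun x => k * f x) = k * RI D f.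
Proof. by move=> mD fi; rewrite /RI RintegralZl. Qed.

Lemma le_RI D f h : lmset D -> rint D f -> rint D h ->
  (forall x, D x -> f x <= h x) -> RI D f <= RI D h.
Proof. exact: le_Rintegral. Qed.

Lemma RI_ge0 D f : (forall x, D x -> 0 <= f x) -> 0 <= RI D f.
Proof. by move=> f0; exact: (@Rintegral_ge0 _ (measurableTypeR R) R leb D f f0). Qed.

Lemma eq_RI D f h : (forall x, D x -> f x = h x) -> RI D f = RI D h.
Proof. by move=> fh; apply: (@eq_Rintegral _ (measurableTypeR R)) => x /set_mem /fh. Qed.

Lemma eq_rint D f h : lmset D -> (forall x, D x -> f x = h x) ->
  rint D f -> rint D h.
Proof. by move=> mD fh; apply: eq_integrable => // x /set_mem /fh /= ->. Qed.

Lemma RI_fin D f : lmset D -> rint D f ->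
  (\int[leb]_(x in D) (f x)%:E)%E = (RI D f)%:E.
Proof.
by move=> mD fi; rewrite /RI /Rintegral fineK//; exact: integrable_fin_num.
Qed.

Lemma RI_setU D1 D2 f : lmset D1 -> lmset D2 ->
  rint (D1 `|` D2) f -> (forall x, D1 x -> D2 x -> False) ->
  RI (D1 `|` D2) f = RI D1 f + RI D2 f.
Proof.
move=> m1 m2 fi dis; rewrite /RI Rintegral_setU//.
by apply/disj_setPS => x [] /= /dis.
Qed.

Lemma RI_sub D D' f : lmset D -> lmset D' -> D' `<=` D ->
  rint D f -> (forall x, D x -> 0 <= f x) -> RI D' f <= RI D f.
Proof.
move=> mD mD' sD fi f0.
have fi' := rintS mD mD' sD fi.
rewrite -lee_fin -!RI_fin//; apply: ge0_subset_integral => //.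
exact: measurable_int fi.
Qed.

Lemma RI_cat x y z f : x <= y -> y <= z -> rint `[x, z] f ->
  RI `[x, z] f = RI `[x, y] f + RI `[y, z] f.
Proof.
move=> xy yz fi.
have fi1 : rint `]y, z] f.
  apply: rintS fi => //; apply: subset_itvr; rewrite bnd_simp //.
have : RI `[x, z] f - RI `[x, y] f = RI `]y, z] f.
  by apply: Rintegral_itvB => //; rewrite bnd_simp.
rewrite /RI (Rintegral_itv_obnd_cbnd fi1) => <-; lra.
Qed.

Lemma RI_abs D f : lmset D -> rint D f -> `|RI D f| <= RI D (fun x => `|f x|).
Proof. exact: le_normr_Rintegral. Qed.

Lemma rint_abs D f : lmset D -> rint D f -> rint D (fun x => `|f x|).
Proof. by move=> mD /(integrable_abse). Qed.

Lemma rint_of_bound D f (C : R) : lmset D -> lmfun D f ->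
  (forall x, D x -> 0 <= f x) -> (\int[leb]_(x in D) (f x)%:E <= C%:E)%E ->
  rint D f /\ RI D f <= C.
Proof.
move=> mD mf f0 ip; have fi : rint D f.
  apply/integrableP; split; first exact/measurable_EFinP.
  suff -> : (\int[leb]_(x in D) `|(EFin \o f) x| = \int[leb]_(x in D) (f x)%:E)%E.
    by rewrite (le_lt_trans ip)// ltry.
  apply: (@eq_integral _ (measurableTypeR R)) => x /set_mem Dx /=.
  by rewrite ger0_norm// f0.
by split => //; rewrite -lee_fin -RI_fin.
Qed.

(** Monotone convergence along the exhaustion by [[0, n]]; it gives integrability on a half-line
    from uniform bounds on compact pieces. *)
Lemma RI_bounded D f (C : R) : lmset D -> lmfun D f ->
  (forall x, D x -> 0 <= x) -> (forall x, D x -> 0 <= f x) ->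
  (forall n : nat, rint (D `&` `[0, n%:R]) f /\ RI (D `&` `[0, n%:R]) f <= C) ->
  rint D f /\ RI D f <= C.
Proof.
move=> mD mf D0 f0 H.
have DE : D = \bigcup_(n : nat) (D `&` `[0, n%:R]).
  apply/seteqP; split=> [x Dx|x [n _ []]//].
  exists (Num.truncn x).+1 => //; split => //=; rewrite in_itv/= D0//=.
  by apply/ltW; have /andP[] := truncn_itv (D0 _ Dx).
have ip : (\int[leb]_(x in D) (f x)%:E <= C%:E)%E.
  have ndF : {homo (fun n : nat => D `&` `[0, n%:R]) : n m / (n <= m)%N >-> (n <= m)%O}.
    move=> n m nm; apply/subsetPset => x [Dx] /=; rewrite !in_itv/= => /andP[-> xn]; split => //.
    by rewrite (le_trans xn)// ler_nat.
  rewrite [X in integral _ X]DE.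
  have mFn n : lmset (D `&` `[0, n%:R]) by exact: measurableI.
  have fn0 n x : (D `&` `[0, n%:R]) x -> (0 <= (EFin \o f) x)%E.
    by case=> Dx _; rewrite /= lee_fin f0.
  have mfn n : lmfun (D `&` `[0, n%:R]) (EFin \o f).
    by apply/measurable_EFinP; apply: (measurable_funS mD _ mf) => x [].
  have /cvg_lim <- // := @ge0_nondecreasing_set_cvg_integral _ (measurableTypeR R)
    R _ (EFin \o f) leb ndF mFn mfn fn0.
  apply: lime_le.
    apply: ereal_nondecreasing_is_cvgn.
    exact: (@ge0_nondecreasing_set_nondecreasing_integral _ (measurableTypeR R)
      R _ (EFin \o f) leb ndF mFn mfn fn0).
  near=> n; have [Hi HC] := H n.
  by rewrite RI_fin.
exact: rint_of_bound.
Unshelve. all: by end_near. Qed.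

End Integration.

(** * Weak derivatives and calibrations *)

Section WeakDerivative.
Context {R : realType}.
Implicit Types (D : set R) (f h u g psi Psi : R -> R) (x y z s t : R).

(* Common abstraction of [0, l] and [0, +oo[. *)
Definition hdom D := [/\ lmset D, D 0, (forall x, D x -> 0 <= x) &
  forall x y, D x -> 0 <= y <= x -> D y].

(** Square integrability of [u] is left out on purpose: functions frozen beyond a cut point, hence
    constant up to infinity, must qualify. *)
Definition wpair D u g := [/\ lmfun D g, rint D (fun x => g x ^+ 2) &
  forall x, D x -> u x = u 0 + RI `[0, x] g].

Lemma hdom_seg D x y : hdom D -> 0 <= x -> D y -> `[x, y] `<=` D.
Proof.
move=> [_ _ _ Dd] x0 Dy z /=; rewrite in_itv/= => /andP[xz zy].
by apply: Dd Dy _; rewrite zy andbT (le_trans x0).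
Qed.

Lemma rint_seg D f x y : hdom D -> 0 <= x -> D y -> rint D f -> rint `[x, y] f.
Proof. by move=> hD x0 Dy; apply: rintS => //; [case: hD|exact: hdom_seg]. Qed.

Lemma RI_seg D f x y : hdom D -> 0 <= x -> D y -> rint D f ->
  (forall z, D z -> 0 <= f z) -> RI `[x, y] f <= RI D f.
Proof. by move=> hD x0 Dy; apply: RI_sub => //; [case: hD|exact: hdom_seg]. Qed.

Lemma wpair_rint D u g x y : hdom D -> wpair D u g -> 0 <= x -> D y ->
  rint `[x, y] g.
Proof.
move=> hD [mg g2 _] x0 Dy.
have mD : lmset D by case: hD.
apply: (@rint_le _ _ _ (fun z => g z ^+ 2 + 1)) => //.
- by apply: (measurable_funS mD _ mg); exact: hdom_seg.
- by move=> z _; rewrite ler_norml; apply/andP; split; nra.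
- by apply: rintD => //; [exact: rint_seg g2|exact: rint_cst].
Qed.

Lemma wpair_incr D u g x y : hdom D -> wpair D u g -> 0 <= x -> x <= y -> D y ->
  u y - u x = RI `[x, y] g.
Proof.
move=> hD hp x0 xy Dy; have [_ _ U] := hp.
have Dx : D x by case: hD => _ _ _; apply; [exact: Dy|rewrite x0].
rewrite (U _ Dy) (U _ Dx) (@RI_cat _ 0 x y)//; first lra.
exact: wpair_rint hp _ Dy.
Qed.

(** Cauchy-Schwarz in parametric form: integrate [|g| <= s g^2 + 1/s]. The parameter is optimized by
    each caller, so no square root appears. *)
Lemma wpair_incr_le D u g x y s : hdom D -> wpair D u g -> 0 < s ->
  0 <= x -> x <= y -> D y ->
  `|u y - u x| <= s * RI D (fun z => g z ^+ 2) + (y - x) / s.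
Proof.
move=> hD hp s0 x0 xy Dy; rewrite (wpair_incr hD hp)//.
have gi := wpair_rint hD hp x0 Dy.
have [_ g2 _] := hp.
have g2i := rint_seg hD x0 Dy g2.
apply: (le_trans (RI_abs _ gi)) => //.
have ms : lmset (`[x, y] : set R) by [].
apply: (@le_trans _ _ (RI `[x, y] (fun z => s * g z ^+ 2 + s^-1))).
  apply: le_RI => //; first exact: rint_abs.
    by apply: rintD => //; [exact: rintZ|exact: rint_cst].
  move=> z _; rewrite -(ler_pM2l s0) mulrDr divff ?gt_eqF//.
  rewrite -[X in X * `| _ |](gtr0_norm s0) -normrM ler_norml; apply/andP; split; nra.
rewrite RID//; [|exact: rintZ|exact: rint_cst].
rewrite RIZ// RI_cst// [s^-1 * _]mulrC lerD2r ler_pM2l//.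
by apply: RI_seg => // z _; rewrite sqr_ge0.
Qed.

(** The modulus depends only on the bound [B], so a sequence with bounded gradients is
    equicontinuous. Taking [s = e / (2 (B + 1))] makes each of the two terms of [wpair_incr_le] at
    most [e / 2]. *)
Lemma wpair_ucont D u g (B e : R) : hdom D -> wpair D u g ->
  RI D (fun z => g z ^+ 2) <= B -> 0 < e -> forall x y, D x -> D y ->
  `|y - x| <= e ^+ 2 / (4 * (B + 1)) -> `|u y - u x| <= e.
Proof.
move=> hD hp AB e0.
have A0 : 0 <= RI D (fun z => g z ^+ 2) by apply: RI_ge0 => x _; rewrite sqr_ge0.
suff H x y : D x -> D y -> x <= y -> y - x <= e ^+ 2 / (4 * (B + 1)) ->
    `|u y - u x| <= e.
  move=> x y Dx Dy; case: (leP x y) => xy.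
    by rewrite ger0_norm ?subr_ge0//; exact: H.
  by rewrite ltr0_norm ?subr_lt0// opprB distrC; apply: H => //; exact: ltW.
move=> Dx Dy xy d; have B1 : 0 < B + 1 by lra.
have s0 : 0 < e / (2 * (B + 1)) by rewrite divr_gt0// mulr_gt0.
have x0 : 0 <= x by case: hD => _ _ + _; apply.
have := wpair_incr_le hD hp s0 x0 xy Dy.
set A := RI D _ in AB A0 *.
move/le_trans; apply.
rewrite [leRHS](_ : e = e / 2 + e / 2); last by field.
rewrite lerD//.
  rewrite mulrAC ler_pdivrMr ?mulr_gt0//.
  have -> : e / 2 * (2 * (B + 1)) = e * (B + 1) by field.
  rewrite ler_pM2l//; lra.
rewrite ler_pdivrMr//; apply: (le_trans d).
rewrite le_eqVlt; apply/orP; left; apply/eqP; field.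
by rewrite gt_eqF.
Qed.

Lemma ucont_within D f :
  (forall x e, D x -> 0 < e -> exists2 d, 0 < d & forall y, D y -> `|y - x| < d -> `|f y - f x| <= e) ->
  {within D, continuous f}.
Proof.
move=> H; rewrite continuous_subspace_in => x /set_mem Dx.
apply/cvgrPdist_le => e e0; have [d d0 Hd] := H _ _ Dx e0.
rewrite /= /prop_near1 -nbhs_subspace_in//; apply/nbhs_ballP; exists d => // y yd Dy.
by rewrite distrC; apply: Hd => //; rewrite distrC.
Qed.

Lemma wpair_within D u g : hdom D -> wpair D u g -> {within D, continuous u}.
Proof.
move=> hD hp; apply: ucont_within => x e Dx e0.
have A0 : 0 <= RI D (fun z => g z ^+ 2) by apply: RI_ge0 => z _; rewrite sqr_ge0.
exists (e ^+ 2 / (4 * (RI D (fun z => g z ^+ 2) + 1))).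
  by rewrite divr_gt0 ?exprn_gt0//; lra.
move=> y Dy /ltW yx; exact: (wpair_ucont hD hp (lexx _) e0 Dx Dy yx).
Qed.

Lemma wpair_meas D u g : hdom D -> wpair D u g -> lmfun D u.
Proof.
move=> hD hp; apply: subspace_continuous_measurable_fun; first by case: hD.
exact: wpair_within hp.
Qed.

(** Monotonicity is local: the supremum of the points [s] with [f x <= f s] belongs to this set, and
    unless it is [y] the local hypothesis pushes it further. *)
Lemma local_nondecreasing f x y : x <= y ->
  (forall z, x <= z <= y -> exists2 d, 0 < d & forall s t, x <= s -> s <= t ->
     t <= y -> `|s - z| < d -> `|t - z| < d -> f s <= f t) ->
  f x <= f y.
Proof.
move=> xy H.
pose S := [set s | x <= s <= y /\ f x <= f s].
have Sx : S x by split; rewrite ?lexx ?xy.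
have hS : has_sup S.
  by split; [exists x|exists y => s [] /andP[]].
have xs : x <= sup S by apply: ub_le_sup => //; case: hS.
have sy : sup S <= y by apply: ge_sup; [exists x|move=> s [] /andP[]].
have [d d0 Hd] := H (sup S) (introT andP (conj xs sy)).
have [s [/andP[xs' sy'] fs] ds] := sup_adherent d0 hS.
have ssup : s <= sup S by apply: ub_le_sup; [case: hS|split => //; rewrite xs'].
have fsup : f x <= f (sup S).
  apply: (le_trans fs); apply: Hd => //; last by rewrite subrr normr0.
  by rewrite ler0_norm ?subr_le0//; lra.
case: (eqVneq (sup S) y) => [<-//|sny].
have {sny sy}sy : sup S < y by rewrite lt_neqAle sny.
pose t := Num.min y (sup S + d / 2).
have ts : sup S < t by rewrite lt_min sy/=; lra.
have ty : t <= y by rewrite ge_min lexx.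
have : t <= sup S.
  apply: ub_le_sup; first by case: hS.
  split; first by rewrite ty andbT (le_trans xs)// ltW.
  apply: (le_trans fsup); apply: Hd => //; first exact: ltW.
    by rewrite subrr normr0.
  have : t <= sup S + d / 2 by rewrite ge_min lexx orbT.
  rewrite gtr0_norm ?subr_gt0//; lra.
by rewrite leNgt ts.
Qed.

(** [Psi' = psi] is only used through a mean value inequality; the quadratic bound makes [psi |u|]
    square integrable as soon as [u] is. *)
Definition calibration (C : R) psi Psi := [/\ continuous psi,
  (forall s t, 0 <= s -> s <= t ->
     exists2 c, s <= c <= t & `|Psi t - Psi s| <= `|psi c| * (t - s)) &
  forall t, 0 <= t -> psi t ^+ 2 <= C * t ^+ 2].

Definition action psi u g x := g x ^+ 2 / 2 + psi `|u x| ^+ 2 / 2.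

Lemma action_rint D u g C psi Psi : hdom D -> wpair D u g ->
  rint D (fun x => u x ^+ 2) -> calibration C psi Psi ->
  rint D (fun x => psi `|u x| ^+ 2) /\ rint D (action psi u g).
Proof.
move=> hD hp u2 [cpsi _ psiC].
have mD : lmset D by case: hD.
have P2 : rint D (fun x => psi `|u x| ^+ 2).
  apply: (@rint_le _ _ _ (fun x => C * u x ^+ 2)) => //; last exact: rintZ.
    apply: measurable_funX; apply: measurableT_comp.
      exact: continuous_measurable_fun.
    by apply: measurableT_comp => //; exact: wpair_meas hp.
  move=> x Dx; rewrite ger0_norm ?sqr_ge0//.
  by rewrite (le_trans (psiC _ _))// real_normK ?num_real.
split => //; apply: (@eq_rint _ _ (fun x => 2^-1 * g x ^+ 2 + 2^-1 * psi `|u x| ^+ 2)) => //.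
  by move=> x _; rewrite /action; field.
by apply: rintD => //; apply: rintZ => //; case: hp.
Qed.

Lemma action_ge0 psi u g x : 0 <= action psi u g x.
Proof. by rewrite addr_ge0// divr_ge0// sqr_ge0. Qed.

(* Young's inequality replaces the chain rule: up to an arbitrarily small slope, the
   increment of [Psi |u|] is dominated by the action on small intervals. *)
Lemma calibration_incr D u g C psi Psi x y : hdom D -> wpair D u g ->
  rint D (fun x => u x ^+ 2) -> calibration C psi Psi ->
  0 <= x -> x <= y -> D y ->
  `|Psi `|u y| - Psi `|u x| | <= RI `[x, y] (action psi u g).
Proof.
move=> hD hp u2 cal x0 xy Dy.
have [_ Ti] := action_rint hD hp u2 cal.
have [cpsi MV psiC] := cal.
have [_ g2 _] := hp.
(* The sign [(-1) ^+ b] treats both inequalities hidden in the absolute value at once; the slope [e]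
   is arbitrary and then removed. *)
suff H (e : R) (b : bool) : 0 < e -> (-1) ^+ b * (Psi `|u y| - Psi `|u x|)
    <= RI `[x, y] (action psi u g) + e * (y - x).
  have H' (b : bool) : (-1) ^+ b * (Psi `|u y| - Psi `|u x|) <= RI `[x, y] (action psi u g).
    rewrite leNgt; apply/negP => lt.
    have yx1 : 0 < y - x + 1 by lra.
    set a := (_ * _) in lt; set c := RI _ _ in lt.
    have e0 : 0 < (a - c) / (y - x + 1) by rewrite divr_gt0// subr_gt0.
    have := H _ b e0; rewrite -/a -/c => h.
    have : (a - c) / (y - x + 1) * (y - x) < a - c.
      rewrite mulrAC ltr_pdivrMr// ltr_pM2l ?subr_gt0//; lra.
    lra.
  have := H' false; have := H' true; rewrite expr0 expr1 ler_norml => h1 h2.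
  by apply/andP; split; lra.
move=> e0.
pose F z := RI `[0, z] (action psi u g) + e * z - (-1) ^+ b * Psi `|u z|.
have Fcat z : x <= z <= y -> RI `[0, z] (action psi u g) =
    RI `[0, x] (action psi u g) + RI `[x, z] (action psi u g).
  move=> /andP[xz zy]; apply: RI_cat => //.
  by apply: (rint_seg hD _ _ Ti) => //; case: hD => _ _ _; apply; [exact: Dy|rewrite zy (le_trans x0)].
suff : F x <= F y.
  rewrite /F (Fcat y) ?lexx ?xy// => h; rewrite mulrBr mulrBr.
  move: h; set p := RI _ _; set q := RI _ _; set a := (_ * Psi _); set c := (_ * Psi _).
  nra.
apply: local_nondecreasing => // z /andP[xz zy].
have Dz : D z by case: hD => _ _ _; apply; [exact: Dy|rewrite zy (le_trans x0)].
have p2c : {for `|u z|, continuous (fun t => psi t ^+ 2)}.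
  by apply: (@continuous_comp _ _ _ psi (fun r => r ^+ 2)); [exact: cpsi|exact: exprn_continuous].
have /cvgrPdist_le/(_ e e0)/nbhs_ballP[d /= d0 Hd] := p2c.
have A0 : 0 <= RI D (fun z => g z ^+ 2) by apply: RI_ge0 => w _; rewrite sqr_ge0.
have d20 : 0 < d / 2 by lra.
exists ((d / 2) ^+ 2 / (4 * (RI D (fun z => g z ^+ 2) + 1))).
  by rewrite divr_gt0 ?exprn_gt0//; lra.
move=> s t xs st ty sd td.
have Dw w : x <= w -> w <= y -> D w.
  by move=> xw wy; case: hD => _ _ _; apply; [exact: Dy|rewrite wy (le_trans x0)].
have uc w : x <= w -> w <= y -> `|w - z| < (d / 2) ^+ 2 / (4 * (RI D (fun z => g z ^+ 2) + 1)) ->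
    `| `|u w| - `|u z| | < d.
  move=> xw wy /ltW wd; apply: (le_lt_trans (ler_dist_dist _ _)).
  by apply: (le_lt_trans (wpair_ucont hD hp (lexx _) d20 Dz (Dw _ xw wy) wd)); lra.
have xt := le_trans xs st; have sy := le_trans st ty.
have us := uc s xs sy sd; have ut := uc t xt ty td.
have Ds := Dw _ xs sy; have Dt := Dw _ xt ty.
have s0 := le_trans x0 xs.
have ms : lmset (`[s, t] : set R) by [].
have Tst := rint_seg hD s0 Dt Ti.
have g2st := rint_seg hD s0 Dt g2.
have gst := wpair_rint hD hp s0 Dt.
(* Both [c] and the values [|u w|] on [[s, t]] are within [d] of [|u z|], so [psi c ^+ 2] and
   [psi |u w| ^+ 2] differ by at most [2 e], which halving turns into [e]. *)
have [c cb cMV] : exists2 c, `|c - `|u z| | < d &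
    `|Psi `|u t| - Psi `|u s| | <= `|psi c| * `| `|u t| - `|u s| |.
  case: (leP `|u s| `|u t|) => h.
    have [c /andP[c1 c2] Hc] := MV _ _ (normr_ge0 _) h.
    exists c; last by rewrite [X in _ * X]ger0_norm ?subr_ge0.
    move: us ut; rewrite !ltr_norml => /andP[? ?] /andP[? ?]; apply/andP; split; lra.
  have [c /andP[c1 c2] Hc] := MV _ _ (normr_ge0 _) (ltW h).
  exists c; last by rewrite distrC [X in _ * X]ltr0_norm ?subr_lt0// opprB.
  move: us ut; rewrite !ltr_norml => /andP[? ?] /andP[? ?]; apply/andP; split; lra.
have key : `|Psi `|u t| - Psi `|u s| | <= RI `[s, t] (action psi u g) + e * (t - s).
  apply: (le_trans cMV).
  apply: (@le_trans _ _ (RI `[s, t] (fun w => g w ^+ 2 / 2 + psi c ^+ 2 / 2))).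
    apply: (@le_trans _ _ (`|psi c| * RI `[s, t] (fun w => `|g w|))).
      apply: ler_wpM2l => //; apply: (le_trans (ler_dist_dist _ _)).
      by rewrite (wpair_incr hD hp)//; exact: RI_abs.
    rewrite -RIZ//; last exact: rint_abs.
    apply: le_RI => //.
    - by apply: rintZ => //; exact: rint_abs.
    - apply: rintD => //; last exact: rint_cst.
      by apply: (@eq_rint _ _ (fun w => 2^-1 * g w ^+ 2)) => // [w _|]; [rewrite mulrC|exact: rintZ].
    - move=> w _; have := sqr_ge0 (`|psi c| - `|g w|).
      rewrite -[g w ^+ 2]real_normK ?num_real// -[psi c ^+ 2]real_normK ?num_real//; nra.
  rewrite -(@RI_cst _ s t) // -RID//; last exact: rint_cst.
  apply: le_RI => //.
  - apply: rintD => //; last exact: rint_cst.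
    by apply: (@eq_rint _ _ (fun w => 2^-1 * g w ^+ 2)) => // [w _|]; [rewrite mulrC|exact: rintZ].
  - by apply: rintD => //; exact: rint_cst.
  - move=> w; rewrite /= in_itv/= => /andP[sw wt].
    have xw := le_trans xs sw; have wy := le_trans wt ty.
    have wd : `|w - z| < (d / 2) ^+ 2 / (4 * (RI D (fun z => g z ^+ 2) + 1)).
      move: sd td; rewrite !ltr_norml => /andP[? ?] /andP[? ?]; apply/andP; split; lra.
    have uw := uc w xw wy wd.
    have h1 : `|psi `|u z| ^+ 2 - psi c ^+ 2| <= e by apply: Hd; rewrite /ball/= distrC.
    have h2 : `|psi `|u z| ^+ 2 - psi `|u w| ^+ 2| <= e by apply: Hd; rewrite /ball/= distrC.
    rewrite /action; move: h1 h2; rewrite !ler_norml => /andP[? ?] /andP[? ?]; lra.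
have Fst : RI `[0, t] (action psi u g) = RI `[0, s] (action psi u g) + RI `[s, t] (action psi u g).
  by apply: RI_cat => //; exact: (rint_seg hD _ Dt Ti).
have key2 : (-1) ^+ b * (Psi `|u t| - Psi `|u s|) <= RI `[s, t] (action psi u g) + e * (t - s).
  apply: le_trans key; rewrite -[leRHS]mul1r.
  by rewrite -[X in X * `|_|](normr_sign R b) -normrM ler_norm.
rewrite /F Fst; move: key2; rewrite mulrBr.
set p := RI _ _; set q := RI _ _; set a := (_ * Psi _); set c' := (_ * Psi _).
nra.
Qed.

End WeakDerivative.

(** * Weak compactness in L2 *)

Section RieszFischer.
Context {R : realType}.
Implicit Types (D : set R) (f h u g : R -> R) (x y z s t : R).
Local Notation leb := (@lebesgue_measure R).

Definition dyadic (j : nat) : R := 2^-1 ^+ j.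

Lemma dyadic_gt0 j : 0 < dyadic j. Proof. by rewrite exprn_gt0// invr_gt0. Qed.

Lemma dyadic_le1 j : dyadic j <= 1.
Proof. by rewrite exprn_ile1// ?invr_ge0// invf_le1// ler1n. Qed.

Lemma dyadicS j : dyadic j = 2 * dyadic j.+1.
Proof. by rewrite /dyadic exprS mulrA divff ?mul1r// pnatr_eq0. Qed.

Lemma dyadic_small (e : R) : 0 < e -> exists J, forall j, (J <= j)%N -> dyadic j <= e.
Proof.
move=> e0; have z1 : `|2^-1 : R| < 1 by rewrite ger0_norm ?invr_ge0// invf_lt1// ltr1n.
have /cvgrPdist_le/(_ e e0)[J _ HJ] := cvg_expr z1.
by exists J => j /HJ /=; rewrite sub0r normrN ger0_norm// ltW// dyadic_gt0.
Qed.

(** The intervals of centre [a j] and radius [2 c dyadic j] are nested; the limit is the supremum of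
    their lower ends. *)
Lemma fast_cauchy (a : nat -> R) (c : R) : 0 <= c ->
  (forall j, `|a j.+1 - a j| <= c * dyadic j) ->
  exists l, forall j, `|a j - l| <= 2 * c * dyadic j.
Proof.
move=> c0 H.
have nd i k : a i - 2 * c * dyadic i <= a (i + k)%N - 2 * c * dyadic (i + k).
  elim: k => [|k IH]; first by rewrite addn0.
  rewrite addnS (le_trans IH)//; have := H (i + k)%N; rewrite ler_norml => /andP[h _].
  have := dyadicS (i + k); nra.
have ni i k : a (i + k)%N + 2 * c * dyadic (i + k) <= a i + 2 * c * dyadic i.
  elim: k => [|k IH]; first by rewrite addn0.
  rewrite addnS (le_trans _ IH)//; have := H (i + k)%N; rewrite ler_norml => /andP[_ h].
  have := dyadicS (i + k); nra.
have lu i k : a i - 2 * c * dyadic i <= a k + 2 * c * dyadic k.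
  apply: (le_trans (nd i k)); apply: le_trans (ni k i); rewrite addnC.
  have := mulr_ge0 c0 (ltW (dyadic_gt0 (k + i))); nra.
pose S := [set a i - 2 * c * dyadic i | i in [set: nat]].
have S0 : S !=set0 by exists (a 0%N - 2 * c * dyadic 0), 0%N.
have hS : has_sup S.
  by split => //; exists (a 0%N + 2 * c * dyadic 0) => _ [i _ <-].
exists (sup S) => j; rewrite ler_distl; apply/andP; split.
  by rewrite lerBlDr; apply: ge_sup => // _ [i _ <-].
have : a j - 2 * c * dyadic j <= sup S by apply: ub_le_sup; [case: hS|exists j].
lra.
Qed.

(** The rate [dyadic j ^+ 4] leaves room for the weights [dyadic j ^- 2]: the series [w] of weighted
    squared increments still has integral at most 2. Where [w] is finite the increments are at most
    [sqrt w * dyadic j], so [h j] converges pointwise with an explicit rate that integrates back to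
    the L2 bound. *)
Lemma riesz_fischer D (h : nat -> R -> R) : lmset D ->
  (forall j, lmfun D (h j)) -> (forall j, rint D (fun x => h j x ^+ 2)) ->
  (forall j, RI D (fun x => (h j.+1 x - h j x) ^+ 2) <= dyadic j ^+ 4) ->
  exists2 g : R -> R, lmfun D g & forall j, rint D (fun x => (h j x - g x) ^+ 2) /\
    RI D (fun x => (h j x - g x) ^+ 2) <= 8 * dyadic j ^+ 2.
Proof.
move=> mD mh h2 Hh.
have mB (f1 f2 : R -> R) : lmfun D f1 -> lmfun D f2 -> lmfun D (fun x => (f1 x - f2 x) ^+ 2).
  by move=> m1 m2; apply: measurable_funX; exact: measurable_funB.
have hd j : rint D (fun x => (h j.+1 x - h j x) ^+ 2).
  apply: (@rint_le _ _ _ (fun x => 2 * h j.+1 x ^+ 2 + 2 * h j x ^+ 2)) => //.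
  - exact: mB.
  - move=> x _; rewrite ger0_norm ?sqr_ge0//.
    have := sqr_ge0 (h j.+1 x + h j x); nra.
  - by apply: rintD => //; exact: rintZ.
pose T j x := (dyadic j ^- 2 * (h j.+1 x - h j x) ^+ 2)%:E.
have T0 j x : (0 <= T j x)%E.
  by rewrite lee_fin mulr_ge0 ?sqr_ge0// invr_ge0 sqr_ge0.
have mT j : lmfun D (T j).
  by apply/measurable_EFinP; apply: measurable_funM => //; exact: mB.
pose w x := (\sum_(0 <= j <oo) T j x)%E.
have mw : lmfun D w by apply: (@ge0_emeasurable_sum _ (measurableTypeR R)) => // k x _ _; exact: T0.
have w0 x : (0 <= w x)%E by apply: nneseries_ge0 => j _ _; exact: T0.
have iw : (\int[leb]_(x in D) w x <= 2%:E)%E.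
  rewrite /w (@integral_nneseries _ (measurableTypeR R))//.
  apply: lime_le.
    by apply: is_cvg_nneseries => j _ _; apply: integral_ge0 => x _; exact: T0.
  apply: nearW => n.
  suff : (\sum_(0 <= j < n) \int[leb]_(x in D) T j x <= (2 - 2 * dyadic n)%:E)%E.
    by move/le_trans; apply; rewrite lee_fin; have := dyadic_gt0 n; lra.
  elim: n => [|n IH]; first by rewrite big_geq// lee_fin /dyadic expr0; lra.
  rewrite big_nat_recr//= (le_trans (leeD2r _ IH))//.
  rewrite RI_fin//; last exact: rintZ.
  rewrite RIZ// -EFinD lee_fin.
  have : dyadic n ^- 2 * RI D (fun x => (h n.+1 x - h n x) ^+ 2) <= dyadic n ^+ 2.
    rewrite ler_pdivrMl ?exprn_gt0 ?dyadic_gt0//; apply: (le_trans (Hh n)).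
    by rewrite -exprD.
  have := dyadicS n; have := dyadic_gt0 n; have := dyadic_le1 n; nra.
pose g x := fine (limn_esup (fun j => (h j x)%:E)).
have mg : lmfun D g.
  apply: measurableT_comp => //; apply: measurable_fun_limn_esup => j.
  exact/measurable_EFinP.
(* Where [w] is infinite the bound is trivial, so no null set has to be removed; elsewhere the upper
   limit in [g] is the actual limit. *)
have key j x : D x -> (((h j x - g x) ^+ 2)%:E <= (4 * dyadic j ^+ 2)%:E * w x)%E.
  move=> Dx; have [wy|] := eqVneq (w x) +oo%E.
    by rewrite wy mulry gtr0_sg ?mulr_gt0 ?exprn_gt0 ?dyadic_gt0// mul1e leey.
  move=> wy; have wf : w x \is a fin_num by rewrite ge0_fin_numE// ltey.
  have Tw i : (T i x <= w x)%E.
    apply: (@le_trans _ _ (\sum_(0 <= k < i.+1) T k x)%E).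
      rewrite big_nat_recr//= leeDr//; apply: sume_ge0 => k _; exact: T0.
    by apply: nneseries_lim_ge => k _ _; exact: T0.
  set W := fine (w x).
  have W0 : 0 <= W by rewrite fine_ge0.
  have step i : `|h i.+1 x - h i x| <= Num.sqrt W * dyadic i.
    rewrite -(@ler_pXn2r _ 2)// ?nnegrE ?mulr_ge0 ?sqrtr_ge0 ?(ltW (dyadic_gt0 _))//.
    rewrite exprMn sqr_sqrtr// real_normK ?num_real//.
    have := Tw i; rewrite -(fineK wf) lee_fin -/W ler_pdivrMl ?exprn_gt0 ?dyadic_gt0//.
    by rewrite mulrC.
  have [l Hl] := fast_cauchy (sqrtr_ge0 W) step.
  have gl : g x = l.
    rewrite /g; suff -> : limn_esup (fun j => (h j x)%:E) = l%:E by [].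
    suff /cvg_limn_einf_sup[_ ->] : (h j x)%:E @[j --> \oo] --> l%:E by [].
    apply: cvg_EFin; first exact: nearW.
    apply/cvgrPdist_le => e e0.
    have c0 : 0 < 2 * Num.sqrt W + 1 by have := sqrtr_ge0 W; lra.
    have [J HJ] := dyadic_small (divr_gt0 e0 c0).
    exists J => // i /= /HJ; rewrite ler_pdivlMr// => h1.
    rewrite distrC (le_trans (Hl i))//; have := dyadic_gt0 i; lra.
  rewrite gl -(fineK wf) -/W -EFinM lee_fin -[leLHS]real_normK ?num_real//.
  have -> : 4 * dyadic j ^+ 2 * W = (2 * Num.sqrt W * dyadic j) ^+ 2.
    by rewrite !exprMn sqr_sqrtr// mulrAC -natrX.
  by rewrite ler_pXn2r// nnegrE ?normr_ge0// !mulr_ge0 ?sqrtr_ge0 ?(ltW (dyadic_gt0 _)).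
exists g => // j.
have ib : (\int[leb]_(x in D) ((h j x - g x) ^+ 2)%:E <= (8 * dyadic j ^+ 2)%:E)%E.
  apply: (@le_trans _ _ (\int[leb]_(x in D) ((4 * dyadic j ^+ 2)%:E * w x))%E).
    apply: ge0_le_integral => //=.
    - by move=> x _; rewrite lee_fin sqr_ge0.
    - by apply/measurable_EFinP; exact: (mB _ _ (mh j) mg).
    - exact: emeasurable_funM.
    - by move=> x Dx; exact: key.
  have c0 : 0 <= 4 * dyadic j ^+ 2 by rewrite mulr_ge0// sqr_ge0.
  have := @ge0_integralZl _ (measurableTypeR R) R leb D mD w mw
    (4 * dyadic j ^+ 2)%:E (fun x _ => w0 x).
  rewrite lee_fin => /(_ c0)/eqP; rewrite eq_le => /andP[/le_trans + _]; apply.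
  apply: (le_trans (lee_wpmul2l _ iw)) => //.
  by rewrite -EFinM lee_fin; lra.
apply: rint_of_bound => //; first exact: (mB _ _ (mh j) mg).
by move=> x _; rewrite sqr_ge0.
Qed.

End RieszFischer.

(** * Weak limits of derivatives under pointwise convergence of the functions *)

Section WeakLimit.
Context {R : realType}.
Local Notation dyad := (@dyadic R).
Implicit Types (D : set R) (f h u g : R -> R) (x y z s t : R).

Lemma rint_sqr_lin D a b g h : lmset D -> lmfun D g -> lmfun D h ->
  rint D (fun x => g x ^+ 2) -> rint D (fun x => h x ^+ 2) ->
  rint D (fun x => (a * g x + b * h x) ^+ 2).
Proof.
move=> mD mg mh g2 h2.
apply: (@rint_le _ _ _ (fun x => (2 * a ^+ 2) * g x ^+ 2 + (2 * b ^+ 2) * h x ^+ 2)) => //.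
- by apply: measurable_funX; apply: measurable_funD; apply: measurable_funM.
- move=> x _; rewrite ger0_norm ?sqr_ge0//.
  by have := sqr_ge0 (a * g x - b * h x); nra.
- by apply: rintD => //; exact: rintZ.
Qed.

Lemma wpair_lin D a b u g v h : hdom D -> wpair D u g -> wpair D v h ->
  wpair D (fun x => a * u x + b * v x) (fun x => a * g x + b * h x).
Proof.
move=> hD hp hq; have [mg g2 U] := hp; have [mh h2 V] := hq.
have mD : lmset D by case: hD.
split.
- by apply: measurable_funD; apply: measurable_funM.
- exact: rint_sqr_lin.
- move=> x Dx; have gi := wpair_rint hD hp (lexx 0) Dx.
  have hi := wpair_rint hD hq (lexx 0) Dx.
  rewrite RID//; [|exact: rintZ|exact: rintZ].
  by rewrite !RIZ// (U _ Dx) (V _ Dx); ring.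
Qed.

(** The primitive of [h - g] is itself a [wpair], so this is [wpair_incr_le] with [s = 1 / e]. *)
Lemma RI_L2_approx D g h x (A e : R) : hdom D -> lmfun D g -> lmfun D h ->
  rint D (fun x => (h x - g x) ^+ 2) -> rint D (fun x => g x ^+ 2) ->
  rint D (fun x => h x ^+ 2) -> D x -> 0 < e ->
  RI D (fun x => (h x - g x) ^+ 2) <= A -> 
  `|RI `[0, x] h - RI `[0, x] g| <= e^-1 * A + e * x.
Proof.
move=> hD mg mh d2 g2 h2 Dx e0 HA.
have mD : lmset D by case: hD.
have W f : lmfun D f -> rint D (fun x => f x ^+ 2) -> wpair D (fun y => RI `[0, y] f) f.
  move=> mf f2; split => // y Dy; rewrite [X in _ = X + _](_ : _ = 0) ?add0r//.
  by rewrite set_itv1 /RI Rintegral_set1.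
have := wpair_lin (-1) 1 hD (W _ mg g2) (W _ mh h2).
have e1 : 0 < e^-1 by rewrite invr_gt0.
have x0 : 0 <= x by case: hD => _ _ + _; apply.
move=> /(wpair_incr_le hD)/(_ e1 (lexx 0) x0 Dx).
rewrite !set_itv1 /= /RI !Rintegral_set1 !mulr0 addr0 !subr0 invrK mulN1r mul1r addrC [x * e]mulrC.
move/le_trans; apply; rewrite lerD2r ler_pM2l//; apply: le_trans HA.
rewrite le_eqVlt; apply/orP; left; apply/eqP; apply: eq_RI => z _; ring.
Qed.

Variables (n : nat) (D : 'I_n -> set R) (hD : forall e, hdom (D e)).
Local Notation fam := ('I_n -> R -> R).

Definition normsq (h : fam) := \sum_e RI (D e) (fun x => h e x ^+ 2).

Lemma normsq_ge0 (h : fam) : 0 <= normsq h.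
Proof. by apply: sumr_ge0 => e _; apply: RI_ge0 => x _; rewrite sqr_ge0. Qed.

Lemma normsq_parallelogram (a b : fam) :
  (forall e, lmfun (D e) (a e)) -> (forall e, lmfun (D e) (b e)) ->
  (forall e, rint (D e) (fun x => a e x ^+ 2)) ->
  (forall e, rint (D e) (fun x => b e x ^+ 2)) ->
  normsq (fun e x => a e x - b e x) = 2 * normsq a + 2 * normsq b
    - 4 * normsq (fun e x => 2^-1 * a e x + 2^-1 * b e x).
Proof.
move=> ma mb a2 b2; rewrite /normsq !mulr_sumr -big_split -sumrB /=.
apply: eq_bigr => e _; have mD : lmset (D e) by case: (hD e).
have i2 : rint (D e) (fun x => (2^-1 * a e x + 2^-1 * b e x) ^+ 2) by exact: rint_sqr_lin.
have d2 : rint (D e) (fun x => (a e x - b e x) ^+ 2).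
  apply: (@eq_rint _ _ (fun x => (1 * a e x + (-1) * b e x) ^+ 2)) => //.
    by move=> x _; congr (_ ^+ 2); ring.
  exact: rint_sqr_lin.
have : RI (D e) (fun x => (a e x - b e x) ^+ 2 + 4 * (2^-1 * a e x + 2^-1 * b e x) ^+ 2)
    = RI (D e) (fun x => 2 * a e x ^+ 2 + 2 * b e x ^+ 2).
  by apply: eq_RI => x _; field.
rewrite !RID//; [|exact: rintZ..].
rewrite !RIZ//; lra.
Qed.

(* Mazur's argument: the admissible derivatives near the limit form decreasing convex
   sets, and near-minimal elements are Cauchy in L2 by the parallelogram identity. *)
Lemma weak_limit (v h : nat -> fam) (u : fam) (B : R) :
  (forall k e, wpair (D e) (v k e) (h k e)) ->
  (forall e x, D e x -> forall r : R, 0 < r -> exists K, forall k, (K <= k)%N ->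
     `|v k e x - u e x| <= r) ->
  (forall r : R, 0 < r -> exists K, forall k, (K <= k)%N -> normsq (h k) <= B + r) ->
  exists2 g, (forall e, wpair (D e) (u e) (g e)) & normsq g <= B.
Proof.
move=> vh vu hB.
(* [C k] replaces the convex hull of the tail from [k] on: it retains every pointwise distance bound
   to [u] shared by that tail. It is visibly stable under midpoints and decreasing in [k], and no
   convex combinations need be handled. *)
pose C k (p : fam * fam) := (forall e, wpair (D e) (p.1 e) (p.2 e)) /\
  forall e x, D e x -> forall t, (forall j, (k <= j)%N -> `|v j e x - u e x| <= t) ->
    `|p.1 e x - u e x| <= t.
have Ch k j : (k <= j)%N -> C k (v j, h j).
  by move=> kj; split=> [e|e x Dx t] /=; [exact: vh|apply].
have CS k j p : (k <= j)%N -> C j p -> C k p.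
  move=> kj [p1 p2]; split=> [e|e x Dx t Ht]; first exact: p1.
  apply: p2 => // i ji.
  by apply: Ht; exact: leq_trans ji.
have Cmid k p q : C k p -> C k q ->
    C k ((fun e x => 2^-1 * p.1 e x + 2^-1 * q.1 e x),
         (fun e x => 2^-1 * p.2 e x + 2^-1 * q.2 e x)).
  move=> [p1 p2] [q1 q2]; split => [e|e x Dx t Ht] /=; first exact: wpair_lin.
  have := p2 e x Dx t Ht; have := q2 e x Dx t Ht.
  by rewrite !ler_norml => /andP[? ?] /andP[? ?]; apply/andP; split; lra.
pose A := [set a : R | exists k, forall p, C k p -> a <= normsq p.2].
have A0 : A 0 by exists 0%N => p _; exact: normsq_ge0.
have Aub : ubound A B.
  move=> a [k Hk]; apply/ler_addgt0Pr => r r0; have [K HK] := hB r r0.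
  apply: (@le_trans _ _ (normsq (h (maxn k K)))); last by apply: HK; rewrite leq_maxr.
  by apply: (Hk (_, _)) (Ch _ _ _); rewrite leq_maxl.
have hA : has_sup A by split; [exists 0|exists B].
set d := sup A.
have der_sub : d <= B by apply: ge_sup => //; exists 0.
have low (r : R) : 0 < r -> exists k, forall p, C k p -> d - r <= normsq p.2.
  move=> r0; have [a [k Hk] ad] := sup_adherent r0 hA.
  by exists k => p /Hk; exact: (le_trans (ltW ad)).
have high (r : R) k : 0 < r -> exists2 p, C k p & normsq p.2 <= d + r.
  move=> r0; apply: contrapT => hn.
  have : d + r <= d.
    apply: ub_le_sup; first by case: hA.
    exists k => p Cp; rewrite leNgt; apply/negP => /ltW hp; apply: hn; by exists p.
  lra.
(* With defect [dyad j ^+ 4 / 8] on both sides of [d], the parallelogram identity bounds the squared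
   distance of consecutive choices by eight defects, that is [dyad j ^+ 4], the rate asked by
   [riesz_fischer]. *)
have seq j : exists p, C j p /\
   (exists k, [/\ (j <= k)%N, C k p, normsq p.2 <= d + dyad j ^+ 4 / 8 &
     forall q, C k q -> d - dyad j ^+ 4 / 8 <= normsq q.2]).
  have r0 : 0 < dyad j ^+ 4 / 8 by rewrite divr_gt0// exprn_gt0// dyadic_gt0.
  have [k Hk] := low _ r0; have [p Cp Np] := high _ (maxn j k) r0.
  exists p; split => //; first by apply: CS Cp; rewrite leq_maxl.
  exists (maxn j k); split => //; first exact: leq_maxl.
  by move=> q Cq; apply: Hk; apply: CS Cq; rewrite leq_maxr.
have [p Hp] := choice seq.
have pw j e : wpair (D e) ((p j).1 e) ((p j).2 e) by have [[+ _] _] := Hp j; apply.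
have mD e : lmset (D e) by case: (hD e).
have mp j e : lmfun (D e) ((p j).2 e) by case: (pw j e).
have p2 j e : rint (D e) (fun x => (p j).2 e x ^+ 2) by case: (pw j e).
have cau j : normsq (fun e x => (p j.+1).2 e x - (p j).2 e x) <= dyad j ^+ 4.
  rewrite normsq_parallelogram//.
  have [_ [k [jk Ck Nk Lk]]] := Hp j; have [_ [k' [jk' Ck' Nk' Lk']]] := Hp j.+1.
  have dj : dyad j.+1 ^+ 4 <= dyad j ^+ 4.
    rewrite ler_pXn2r ?nnegrE ?(ltW (dyadic_gt0 _))//.
    by rewrite (@dyadicS R j); have := @dyadic_gt0 R j.+1; lra.
  have : d - dyad j ^+ 4 / 8 <= normsq (fun e x => 2^-1 * (p j.+1).2 e x + 2^-1 * (p j).2 e x).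
    case: (leqP k k') => kk.
      by have := Cmid _ _ _ (CS _ _ _ kk Ck') Ck => /Lk.
    have := Cmid _ _ _ Ck' (CS _ _ _ (ltnW kk) Ck) => /Lk' /=; lra.
  lra.
have cau1 e j : RI (D e) (fun x => ((p j.+1).2 e x - (p j).2 e x) ^+ 2) <= dyad j ^+ 4.
  apply: le_trans (cau j); rewrite /normsq (bigD1 e)//= lerDl.
  by apply: sumr_ge0 => i _; apply: RI_ge0 => x _; rewrite sqr_ge0.
have ex e : exists g : R -> R, lmfun (D e) g /\
    forall j, rint (D e) (fun x => ((p j).2 e x - g x) ^+ 2) /\
    RI (D e) (fun x => ((p j).2 e x - g x) ^+ 2) <= 8 * dyad j ^+ 2.
  have [g mg Hg] := riesz_fischer (mD e) (mp^~ e) (p2^~ e) (cau1 e).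
  by exists g.
have [g Hg] := choice ex.
have mg e : lmfun (D e) (g e) by case: (Hg e).
have d2 j e : rint (D e) (fun x => ((p j).2 e x - g e x) ^+ 2) by case: (Hg e) => _ /(_ j)[].
have db j e : RI (D e) (fun x => ((p j).2 e x - g e x) ^+ 2) <= 8 * dyad j ^+ 2.
  by case: (Hg e) => _ /(_ j)[].
have g2 e : rint (D e) (fun x => g e x ^+ 2).
  apply: (@eq_rint _ _ (fun x => (1 * (p 0%N).2 e x + (-1) * ((p 0%N).2 e x - g e x)) ^+ 2)) => //.
    by move=> x _; congr (_ ^+ 2); ring.
  by apply: rint_sqr_lin => //; apply: measurable_funB.
exists g.
  move=> e; split => // x Dx.
  have lim0 y : D e y -> forall r : R, 0 < r -> exists J, forall j, (J <= j)%N ->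
      `|(p j).1 e y - u e y| <= r.
    move=> Dy r r0; have [J HJ] := vu e y Dy r r0; exists J => j Jj.
    have [[_ +] _] := Hp j; apply => // i ji; apply: HJ; exact: leq_trans ji.
  have x0 : 0 <= x by case: (hD e) => _ _ + _; apply.
  have D0 : D e 0 by case: (hD e).
  apply/eqP; rewrite -subr_eq0 -normr_le0; apply/ler_addgt0Pr => r r0; rewrite add0r.
  have r40 : 0 < r / 4 by lra.
  have [J1 HJ1] := lim0 x Dx _ r40; have [J2 HJ2] := lim0 0 D0 _ r40.
  have s0 : 0 < r / (4 * (x + 1)) by rewrite divr_gt0//; lra.
  set s := r / (4 * (x + 1)) in s0.
  have sx : s * x <= r / 4.
    rewrite /s mulrAC ler_pdivrMr; last lra.
    by rewrite [leRHS](_ : _ = r * (x + 1)); [rewrite ler_pM2l//; lra|field].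
  have [J3 HJ3] := dyadic_small (divr_gt0 (mulr_gt0 r0 s0) (ltr0Sn R 31)).
  pose j := maxn J1 (maxn J2 J3).
  have h1 : `|(p j).1 e x - u e x| <= r / 4 by apply: HJ1; rewrite /j leq_max leqnn.
  have h2 : `|(p j).1 e 0 - u e 0| <= r / 4 by apply: HJ2; rewrite /j !leq_max leqnn orbT.
  have h3 : dyad j <= r * s / 32 by apply: HJ3; rewrite /j !leq_max leqnn !orbT.
  have h4 := RI_L2_approx (hD e) (mg e) (mp j e) (d2 j e) (g2 e) (p2 j e) Dx s0 (db j e).
  have h5 : s^-1 * (8 * dyad j ^+ 2) <= r / 4.
    rewrite ler_pdivrMl//; have := @dyadic_gt0 R j; have := @dyadic_le1 R j; nra.
  have [_ _ Pj] := pw j e; have := Pj x Dx.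
  move: h1 h2 h4; rewrite !ler_norml => /andP[? ?] /andP[? ?] /andP[? ?] ?.
  by apply/andP; split; lra.
apply: le_trans der_sub.
apply/ler_addgt0Pr => r r0.
(* Weighted Young inequality in place of the triangle inequality for norms; [s] is fixed small
   first, then [j] is taken large enough to beat the factor [1 + 1/s]. *)
have gj j (s : R) : 0 < s -> normsq g <= (1 + s) * normsq (p j).2 +
    (1 + s^-1) * \sum_e RI (D e) (fun x => ((p j).2 e x - g e x) ^+ 2).
  move=> s0; rewrite /normsq !mulr_sumr -big_split/=; apply: ler_sum => e _.
  rewrite -!RIZ// -RID//; [|exact: rintZ|exact: rintZ].
  apply: le_RI => //; first by apply: rintD => //; exact: rintZ.
  move=> x _; set a := (p j).2 e x; set b := g e x.
  have : 0 <= s^-1 * (s * a + (a - b)) ^+ 2 by rewrite mulr_ge0 ?sqr_ge0// invr_ge0 ltW.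
  rewrite (_ : s^-1 * _ = s * a ^+ 2 + 2 * a * (a - b) + s^-1 * (a - b) ^+ 2); last first.
    by field; rewrite gt_eqF.
  nra.
have Nj j : normsq (p j).2 <= d + dyad j.
  have [_ [k [_ _ + _]]] := Hp j; have := @dyadic_gt0 R j; have := @dyadic_le1 R j.
  move=> a b /le_trans; apply; rewrite lerD2l ler_pdivrMr//.
  by have := ler_iXnr (isT : (0 < 4)%N) (ltW b) a; lra.
have Sj j : \sum_e RI (D e) (fun x => ((p j).2 e x - g e x) ^+ 2) <= 8 * n%:R * dyad j.
  apply: (@le_trans _ _ (\sum_(e < n) (8 * dyad j))).
    apply: ler_sum => e _; apply: (le_trans (db j e)).
    by have := @dyadic_gt0 R j; have := @dyadic_le1 R j; nra.
  by rewrite sumr_const card_ord -[leLHS]mulr_natr mulrAC.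
have d0 : 0 <= d by apply: ub_le_sup => //; case: hA.
pose s := Num.min 1 (r / (4 * (d + 2))).
have s0 : 0 < s by rewrite lt_min ltr01/= divr_gt0//; lra.
have s1 : s <= 1 by rewrite ge_min lexx.
have sd : s * (d + 1) <= r / 4.
  have : s <= r / (4 * (d + 2)) by rewrite ge_min lexx orbT.
  rewrite ler_pdivlMr; last lra.
  nra.
have i0 : 0 <= 1 + s^-1 by rewrite addr_ge0// invr_ge0 ltW.
have c0 : 0 < 1 + (1 + s^-1) * (8 * n%:R).
  by have := mulr_ge0 i0 (mulr_ge0 (ler0n R 8) (ler0n R n)); lra.
have [J HJ] := dyadic_small (divr_gt0 r0 (mulr_gt0 (ltr0Sn R 3) c0)).
have dj : dyad J * (4 * (1 + (1 + s^-1) * (8 * n%:R))) <= r.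
  by rewrite -ler_pdivlMr ?mulr_gt0//; apply: HJ.
apply: (le_trans (gj J s s0)).
have a1 : (1 + s) * normsq (p J).2 <= (1 + s) * (d + dyad J) by rewrite ler_pM2l// ?Nj//; lra.
have a2 := ler_wpM2l i0 (Sj J).
have d1 := @dyadic_le1 R J; have d2' := @dyadic_gt0 R J.
have a3 : (1 + s) * (d + dyad J) <= d + r / 4 + dyad J by nra.
move: dj a2; set q := (1 + s^-1); set X := (\sum_e _); nra.
Qed.

End WeakLimit.

(** * Soliton calibrations *)

Section Calculus.
Context {R : realType}.
Implicit Types (f g F psi : R -> R) (x y s t : R).

Lemma der_add f g x a b : is_derive x 1 f a -> is_derive x 1 g b ->
  is_derive x 1 (fun y => f y + g y) (a + b).
Proof. by move=> ? ?; exact: is_deriveD. Qed.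

Lemma der_sub f g x a b : is_derive x 1 f a -> is_derive x 1 g b ->
  is_derive x 1 (fun y => f y - g y) (a - b).
Proof. by move=> ? ?; exact: is_deriveB. Qed.

Lemma der_mul f g x a b : is_derive x 1 f a -> is_derive x 1 g b ->
  is_derive x 1 (fun y => f y * g y) (f x * b + g x * a).
Proof. by move=> ? ?; exact: is_deriveM. Qed.

Lemma der_cst c x : is_derive x 1 (fun=> c : R) 0.
Proof. exact: is_derive_cst. Qed.

Lemma der_id x : is_derive x 1 (fun y : R => y) 1.
Proof. exact: is_derive_id. Qed.

Lemma der_scale f x a c : is_derive x 1 f a -> is_derive x 1 (fun y => c * f y) (c * a).
Proof. by move=> ?; exact: is_deriveZ. Qed.

Lemma der_pow f x a n : is_derive x 1 f a ->
  is_derive x 1 (fun y => f y ^+ n) (n%:R * f x ^+ n.-1 * a).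
Proof.
move=> df; elim: n => [|n IH].
  rewrite mul0r mul0r; under eq_fun do rewrite expr0; exact: der_cst.
under eq_fun do rewrite exprS.
apply: is_derive_eq (der_mul df IH) _ => /=; rewrite -natr1.
by case: n {IH} => [|n] /=; rewrite ?expr0 ?exprS; ring.
Qed.

Lemma der_comp f g x a b : is_derive (g x) 1 f a -> is_derive x 1 g b ->
  is_derive x 1 (fun y => f (g y)) (a * b).
Proof. exact: is_derive1_comp. Qed.

Lemma derive_mono F (d : R -> R) s t : s <= t ->
  (forall x, s <= x <= t -> is_derive x 1 F (d x)) ->
  (forall x, s <= x <= t -> 0 <= d x) -> F s <= F t.
Proof.
move=> st dF d0.
have dF' x : x \in `]s, t[ -> is_derive x 1 F (d x).
  by rewrite in_itv/= => /andP[/ltW ? /ltW ?]; apply: dF; apply/andP.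
have cF : {within `[s, t], continuous F}.
  by apply: derivable_within_continuous => x; rewrite in_itv/= => /dF h; exact: ex_derive.
have [c] := MVT_segment st dF' cF.
rewrite in_itv/= => cst E; rewrite -subr_ge0 E mulr_ge0 ?subr_ge0//; exact: d0.
Qed.

(** Only differences of primitives matter. The base point [-1] makes every [t >= 0] interior, so the
    derivative at 0 is two-sided too. *)
Definition prim psi t := RI `[-1, t] psi.

Lemma prim_derive psi t : continuous psi -> -1 < t -> is_derive t 1 (prim psi) (psi t).
Proof.
move=> cp t1; have [] := @continuous_FTC1_closed R psi (-1) t (t + 1) _ _ t1 (cp t).
- lra.
- apply: continuous_compact_integrable; first exact: segment_compact.
  exact: continuous_subspaceT.
by move=> h <-; rewrite derive1E; exact: DeriveDef.
Qed.

Lemma prim_calibration C psi : continuous psi ->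
  (forall t, 0 <= t -> psi t ^+ 2 <= C * t ^+ 2) -> calibration C psi (prim psi).
Proof.
move=> cp psiC; split => // s t s0 st.
have dP x : s <= x -> is_derive x 1 (prim psi) (psi x).
  by move=> sx; apply: prim_derive => //; lra.
have dP' x : x \in `]s, t[ -> is_derive x 1 (prim psi) (psi x).
  by rewrite in_itv/= => /andP[/ltW sx _]; exact: dP.
have cP : {within `[s, t], continuous (prim psi)}.
  apply: derivable_within_continuous => x; rewrite in_itv/= => /andP[/dP h _].
  exact: ex_derive.
have [c] := MVT_segment st dP' cP.
by rewrite in_itv/= => cst E; exists c => //; rewrite E normrM [`|t - s|]ger0_norm// subr_ge0.
Qed.

Lemma prim_le psi F (d : R -> R) s t : continuous psi -> 0 <= s -> s <= t ->
  (forall x, s <= x <= t -> is_derive x 1 F (d x)) ->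
  (forall x, s <= x <= t -> psi x <= d x) ->
  prim psi t - prim psi s <= F t - F s.
Proof.
move=> cp s0 st dF pd.
suff : F s - prim psi s <= F t - prim psi t by lra.
apply: (@derive_mono (fun x => F x - prim psi x) (fun x => d x - psi x)) => // x sxt.
  apply: der_sub; first exact: dF.
  by apply: prim_derive => //; case/andP: sxt; lra.
by rewrite subr_ge0 pd.
Qed.

Lemma prim_ge psi F (d : R -> R) s t : continuous psi -> 0 <= s -> s <= t ->
  (forall x, s <= x <= t -> is_derive x 1 F (d x)) ->
  (forall x, s <= x <= t -> d x <= psi x) ->
  F t - F s <= prim psi t - prim psi s.
Proof.
move=> cp s0 st dF pd.
suff : prim psi s - F s <= prim psi t - F t by lra.
apply: (@derive_mono (fun x => prim psi x - F x) (fun x => psi x - d x)) => // x sxt.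
  apply: der_sub; last exact: dF.
  by apply: prim_derive => //; case/andP: sxt; lra.
by rewrite subr_ge0 pd.
Qed.

End Calculus.

Section Soliton.
Context {R : realType}.
Implicit Types (N m t : R).

(* Phase portrait [phi' = - psi0 N phi] of the soliton of height N. *)
Definition psi0 N t : R := t * (Num.sqrt (N ^+ 4 - t ^+ 4) / Num.sqrt 3).

(* The weaker calibration [psi1] leaves room for a gain on edges where [m <= |u|]. *)
Definition psi1 N m t : R :=
  (t - Num.min t (m / (1 + t ^+ 2))) * (Num.sqrt (N ^+ 4 - t ^+ 4) / Num.sqrt 3).

Lemma sqrt3_gt0 : 0 < Num.sqrt (3 : R). Proof. by rewrite sqrtr_gt0. Qed.

Lemma sqrt3_sqr : Num.sqrt (3 : R) ^+ 2 = 3. Proof. by rewrite sqr_sqrtr. Qed.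

Lemma weight_continuous N : continuous (fun t : R => Num.sqrt (N ^+ 4 - t ^+ 4) / Num.sqrt 3).
Proof.
move=> t; apply: cvgM; last exact: cvg_cst.
apply: continuous_comp; last exact: sqrt_continuous.
by apply: cvgB; [exact: cvg_cst|exact: exprn_continuous].
Qed.

Lemma psi0_continuous N : continuous (psi0 N).
Proof. by move=> t; apply: cvgM; [exact: cvg_id|exact: weight_continuous]. Qed.

Lemma psi1_continuous N m : continuous (psi1 N m).
Proof.
move=> t; apply: cvgM; last exact: weight_continuous.
apply: cvgB; first exact: cvg_id.
apply: (@continuous_min _ _ id (fun t => m / (1 + t ^+ 2))); first exact: cvg_id.
apply: cvgM; first exact: cvg_cst.
apply: cvgV; first by rewrite gt_eqF// ltr_pwDl// sqr_ge0.
by apply: cvgD; [exact: cvg_cst|exact: exprn_continuous].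
Qed.

Lemma weight_ge0 N t : 0 <= Num.sqrt (N ^+ 4 - t ^+ 4) / Num.sqrt (3 : R).
Proof. by rewrite divr_ge0// sqrtr_ge0. Qed.

Lemma weight_sqr N t :
  (Num.sqrt (N ^+ 4 - t ^+ 4) / Num.sqrt 3) ^+ 2 = Num.max 0 (N ^+ 4 - t ^+ 4) / 3.
Proof.
rewrite expr_div_n sqrt3_sqr; congr (_ / _).
case: (leP (N ^+ 4 - t ^+ 4) 0) => h; last by rewrite sqr_sqrtr// ltW.
by rewrite ler0_sqrtr// expr0n.
Qed.

Lemma weight_le N t : Num.sqrt (N ^+ 4 - t ^+ 4) / Num.sqrt 3 <= N ^+ 2 / Num.sqrt (3 : R).
Proof.
rewrite ler_pM2r ?invr_gt0 ?sqrt3_gt0//.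
rewrite -[N ^+ 2]ger0_norm ?sqr_ge0// -sqrtr_sqr ler_sqrt; last by rewrite sqr_ge0.
by rewrite -exprM lerBlDr lerDl (exprM t 2 2) sqr_ge0.
Qed.

Lemma psi0_sqr N t : psi0 N t ^+ 2 = t ^+ 2 * (Num.max 0 (N ^+ 4 - t ^+ 4) / 3).
Proof. by rewrite exprMn weight_sqr. Qed.

Lemma psi0_calibration N : calibration (N ^+ 4 / 3) (psi0 N) (prim (psi0 N)).
Proof.
apply: prim_calibration; first exact: psi0_continuous.
move=> t _; rewrite psi0_sqr mulrC ler_wpM2r ?sqr_ge0// ler_pM2r ?invr_gt0//.
have pow4 (x : R) : 0 <= x ^+ 4 by rewrite (exprM _ 2 2) sqr_ge0.
by rewrite ge_max pow4/=; have := pow4 t; lra.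
Qed.

Lemma psi0_ge0 N t : 0 <= t -> 0 <= psi0 N t.
Proof. by move=> t0; rewrite mulr_ge0// weight_ge0. Qed.

Lemma psi1_ge0 N m t : 0 <= psi1 N m t.
Proof. by rewrite mulr_ge0 ?weight_ge0// subr_ge0 ge_min lexx. Qed.

Lemma prim_psi0_homo N s t : 0 <= s -> s <= t -> prim (psi0 N) s <= prim (psi0 N) t.
Proof.
move=> s0 st; apply: (derive_mono st) => x /andP[sx _].
  by apply: prim_derive; [exact: psi0_continuous|lra].
by apply: psi0_ge0; lra.
Qed.

Lemma prim_psi1_homo N m s t : 0 <= s -> s <= t -> prim (psi1 N m) s <= prim (psi1 N m) t.
Proof.
move=> s0 st; apply: (derive_mono st) => x /andP[sx _].
  by apply: prim_derive; [exact: psi1_continuous|lra].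
exact: psi1_ge0.
Qed.

Lemma prim_psi0_le N t : 0 <= t ->
  prim (psi0 N) t - prim (psi0 N) 0 <= N ^+ 2 * t ^+ 2 / (2 * Num.sqrt 3).
Proof.
move=> t0; have s3 := sqrt3_gt0.
pose F (x : R) := (N ^+ 2 / (2 * Num.sqrt 3)) * x ^+ 2.
have -> : N ^+ 2 * t ^+ 2 / (2 * Num.sqrt 3) = F t - F 0.
  by rewrite /F expr0n mulr0 subr0 mulrAC.
apply: (@prim_le _ _ _ (fun x => x * (N ^+ 2 / Num.sqrt 3))) => //.
- exact: psi0_continuous.
- move=> x _; apply: is_derive_eq (der_scale _ (der_pow 2 (der_id x))) _ => /=.
  by rewrite expr1; field; rewrite gt_eqF.
- by move=> x /andP[x0 _]; rewrite ler_wpM2l// weight_le.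
Qed.

(* [4 sqrt 3 Psi] has the closed form [t^2 sqrt (N^4 - t^4) + N^4 asin (t^2 / N^2)]. *)
Lemma prim_psi0_ge N : 0 < N ->
  N ^+ 4 * pi / (8 * Num.sqrt 3) <= prim (psi0 N) N - prim (psi0 N) 0.
Proof.
move=> N0; have s3 := sqrt3_gt0.
pose F (x : R) := (4 * Num.sqrt 3)^-1 *
  (x ^+ 2 * Num.sqrt (N ^+ 4 - x ^+ 4) + N ^+ 4 * asin (N ^- 2 * x ^+ 2)).
have N2 : 0 < N ^+ 2 by rewrite exprn_gt0.
have N4 : 0 < N ^+ 4 by rewrite exprn_gt0.
have dF x : 0 <= x -> x < N -> is_derive x 1 F (psi0 N x).
  move=> x0 xN.
  have x4 : 0 < N ^+ 4 - x ^+ 4 by rewrite subr_gt0 ltr_pXn2r// nnegrE// ltW.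
  have S0 : 0 < Num.sqrt (N ^+ 4 - x ^+ 4) by rewrite sqrtr_gt0.
  have x2N : N ^- 2 * x ^+ 2 < 1.
    by rewrite ltr_pdivrMl// mulr1 ltr_pXn2r// nnegrE// ltW.
  have x2N0 : 0 <= N ^- 2 * x ^+ 2 by rewrite mulr_ge0 ?sqr_ge0// invr_ge0 ltW.
  have dsq : is_derive x 1 (fun y : R => Num.sqrt (N ^+ 4 - y ^+ 4))
      ((2 * Num.sqrt (N ^+ 4 - x ^+ 4))^-1 * (0 - 4 * x ^+ 3 * 1)).
    apply: (@der_comp _ Num.sqrt (fun y => N ^+ 4 - y ^+ 4)); first exact: is_derive1_sqrt.
    exact: (der_sub (der_cst _ _) (der_pow 4 (der_id x))).
  have das : is_derive x 1 (fun y : R => asin (N ^- 2 * y ^+ 2))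
      ((Num.sqrt (1 - (N ^- 2 * x ^+ 2) ^+ 2))^-1 * (N ^- 2 * (2 * x ^+ 1 * 1))).
    apply: (@der_comp _ asin (fun y => N ^- 2 * y ^+ 2)); last exact: (der_scale _ (der_pow 2 (der_id x))).
    by apply: is_derive1_asin; rewrite x2N andbT (lt_le_trans _ x2N0)// ltrN10.
  have E : Num.sqrt (1 - (N ^- 2 * x ^+ 2) ^+ 2) = N ^- 2 * Num.sqrt (N ^+ 4 - x ^+ 4).
    rewrite (_ : 1 - _ = (N ^- 2) ^+ 2 * (N ^+ 4 - x ^+ 4)); last first.
      by field; rewrite gt_eqF.
    by rewrite sqrtrM ?sqr_ge0// sqrtr_sqr ger0_norm// invr_ge0 ltW.
  apply: is_derive_eq (der_scale _ (der_add (der_mul (der_pow 2 (der_id x)) dsq) (der_scale _ das))) _.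
  rewrite E /psi0 /=.
  have S2 : Num.sqrt (N ^+ 4 - x ^+ 4) ^+ 2 = N ^+ 4 - x ^+ 4 by rewrite sqr_sqrtr// ltW.
  move: S0 S2; set S := Num.sqrt (N ^+ 4 - x ^+ 4) => S0 S2.
  transitivity ((4 * Num.sqrt 3)^-1 * (2 * x * S + 2 * x * (N ^+ 4 - x ^+ 4) / S)).
    by field; rewrite !gt_eqF//.
  by rewrite -S2; field; rewrite !gt_eqF//.
have asin0 : asin 0 = 0 :> R.
  rewrite -[X in asin X]sin0 sinK// in_itv/=; apply/andP; split; have := pi_gt0 R; lra.
have F0 : F 0 = 0 by rewrite /F !expr0n/= mul0r mulr0 asin0 mulr0 addr0 mulr0.
(* [F] is differentiable only below [N], since [asin] is singular at 1. The comparison is therefore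
   made at the height [t] with [t^2 / N^2 = sin th], and [th] is pushed towards [pi / 2]. *)
have key th : 0 < th -> th < pi / 2 ->
    N ^+ 4 * th / (4 * Num.sqrt 3) <= prim (psi0 N) N - prim (psi0 N) 0.
  move=> th0 thpi.
  have sn0 : 0 < sin th by apply: sin_gt0_pi; rewrite th0/=; have := pi_gt0 R; lra.
  have sn1 : sin th < 1.
    rewrite -sin_pihalf ltr_sin//; rewrite in_itv/=; apply/andP; split; have := pi_gt0 R; lra.
  pose t := N * Num.sqrt (sin th).
  have t0 : 0 <= t by rewrite mulr_ge0 ?sqrtr_ge0// ltW.
  have tN : t < N.
    rewrite /t -[ltRHS]mulr1 ltr_pM2l// -[ltRHS]sqrtr1 ltr_sqrt//.
  have t2 : N ^- 2 * t ^+ 2 = sin th.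
    by rewrite /t exprMn sqr_sqrtr ?(ltW sn0)// mulKf// gt_eqF.
  have h1 : F t - F 0 <= prim (psi0 N) t - prim (psi0 N) 0.
    apply: (@prim_ge _ _ _ (psi0 N)) => //; first exact: psi0_continuous.
    by move=> x /andP[x0 xt]; apply: dF => //; exact: le_lt_trans tN.
  have h2 := prim_psi0_homo N t0 (ltW tN).
  have h3 : N ^+ 4 * th / (4 * Num.sqrt 3) <= F t.
    rewrite /F t2 sinK; last by rewrite in_itv/=; apply/andP; split; lra.
    rewrite mulrC ler_pM2l ?invr_gt0 ?mulr_gt0// lerDr.
    by rewrite mulr_ge0 ?sqr_ge0 ?sqrtr_ge0.
  lra.
rewrite leNgt; apply/negP => lt.
set X := prim (psi0 N) N - _ in lt key.
have c0 : 0 < N ^+ 4 / (4 * Num.sqrt 3) by rewrite divr_gt0// mulr_gt0.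
have p0 := pi_gt0 R.
have X0 : 0 < X.
  apply: (lt_le_trans _ (key (pi / 4) _ _)); [|lra|lra].
  by rewrite mulrAC mulr_gt0//; lra.
(* The angle whose lower bound in [key] equals [X]. If it were below [pi / 2], the midpoint of [th]
   and [pi / 2] would contradict [key]. *)
pose th := X / (N ^+ 4 / (4 * Num.sqrt 3)).
have thX : N ^+ 4 * th / (4 * Num.sqrt 3) = X.
  by rewrite /th; field; rewrite !gt_eqF.
have th0 : 0 < th by rewrite divr_gt0.
have thp : th < pi / 2.
  rewrite /th ltr_pdivrMr//; apply: (lt_le_trans lt).
  by rewrite le_eqVlt; apply/orP; left; apply/eqP; field; rewrite gt_eqF.
have th1 : 0 < (th + pi / 2) / 2 by lra.
have th2 : (th + pi / 2) / 2 < pi / 2 by lra.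
have := key _ th1 th2; rewrite -[leRHS]thX.
rewrite ler_pM2r ?invr_gt0 ?mulr_gt0// ler_pM2l//; lra.
Qed.

Lemma psi1_gain N m t : 0 <= m -> 0 <= t -> psi1 N m t ^+ 2 <= psi0 N t ^+ 2.
Proof.
move=> m0 t0; rewrite !exprMn ler_wpM2r ?sqr_ge0//.
have a : Num.min t (m / (1 + t ^+ 2)) <= t by rewrite ge_min lexx.
have b : 0 <= Num.min t (m / (1 + t ^+ 2)).
  by rewrite le_min t0 divr_ge0// addr_ge0// sqr_ge0.
rewrite ler_pXn2r ?nnegrE//; lra.
Qed.

(** For [m <= t <= b], the square of [t - m / (1 + t^2)] is at most [t^2 - m^2 / (1 + t^2)], while
    [N^4 - t^4 >= N^4 / 2]. Beyond [b] the factor [1 - t^2 / b^2] is negative and [psi1_gain]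
    suffices; this factor is what integrates to [length - mass / b^2], a Chebyshev bound. *)
Lemma psi1_gain_mid N m t b : 0 <= m -> m <= t -> 0 < b -> 2 * b ^+ 4 <= N ^+ 4 ->
  psi1 N m t ^+ 2 + N ^+ 4 * m ^+ 2 / (6 * (1 + b ^+ 2)) * (1 - t ^+ 2 / b ^+ 2)
    <= psi0 N t ^+ 2.
Proof.
move=> m0 mt b0 bN.
have b20 : 0 < b ^+ 2 by rewrite exprn_gt0.
have t0 := le_trans m0 mt.
have N4 : 0 <= N ^+ 4 by rewrite (exprM _ 2 2) sqr_ge0.
have c0 : 0 <= N ^+ 4 * m ^+ 2 / (6 * (1 + b ^+ 2)).
  apply: divr_ge0; first by rewrite mulr_ge0 ?sqr_ge0.
  lra.
case: (leP t b) => tb; last first.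
  apply: le_trans (psi1_gain N m0 t0); rewrite gerDl.
  rewrite mulr_ge0_le0// subr_le0 ler_pdivlMr// mul1r.
  by rewrite ler_pXn2r ?nnegrE// ltW.
apply: (@le_trans _ _ (psi1 N m t ^+ 2 + N ^+ 4 * m ^+ 2 / (6 * (1 + b ^+ 2)))).
  rewrite lerD2l -[leRHS]mulr1 ler_wpM2l// gerBl divr_ge0 ?sqr_ge0//.
rewrite psi0_sqr /psi1 exprMn weight_sqr.
have t4 : t ^+ 4 <= b ^+ 4 by rewrite ler_pXn2r ?nnegrE// ltW.
have -> : Num.max 0 (N ^+ 4 - t ^+ 4) = N ^+ 4 - t ^+ 4.
  apply/max_idPr; have : 0 < b ^+ 4 by rewrite exprn_gt0.
  by lra.
have t21 : 0 < 1 + t ^+ 2 by rewrite ltr_pwDl// sqr_ge0.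
have -> : Num.min t (m / (1 + t ^+ 2)) = m / (1 + t ^+ 2).
  apply/min_idPr; rewrite ler_pdivrMr//; have := sqr_ge0 t; nra.
set y := (1 + t ^+ 2)^-1.
have y0 : 0 < y by rewrite invr_gt0.
have y1 : y <= 1 by rewrite invf_le1// lerDl sqr_ge0.
have yb : (1 + b ^+ 2)^-1 <= y.
  rewrite lef_pV2 ?posrE//; last lra.
  by rewrite lerD2l ler_pXn2r ?nnegrE// ltW.
have y2 : (t - m * y) ^+ 2 <= t ^+ 2 - m ^+ 2 * y.
  have : m ^+ 2 * y * (2 - y) <= t * m * y * 2 - m ^+ 2 * y ^+ 2.
    have : 0 <= m * y * (t - m) by rewrite !mulr_ge0 ?subr_ge0// ltW.
    nra.
  have : m ^+ 2 * y <= m ^+ 2 * y * (2 - y).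
    by rewrite ler_peMr ?mulr_ge0 ?sqr_ge0 ?(ltW y0)//; lra.
  nra.
have b40 : 0 < b ^+ 4 by rewrite exprn_gt0.
have W0 : 0 <= (N ^+ 4 - t ^+ 4) / 3 by lra.
apply: (@le_trans _ _ ((t ^+ 2 - m ^+ 2 * y) * ((N ^+ 4 - t ^+ 4) / 3) +
    N ^+ 4 * m ^+ 2 / (6 * (1 + b ^+ 2)))).
  by rewrite lerD2r ler_wpM2r.
suff : N ^+ 4 * m ^+ 2 / (6 * (1 + b ^+ 2)) <= m ^+ 2 * y * ((N ^+ 4 - t ^+ 4) / 3) by lra.
have -> : N ^+ 4 * m ^+ 2 / (6 * (1 + b ^+ 2)) = m ^+ 2 * (1 + b ^+ 2)^-1 * (N ^+ 4 / 6).
  by field; rewrite gt_eqF// ltr_pwDl// ltW.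
apply: ler_pM => //.
- by rewrite mulr_ge0 ?sqr_ge0// invr_ge0 addr_ge0// ltW.
- by rewrite divr_ge0.
- by rewrite ler_wpM2l ?sqr_ge0.
- lra.
Qed.

Lemma psi1_calibration N m : 0 <= m -> calibration (N ^+ 4 / 3) (psi1 N m) (prim (psi1 N m)).
Proof.
move=> m0; apply: prim_calibration; first exact: psi1_continuous.
move=> t t0; apply: (le_trans (psi1_gain N m0 t0)).
by case: (psi0_calibration N) => _ _; exact.
Qed.

(** The part removed from [psi0] is at most [m / (1 + t^2) * N^2 / sqrt 3], with primitive a
    multiple of [atan]. Integrability of [1 / (1 + t^2)] is the point: removing the constant [m]
    would cost order [m N^3] instead of [m N^2]. *)
Lemma prim_psi1_ge N m : 0 <= m -> m <= N ->
  prim (psi0 N) N - prim (psi0 N) m - m * N ^+ 2 * pi / (2 * Num.sqrt 3)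
    <= prim (psi1 N m) N - prim (psi1 N m) m.
Proof.
move=> m0 mN; have s3 := sqrt3_gt0.
pose F (x : R) := prim (psi0 N) x - (m * N ^+ 2 / Num.sqrt 3) * atan x.
have c0 : 0 <= m * N ^+ 2 / Num.sqrt 3 by rewrite divr_ge0 ?sqrtr_ge0// mulr_ge0// sqr_ge0.
have : F N - F m <= prim (psi1 N m) N - prim (psi1 N m) m.
  apply: (@prim_ge _ _ _ (fun x => psi0 N x - (m * N ^+ 2 / Num.sqrt 3) * (1 + x ^+ 2)^-1)) => //.
  - exact: psi1_continuous.
  - move=> x /andP[mx _]; apply: (der_sub _ (der_scale _ (is_derive1_atan x))).
    by apply: prim_derive; [exact: psi0_continuous|lra].
  - move=> x /andP[mx _]; rewrite /psi0 /psi1 mulrBl lerB//.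
    have -> : m * N ^+ 2 / Num.sqrt 3 * (1 + x ^+ 2)^-1 =
      m / (1 + x ^+ 2) * (N ^+ 2 / Num.sqrt 3).
      by field; rewrite !gt_eqF// ltr_pwDl// sqr_ge0.
    apply: ler_pM; rewrite ?weight_ge0 ?weight_le//.
      have x21 : 0 < 1 + x ^+ 2 by rewrite ltr_pwDl// sqr_ge0.
      by rewrite le_min (le_trans m0 mx) divr_ge0// ltW.
    by rewrite ge_min lexx orbT.
have aN : atan N <= pi / 2 by exact/ltW/atan_ltpi2.
have am : 0 <= atan m by rewrite -[leLHS](@atan0 R) le_atan.
rewrite /F; move: c0; set c := m * N ^+ 2 / Num.sqrt 3 => c0.
have -> : m * N ^+ 2 * pi / (2 * Num.sqrt 3) = c * (pi / 2).
  by rewrite /c; field; rewrite gt_eqF.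
have : c * atan N <= c * (pi / 2) by rewrite ler_wpM2l.
have : 0 <= c * atan m by rewrite mulr_ge0.
lra.
Qed.

End Soliton.

(** * Level crossings on a graph *)

Section Combinatorics.
Context {R : realType} (G : mgraph R).
(** To be read as [f = Psi |u|], [F] its vertex values, [T e] the action on [e] and [base = Psi 0],
    the value reached at infinity. [fvar] has two intermediate points because a bounded edge is cut
    at a high point and at a low point. *)
Variables (f : 'I_(nE G) -> R -> R) (F : 'I_(nV G) -> R) (T : 'I_(nE G) -> R) (base : R).
Hypothesis fsrc : forall e, f e 0 = F (src G e).
Hypothesis ftgt : forall e v, tgt G e = Some v -> f e (len G e) = F v.
Hypothesis fvar : forall e x y z, 0 <= x -> x <= y -> y <= z -> edge_dom e z ->
  `|f e x - f e 0| + `|f e y - f e x| + `|f e z - f e y| <= T e.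
Hypothesis finf : forall e x, is_halfline e -> 0 <= x ->
  `|f e x - f e 0| + (f e x - base) <= T e.

Lemma edge_dom0 e : edge_dom (G := G) e 0.
Proof.
rewrite /edge_dom; case E: (tgt G e) => [v|] /=; rewrite in_itv/= lexx//=.
by apply/ltW/(len_gt0 (m := G)); rewrite E.
Qed.

Lemma edge_dom_len e v : tgt G e = Some v -> edge_dom (G := G) e (len G e).
Proof.
move=> E; rewrite /edge_dom E /= in_itv/= lexx andbT.
by apply/ltW/(len_gt0 (m := G)); rewrite E.
Qed.

Lemma edge_domE e v x : tgt G e = Some v -> edge_dom (G := G) e x = (0 <= x <= len G e) :> Prop.
Proof. by move=> E; rewrite /edge_dom E /= in_itv. Qed.

Lemma edge_dom_half e x : is_halfline e -> edge_dom (G := G) e x = (0 <= x) :> Prop.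
Proof. by move=> /eqP E; rewrite /edge_dom E /= in_itv/= andbT. Qed.

Lemma T_ge0 e : 0 <= T e.
Proof.
have := fvar (lexx 0) (lexx 0) (lexx 0) (edge_dom0 e); rewrite subrr normr0; lra.
Qed.

Lemma sumT2 e1 e2 : e1 != e2 -> T e1 + T e2 <= \sum_e T e.
Proof.
move=> ne; rewrite (bigD1 e1)//= (bigD1 e2) 1?eq_sym//= addrA lerDl.
by apply: sumr_ge0 => e _; exact: T_ge0.
Qed.

Lemma sumT1 e : T e <= \sum_e T e.
Proof.
by rewrite (bigD1 e)//= lerDl; apply: sumr_ge0 => i _; exact: T_ge0.
Qed.

Section TwoPreimages.
Hypothesis noterm : no_terminal_point G.
Variable lev : R.
Hypothesis lev_base : base <= lev.
Hypothesis low : forall e v, tgt G e = Some v ->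
  exists2 y, 0 <= y <= len G e & f e y <= lev.

Lemma T_src e : F (src G e) - lev <= T e.
Proof.
case E: (tgt G e) => [v|]; last first.
  have hl : is_halfline e by apply/eqP.
  have := finf hl (lexx 0); rewrite subrr normr0 add0r fsrc.
  by have := lev_base; lra.
have [y /andP[y0 yl] fy] := low E.
have := fvar (lexx 0) y0 yl (edge_dom_len E); rewrite fsrc subrr normr0.
have := ler_norm (- (f e y - F (src G e))); rewrite normrN.
have := normr_ge0 (f e (len G e) - f e y); lra.
Qed.

Lemma T_tgt e v : tgt G e = Some v -> F v - lev <= T e.
Proof.
move=> E; have [y /andP[y0 yl] fy] := low E.
have := fvar (lexx 0) y0 yl (edge_dom_len E); rewrite fsrc subrr normr0 (ftgt E).
have := ler_norm (F v - f e y).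
have := normr_ge0 (f e y - F (src G e)); lra.
Qed.

Lemma other_end_src e0 : (exists2 e1, e1 != e0 & src G e1 = src G e0) \/
  (exists e1, tgt G e1 = Some (src G e0)).
Proof.
have := noterm (src G e0); rewrite /degree (cardD1 e0) inE eqxx -addnA eqSS.
rewrite addn_eq0 => /nandP[]; rewrite -lt0n => /card_gt0P[e1]; rewrite !inE.
  by case/andP=> ne /eqP E; left; exists e1.
by move=> /eqP E; right; exists e1.
Qed.

Lemma other_end_tgt e0 v : tgt G e0 = Some v ->
  (exists2 e1, e1 != e0 & tgt G e1 = Some v) \/ (exists e1, src G e1 = v).
Proof.
move=> E; have := noterm v; rewrite /degree addnC (cardD1 e0) inE E eqxx -addnA eqSS.
rewrite addn_eq0 => /nandP[]; rewrite -lt0n => /card_gt0P[e1]; rewrite !inE.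
  by case/andP=> ne /eqP E1; left; exists e1.
by move=> /eqP E1; right; exists e1.
Qed.

(* Above level [lev] no edge is fully traversed, so every edge end at a vertex of
   value > lev carries its own crossing; degree >= 2 then gives two of them. *)
Lemma two_preimages e0 x0 : edge_dom e0 x0 -> 2 * (f e0 x0 - lev) <= \sum_e T e.
Proof.
move=> Dx; case E: (tgt G e0) => [v|].
- move: (Dx); rewrite (edge_domE _ E) => /andP[x00 x0l].
  have [y /andP[y0 yl] fy] := low E.
  case: (leP x0 y) => xy.
  + have V := fvar x00 xy yl (edge_dom_len E); rewrite fsrc (ftgt E) in V.
    case: (other_end_src e0) => [[e1 ne E1]|[e1 E1]].
    * have := sumT2 ne; have := T_src e1; rewrite E1.
      move: V; set a := f e0 x0; set b := F (src G e0).
      have := ler_norm (a - b); have := ler_norm (- (f e0 y - a)); rewrite normrN.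
      have := normr_ge0 (F v - f e0 y); lra.
    (* The second end at the source may be the far end of [e0] itself; then [e0] is a loop and the
       return crossing takes place between [y] and that end. *)
    * case: (eqVneq e1 e0) => [e10|ne].
        move: E1; rewrite e10 E => -[vE]; have := sumT1 e0; move: V; rewrite vE.
        set a := f e0 x0; set b := F (src G e0).
        have := ler_norm (a - b); have := ler_norm (- (f e0 y - a)); rewrite normrN.
        have := ler_norm (b - f e0 y); lra.
      have := sumT2 ne; have := T_tgt E1; move: V; set a := f e0 x0; set b := F (src G e0).
      have := ler_norm (a - b); have := ler_norm (- (f e0 y - a)); rewrite normrN.
      have := normr_ge0 (F v - f e0 y); lra.
  + have V := fvar y0 (ltW xy) x0l (edge_dom_len E); rewrite fsrc (ftgt E) in V.
    case: (other_end_tgt E) => [[e1 ne E1]|[e1 E1]].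
    * have := sumT2 ne; have := T_tgt E1.
      move: V; set a := f e0 x0; set b := F v.
      have := ler_norm (- (b - a)); have := ler_norm (a - f e0 y); rewrite normrN.
      have := normr_ge0 (f e0 y - F (src G e0)); lra.
    * case: (eqVneq e1 e0) => [e10|ne].
        move: E1; rewrite e10 => vE; have := sumT1 e0; move: V; rewrite vE.
        set a := f e0 x0; set b := F v.
        have := ler_norm (- (b - a)); have := ler_norm (a - f e0 y); rewrite normrN.
        have := ler_norm (- (f e0 y - b)); rewrite normrN; lra.
      have := sumT2 ne; have := T_src e1; rewrite E1; move: V; set a := f e0 x0; set b := F v.
      have := ler_norm (- (b - a)); have := ler_norm (a - f e0 y); rewrite normrN.
      have := normr_ge0 (f e0 y - F (src G e0)); lra.
- have hl : is_halfline e0 by apply/eqP.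
  move: (Dx); rewrite (edge_dom_half _ hl) => x00.
  have := finf hl x00; rewrite fsrc => V.
  have := ler_norm (f e0 x0 - F (src G e0)); have := lev_base.
  case: (other_end_src e0) => [[e1 ne E1]|[e1 E1]].
    by have := sumT2 ne; have := T_src e1; rewrite E1; lra.
  have ne : e1 != e0 by apply: contra_eq_neq E => <-; rewrite E1.
  by have := sumT2 ne; have := T_tgt E1; lra.
Qed.

End TwoPreimages.

(** * Variation along paths of bounded edges *)

Section Connected.
Hypothesis conn : gconnected G.

Definition adj : rel 'I_(nV G) := fun v w => [exists e,
  (src G e == v) && (tgt G e == Some w) || (src G e == w) && (tgt G e == Some v)].

(** Retracts each vertex at infinity to the origin of its half-line, so that a walk making an
    excursion to infinity projects to a path of bounded edges. *)
Definition foot (x : gvert G) : 'I_(nV G) :=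
  match x with inl v => v | inr e => src G e end.

Lemma adj_connected v w : connect adj v w.
Proof.
have step (a : 'I_(nE G) * bool) : connect adj (foot (ofrom a)) (foot (oto a)).
  case: a => e b; rewrite /ofrom /oto /= /endA /endB.
  case E: (tgt G e) => [t|]; case: b => /=; try exact: connect0.
    by apply: connect1; apply/existsP; exists e; rewrite E !eqxx.
  by apply: connect1; apply/existsP; exists e; rewrite E !eqxx orbT.
have walks s a : consecutive (a :: s) ->
    connect adj (foot (ofrom a)) (foot (oto (last a s))).
  elim: s a => [|b s IH] a /=; first by move=> _; exact: step.
  move=> /andP[/eqP ab /IH h]; apply: connect_trans (step a) _.
  by rewrite ab.
have [->|[[//|a s] [c fv tw]]] := conn v w; first exact: connect0.
by have := walks s a c; rewrite fv tw.
Qed.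

Lemma T_bounded e v : tgt G e = Some v -> `|F v - F (src G e)| <= T e.
Proof.
move=> E; have := fvar (lexx 0) (lexx 0) (ltW (len_gt0 (m := G) (e := e) _)) (edge_dom_len E).
by rewrite E => /(_ isT); rewrite subrr normr0 fsrc (ftgt E); lra.
Qed.

(** A path without repeated vertices uses each bounded edge at most once, so the variations of its
    edges may be summed. *)
Lemma path_variation v w : `|F v - F w| <= \sum_(e | ~~ is_halfline e) T e.
Proof.
have /connectP[p0 ep0 ->] := adj_connected v w.
case/shortenP: ep0 => p ep up _ {p0 w}.
(* Counting all edges with both ends on the path avoids recording which ones are used. The edge
   leaving [v] is new at each step because [v] does not occur in the rest of the path. *)
pose inside (q : seq (ordinal (nV G))) : pred 'I_(nE G) := fun e => [&& src G e \in q &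
  if tgt G e is Some t then t \in q else false].
apply: (@le_trans _ _ (\sum_(e | inside (v :: p) e) T e)); last first.
  rewrite [leRHS](bigID (inside (v :: p)))/= -[leLHS]addr0 lerD//; last first.
    by apply: sumr_ge0 => e _; exact: T_ge0.
  rewrite le_eqVlt; apply/orP; left; apply/eqP; apply: eq_bigl => e.
  rewrite /inside /is_halfline; case: (tgt G e) => [t|] //=.
  by rewrite andbF.
elim: p v ep up => [|w p IH] v /=.
  by move=> _ _; rewrite subrr normr0; apply: sumr_ge0 => e _; exact: T_ge0.
move=> /andP[/existsP[e he] ep] /andP[vp up].
have {}IH := IH w ep up.
have [De ie] : `|F v - F w| <= T e /\ inside (v :: w :: p) e.
  rewrite /inside; case/orP: he => /andP[/eqP s /eqP t]; have := T_bounded t; rewrite s t !inE !eqxx ?orbT.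
    by rewrite distrC.
  by [].
have ne : ~~ inside (w :: p) e.
  rewrite /inside; case/orP: he => /andP[/eqP -> /eqP ->]; first by rewrite (negbTE vp).
  by rewrite (negbTE vp) andbF.
rewrite (bigD1 e)//= -(subrKA (F w)) (le_trans (ler_normD _ _))// lerD//.
apply: (le_trans IH); rewrite [leRHS](bigID (inside (w :: p)))/= -[leLHS]addr0 lerD//; last first.
  by apply: sumr_ge0 => i _; exact: T_ge0.
rewrite le_eqVlt; apply/orP; left; apply/eqP; apply: eq_bigl => i.
case: (boolP (inside (w :: p) i)) => ii; rewrite ?andbF// andbT; apply/esym/andP; split; last first.
  by apply: contraNneq ne => <-.
move: ii; rewrite /inside => /andP[h1]; rewrite in_cons h1 orbT /=.
by case: (tgt G i) => // t h2; rewrite in_cons h2 orbT.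
Qed.

(** One descent to [base] goes outwards along [i]; the other goes back to the origin of [i], through
    bounded edges, and out along [j]. *)
Lemma two_halflines i j x : is_halfline i -> is_halfline j -> i != j -> 0 <= x ->
  2 * (f i x - base) <= \sum_e T e.
Proof.
move=> hi hj ij x0.
have Vi := finf hi x0; have Vj := finf hj (lexx 0).
rewrite fsrc subrr normr0 in Vj; rewrite fsrc in Vi.
have P := path_variation (src G i) (src G j).
have S : T i + T j + \sum_(e | ~~ is_halfline e) T e <= \sum_e T e.
  rewrite [leRHS](bigID (@is_halfline R G))/= lerD2r (bigD1 i)//= (bigD1 j)/=; last first.
    by rewrite hj eq_sym.
  by rewrite addrA lerDl; apply: sumr_ge0 => e _; exact: T_ge0.
have := ler_norm (F (src G i) - F (src G j)).
have := ler_norm (f i x - F (src G i)).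
have := ler_norm (- (f i x - F (src G i))); rewrite normrN; lra.
Qed.

(** The factor 2 allows [e] to occur again on the path joining it to a half-line. *)
Lemma bound_from_infinity e x : noncompact G -> edge_dom e x ->
  f e x - base <= 2 * \sum_e T e.
Proof.
move=> [i hi] Dx.
have Vi := finf hi (lexx 0); rewrite fsrc subrr normr0 in Vi.
have P := path_variation (src G e) (src G i).
have x0 : 0 <= x.
  by move: Dx; rewrite /edge_dom; case: (tgt G e) => [v|]; rewrite /= in_itv/= => /andP[].
have V := fvar (lexx 0) (lexx 0) x0 Dx; rewrite subrr normr0 fsrc in V.
have S : T i + \sum_(e | ~~ is_halfline e) T e <= \sum_e T e.
  rewrite [leRHS](bigID (@is_halfline R G))/= lerD2r (bigD1 i)//= lerDl.
  by apply: sumr_ge0 => k _; exact: T_ge0.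
have := sumT1 e; have := ler_norm (F (src G e) - F (src G i)).
have := ler_norm (f e x - F (src G e)); lra.
Qed.

End Connected.
End Combinatorics.

(** * Functions on a graph *)

Section GraphFunctions.
Context {R : realType} (G : mgraph R).
Local Notation fam := ('I_(nE G) -> R -> R).
Implicit Types (u g : fam) (e : 'I_(nE G)) (x y z : R).

Lemma edge_hdom e : hdom (edge_dom (G := G) e).
Proof.
split; last 3 first.
- exact: edge_dom0.
- by move=> x; rewrite /edge_dom; case: (tgt G e) => [v|]; rewrite /= in_itv/= => /andP[].
- move=> x y; rewrite /edge_dom; case: (tgt G e) => [v|]; rewrite /= !in_itv/=.
    by move=> /andP[_ xl] /andP[-> yx] /=; exact: le_trans xl.
  by move=> _ /andP[->].
- by rewrite /edge_dom; case: (tgt G e) => [v|].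
Qed.

Lemma edge_dom_measurable e : lmset (edge_dom (G := G) e). Proof. by case: (edge_hdom e). Qed.
#[local] Hint Resolve edge_dom_measurable : core.

Definition N2 u := normsq (edge_dom (G := G)) u.
Definition N6 u := \sum_e RI (edge_dom e) (fun x => u e x ^+ 6).
Definition En u g := N2 g / 2 - N6 u / 6.

Lemma H1_wpair u g e : H1 u g -> wpair (edge_dom e) (u e) (g e).
Proof. by case=> _ /(_ e)[]. Qed.

Lemma H1_u2 u g e : H1 u g -> rint (edge_dom e) (fun x => u e x ^+ 2).
Proof. by case=> _ /(_ e)[]. Qed.

Lemma H1_g2 u g e : H1 u g -> rint (edge_dom e) (fun x => g e x ^+ 2).
Proof. by case=> _ /(_ e)[]. Qed.

Lemma H1_L2 u g : H1 u g -> L2sq u = (N2 u)%:E.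
Proof.
move=> H; rewrite /L2sq /gint /N2 /normsq -sumEFin; apply: eq_bigr => e _.
by rewrite -RI_fin//; exact: H1_u2 H.
Qed.

Lemma H1_L2g u g : H1 u g -> L2sq g = (N2 g)%:E.
Proof.
move=> H; rewrite /L2sq /gint /N2 /normsq -sumEFin; apply: eq_bigr => e _.
by rewrite -RI_fin//; exact: H1_g2 H.
Qed.

Section OneFunction.
Variables (u g : fam).
Hypothesis H : H1 u g.

Let u2 e := H1_u2 e H.
Let g2 e := H1_g2 e H.
#[local] Hint Resolve u2 g2 : core.

Lemma half_dom e x : is_halfline e -> 0 <= x -> edge_dom e x.
Proof. by move=> h x0; rewrite edge_dom_half. Qed.

(** Otherwise [u^2 >= d^2] beyond [X], and an interval of length [A / d^2 + 1] would carry more than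
    the whole mass [A] of the edge. *)
Lemma vanishing e (d X : R) : is_halfline e -> 0 < d -> 0 <= X ->
  exists2 y, X <= y & `|u e y| <= d.
Proof.
move=> he d0 X0; apply: contrapT => hn.
have big y : X <= y -> d ^+ 2 <= u e y ^+ 2.
  move=> Xy; rewrite -[u e y ^+ 2]real_normK ?num_real// ler_pXn2r ?nnegrE ?(ltW d0)//.
  by rewrite leNgt; apply/negP => /ltW h; apply: hn; exists y.
pose A := RI (edge_dom e) (fun x => u e x ^+ 2).
have A0 : 0 <= A by apply: RI_ge0 => x _; rewrite sqr_ge0.
pose L := A / d ^+ 2 + 1.
have d20 : 0 < d ^+ 2 by rewrite exprn_gt0.
have L0 : 0 <= L by rewrite addr_ge0// divr_ge0// ltW.
have Dy : edge_dom e (X + L) by apply: half_dom => //; lra.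
have h1 : RI `[X, X + L] (fun x => u e x ^+ 2) <= A.
  by apply: (RI_seg (edge_hdom e)) => // x _; rewrite sqr_ge0.
have : RI `[X, X + L] (fun=> d ^+ 2) <= RI `[X, X + L] (fun x => u e x ^+ 2).
  apply: le_RI => //; first exact: rint_cst.
    exact: (rint_seg (edge_hdom e) X0 Dy).
  by move=> x; rewrite /= in_itv/= => /andP[Xx _]; exact: big.
rewrite RI_cst; last lra.
rewrite /L addrAC subrr add0r mulrDr mulr1 mulrC divfK ?gt_eqF//; lra.
Qed.

Section Calibrated.
Variables (C : R) (psi Psi : R -> R).
Hypothesis cal : calibration C psi Psi.
Local Notation act e := (action psi (u e) (g e)).
Local Notation T e := (RI (edge_dom e) (act e)).

Lemma act_rint e : rint (edge_dom e) (act e).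
Proof. by case: (action_rint (edge_hdom e) (H1_wpair e H) (u2 e) cal). Qed.

Lemma psi_rint e : rint (edge_dom e) (fun x => psi `|u e x| ^+ 2).
Proof. by case: (action_rint (edge_hdom e) (H1_wpair e H) (u2 e) cal). Qed.

Lemma sum_action : \sum_e T e =
  N2 g / 2 + (\sum_e RI (edge_dom e) (fun x => psi `|u e x| ^+ 2)) / 2.
Proof.
rewrite -mulrDl /N2 /normsq -big_split/= mulr_suml; apply: eq_bigr => e _.
rewrite -RID//; last exact: psi_rint.
rewrite mulrC -RIZ//; last by apply: rintD => //; exact: psi_rint.
by apply: eq_RI => x _; rewrite /action; lra.
Qed.

Lemma seg_incr e x y : 0 <= x -> x <= y -> edge_dom e y ->
  `|Psi `|u e y| - Psi `|u e x| | <= RI `[x, y] (act e).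
Proof. exact: calibration_incr (edge_hdom e) (H1_wpair e H) (u2 e) cal. Qed.

Lemma three_segments e x y z : 0 <= x -> x <= y -> y <= z -> edge_dom e z ->
  `|Psi `|u e x| - Psi `|u e 0| | + `|Psi `|u e y| - Psi `|u e x| |
    + `|Psi `|u e z| - Psi `|u e y| | <= T e.
Proof.
move=> x0 xy yz Dz; have hD := edge_hdom e.
have Dy : edge_dom e y by case: hD => _ _ _; apply; [exact: Dz|rewrite yz (le_trans x0)].
have Dx : edge_dom e x by case: hD => _ _ _; apply; [exact: Dy|rewrite x0].
have y0 := le_trans x0 xy.
have := seg_incr (lexx 0) x0 Dx; have := seg_incr x0 xy Dy; have := seg_incr y0 yz Dz.
have : RI `[0, z] (act e) <= T e.
  by apply: (RI_seg hD) => //; [exact: act_rint|move=> w _; exact: action_ge0].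
have := @RI_cat _ 0 x z _ x0 (le_trans xy yz) (rint_seg hD (lexx 0) Dz (act_rint e)).
have := @RI_cat _ x y z _ xy yz (rint_seg hD x0 Dz (act_rint e)).
lra.
Qed.

Lemma to_infinity e x (r : R) : is_halfline e -> 0 <= x -> 0 < r ->
  exists y, [/\ x <= y, edge_dom e y & Psi `|u e y| <= Psi 0 + r].
Proof.
move=> he x0 r0; have [_ MV psiC] := cal.
have C0 : 0 <= C by have := psiC 1 ler01; rewrite expr1n mulr1; exact: (le_trans (sqr_ge0 _)).
have c0 : 0 < Num.sqrt C + 1 by have := sqrtr_ge0 C; lra.
pose d := Num.min 1 (r / (Num.sqrt C + 1)).
have d0 : 0 < d by rewrite lt_min ltr01/= divr_gt0.
have d1 : d <= 1 by rewrite ge_min lexx.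
have dr : d * (Num.sqrt C + 1) <= r.
  by rewrite -ler_pdivlMr// ge_min lexx orbT.
have [y xy yd] := vanishing he d0 x0.
have y0 := le_trans x0 xy.
exists y; split => //; first exact: half_dom.
have [c /andP[c0' cy] Hc] := MV 0 _ (lexx 0) (normr_ge0 (u e y)).
have : `|psi c| <= Num.sqrt C.
  rewrite -sqrtr_sqr ler_sqrt//; apply: (le_trans (psiC c c0')).
  by rewrite ler_piMr// exprn_ile1//; lra.
rewrite subr0 in Hc => pc; have := ler_norm (Psi `|u e y| - Psi 0).
have : `|psi c| * `|u e y| <= Num.sqrt C * d by apply: ler_pM.
nra.
Qed.

Lemma half_variation e x : is_halfline e -> 0 <= x ->
  `|Psi `|u e x| - Psi `|u e 0| | + (Psi `|u e x| - Psi 0) <= T e.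
Proof.
move=> he x0; apply/ler_addgt0Pr => r r0.
have [y [xy Dy fy]] := to_infinity he x0 r0.
have := three_segments (lexx 0) x0 xy Dy; rewrite subrr normr0.
have := ler_norm (- (Psi `|u e y| - Psi `|u e x|)); rewrite normrN; lra.
Qed.

(** One ascent from [a] to [x] and one descent from [x] to infinity, where [Psi |u|] comes
    arbitrarily close to [Psi 0]. *)
Lemma tail_variation e a x : is_halfline e -> 0 <= a -> a <= x ->
  2 * Psi `|u e x| - Psi `|u e a| - Psi 0 <= RI `[a, +oo[ (act e).
Proof.
move=> he a0 ax; apply/ler_addgt0Pr => r r0; have hD := edge_hdom e.
have x0 := le_trans a0 ax.
have [y [xy Dy fy]] := to_infinity he x0 r0.
have Dx : edge_dom e x by exact: half_dom.
have := seg_incr a0 ax Dx; have := seg_incr x0 xy Dy.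
have := @RI_cat _ a x y _ ax xy (rint_seg hD a0 Dy (act_rint e)).
have sub : `[a, +oo[ `<=` edge_dom e.
  by move=> z; rewrite /= in_itv/= andbT => az; apply: half_dom => //; exact: le_trans az.
have : RI `[a, y] (act e) <= RI `[a, +oo[ (act e).
  apply: RI_sub => //; first by move=> z; rewrite /= !in_itv/= andbT => /andP[].
    by apply: (rintS (edge_dom_measurable e)) => //; exact: act_rint.
  by move=> z _; exact: action_ge0.
have := ler_norm (- (Psi `|u e y| - Psi `|u e x|)); rewrite normrN.
have := ler_norm (Psi `|u e x| - Psi `|u e a|); lra.
Qed.

Lemma vertex_values : exists phi : 'I_(nV G) -> R,
  (forall e, u e 0 = phi (src G e)) /\
  (forall e v, tgt G e = Some v -> u e (len G e) = phi v).
Proof. by case: H => -[phi Hphi] _; exists phi; split=> e; case: (Hphi e). Qed.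

Lemma two_preimages_bound lev e x : no_terminal_point G -> Psi 0 <= lev ->
  (forall e v, tgt G e = Some v -> exists2 y, 0 <= y <= len G e & Psi `|u e y| <= lev) ->
  edge_dom e x -> 2 * (Psi `|u e x| - lev) <= \sum_e T e.
Proof.
move=> nt b0 low Dx; have [phi [p1 p2]] := vertex_values.
apply: (@two_preimages _ _ (fun e x => Psi `|u e x|) (fun v => Psi `|phi v|)
  (fun e => T e) (Psi 0) _ _ _ _ nt lev b0 low) => //.
- by move=> i /=; rewrite p1.
- by move=> i v /p2 ->.
- exact: three_segments.
- exact: half_variation.
Qed.

Lemma two_halflines_bound i j x : gconnected G -> is_halfline i -> is_halfline j ->
  i != j -> 0 <= x -> 2 * (Psi `|u i x| - Psi 0) <= \sum_e T e.
Proof.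
move=> cn hi hj ij x0; have [phi [p1 p2]] := vertex_values.
apply: (@two_halflines _ _ (fun e x => Psi `|u e x|) (fun v => Psi `|phi v|)
  (fun e => T e) (Psi 0) _ _ _ _ cn i j) => //.
- by move=> k /=; rewrite p1.
- by move=> k v /p2 ->.
- exact: three_segments.
- exact: half_variation.
Qed.

Lemma infinity_bound e x : gconnected G -> noncompact G -> edge_dom e x ->
  Psi `|u e x| - Psi 0 <= 2 * \sum_e T e.
Proof.
move=> cn nc Dx; have [phi [p1 p2]] := vertex_values.
apply: (@bound_from_infinity _ _ (fun e x => Psi `|u e x|) (fun v => Psi `|phi v|)
  (fun e => T e) (Psi 0) _ _ _ _ cn e x) => //.
- by move=> k /=; rewrite p1.
- by move=> k v /p2 ->.
- exact: three_segments.
- exact: half_variation.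
Qed.

End Calibrated.

(** A calibration independent of the height of [u], for a priori bounds that must come before any
    maximum is known to exist. *)
Lemma linear_calibration (c : R) : 0 <= c ->
  calibration (c ^+ 2) (fun t => c * t) (fun t => c * t ^+ 2 / 2).
Proof.
move=> c0; split.
- by move=> t; apply: cvgM; [exact: cvg_cst|exact: cvg_id].
- move=> s t s0 st; exists ((s + t) / 2); first by apply/andP; split; lra.
  rewrite (_ : c * t ^+ 2 / 2 - c * s ^+ 2 / 2 = c * ((s + t) / 2) * (t - s)); last by field.
  by rewrite normrM (ger0_norm (_ : 0 <= t - s)) ?subr_ge0.
- by move=> t _; rewrite exprMn.
Qed.

Lemma N2_ge0 (w : fam) : 0 <= N2 w. Proof. exact: normsq_ge0. Qed.

(** [infinity_bound] for the linear calibration reads [c u^2 <= 2 (N2 g + c^2 N2 u)] for all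
    [c >= 0]; the best choice is [c = u^2 / (4 N2 u)]. *)
Lemma sup_bound e x : gconnected G -> noncompact G -> edge_dom e x ->
  u e x ^+ 4 <= 16 * (N2 u * N2 g).
Proof.
move=> cn nc Dx.
have key c : 0 <= c -> c * u e x ^+ 2 <= 2 * (N2 g + c ^+ 2 * N2 u).
  move=> c0; have cal := linear_calibration c0.
  have := infinity_bound cal cn nc Dx.
  rewrite (sum_action cal) real_normK ?num_real// expr0n/= mulr0 mul0r subr0.
  rewrite (_ : \sum_e _ = c ^+ 2 * N2 u); first lra.
  rewrite /N2 /normsq mulr_sumr; apply: eq_bigr => i _; rewrite -RIZ//.
  by apply: eq_RI => z _; rewrite exprMn real_normK ?num_real.
have A0 := N2_ge0 g; have B0 := N2_ge0 u.
set A := N2 g in key A0 *; set B := N2 u in key B0 *.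
rewrite (exprM _ 2 2); set w := u e x ^+ 2 in key *.
have w0 : 0 <= w by rewrite sqr_ge0.
case: (eqVneq B 0) => [B00|Bn].
  rewrite B00 mul0r mulr0; case: (eqVneq w 0) => [->|wn]; first by rewrite expr0n.
  have wp : 0 < w by rewrite lt_neqAle eq_sym wn.
  have := key ((2 * A + 1) / w); rewrite B00 mulr0 addr0 divfK// => /(_ _).
  by rewrite divr_ge0//; [move=> /(_ isT); lra|lra].
have Bp : 0 < B by rewrite lt_neqAle eq_sym Bn.
have c0 : 0 <= w / (4 * B) by rewrite divr_ge0//; lra.
have := key _ c0.
rewrite (_ : w / (4 * B) * w = w ^+ 2 / (4 * B)); last by field; rewrite gt_eqF.
rewrite (_ : (w / (4 * B)) ^+ 2 * B = w ^+ 2 / (16 * B)); last by field; rewrite gt_eqF.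
have -> : w ^+ 2 / (4 * B) = 4 * (w ^+ 2 / (16 * B)) by field; rewrite gt_eqF.
move=> h; have : w ^+ 2 / (16 * B) <= A by lra.
by rewrite ler_pdivrMr; [lra|lra].
Qed.

Lemma u_meas e : lmfun (edge_dom e) (u e).
Proof. exact: wpair_meas (edge_hdom e) (H1_wpair e H). Qed.

Lemma pow6_rint (B : R) e (D : set R) : lmset D -> D `<=` edge_dom e ->
  (forall x, D x -> `|u e x| <= B) -> rint D (fun x => u e x ^+ 6).
Proof.
move=> mD sD uB; apply: (@rint_le _ _ _ (fun x => B ^+ 4 * u e x ^+ 2)) => //.
- have h : lmfun D (u e) by exact: (lmfunS (edge_dom_measurable e) sD (@u_meas e)).
  exact: measurable_funX.
- move=> x Dx; rewrite normrX (exprD _ 4 2) -[u e x ^+ 2]real_normK ?num_real//.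
  rewrite ler_wpM2r ?sqr_ge0// ler_pXn2r ?nnegrE//; first exact: uB.
  exact: le_trans (uB _ Dx).
- by apply: rintZ => //; exact: (rintS (edge_dom_measurable e) mD sD).
Qed.

Hypothesis cn : gconnected G.
Hypothesis nc : noncompact G.

Lemma H1_u6 e : rint (edge_dom e) (fun x => u e x ^+ 6).
Proof.
apply: (@pow6_rint (16 * (N2 u * N2 g) + 1)) => // x Dx.
have := sup_bound cn nc Dx; rewrite -[u e x ^+ 4]ger0_norm; last by rewrite (exprM _ 2 2) sqr_ge0.
rewrite normrX; set a := `|u e x|; set X := 16 * _ => h.
have a0 : 0 <= a by exact: normr_ge0.
case: (leP a 1) => a1.
  have X0 : 0 <= X by apply: le_trans h; rewrite exprn_ge0.
  lra.
have : a <= a ^+ 4 by rewrite -[leLHS]expr1 ler_weXn2l// ltW.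
lra.
Qed.

Lemma H1_L6 : L6pow u = (N6 u)%:E.
Proof.
rewrite /L6pow /gint /N6 -sumEFin; apply: eq_bigr => e _.
by rewrite -RI_fin//; exact: H1_u6.
Qed.

Lemma energyE : energy u g = (En u g)%:E.
Proof.
rewrite /energy (H1_L2g H) H1_L6 -!EFinM -EFinB; congr EFin.
by rewrite /En; field.
Qed.

(** [vanishing] gives small values only at some far points; the action left beyond [X], which is
    small, controls the oscillation of [u^2] on the way to them. *)
Lemma decay e (d : R) : is_halfline e -> 0 < d ->
  exists2 X, 0 <= X & forall x, X <= x -> `|u e x| <= d.
Proof.
move=> he d0; have cal := linear_calibration (@ler01 R).
pose h := action (fun t => 1 * t) (u e) (g e).
pose S := [set RI `[0, x] h | x in [set x | 0 <= x]].
have hD := edge_hdom e; have hi := act_rint cal e.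
have hS : has_sup S.
  split; first by exists (RI `[0, 0] h), 0 => /=.
  exists (RI (edge_dom e) h) => _ [x /= x0 <-]; apply: (RI_seg hD) => //.
    exact: half_dom.
  by move=> z _; exact: action_ge0.
have d40 : 0 < d ^+ 2 / 4 by rewrite divr_gt0// exprn_gt0.
have [_ [X /= X0 <-] HX] := sup_adherent d40 hS.
exists X => // x Xx; have x0 := le_trans X0 Xx.
have d20 : 0 < d / 2 by lra.
have [y xy yd] := vanishing he d20 x0.
have y0 := le_trans x0 xy.
have Dy : edge_dom e y by exact: half_dom.
rewrite -(@ler_pXn2r _ 2)// ?nnegrE ?(ltW d0)//.
have := seg_incr cal x0 xy Dy.
have := RI_cat X0 (le_trans Xx xy) (rint_seg hD (lexx 0) Dy hi).
have := RI_cat Xx xy (rint_seg hD X0 Dy hi).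
have : RI `[0, y] h <= sup S by apply: ub_le_sup; [case: hS|exists y].
have : 0 <= RI `[X, x] h by apply: RI_ge0 => z _; exact: action_ge0.
rewrite -/h; have := ler_norm (- (1 * `|u e y| ^+ 2 / 2 - 1 * `|u e x| ^+ 2 / 2)); rewrite normrN.
have : `|u e y| ^+ 2 <= (d / 2) ^+ 2 by rewrite ler_pXn2r ?nnegrE// ltW.
lra.
Qed.

Lemma u_within e : {within edge_dom e, continuous (u e)}.
Proof. exact: wpair_within (edge_hdom e) (H1_wpair e H). Qed.

Lemma abs_within e a b : 0 <= a -> edge_dom e b -> {within `[a, b], continuous (fun x => `|u e x|)}.
Proof.
move=> a0 Db; have : {within `[a, b], continuous (u e)}.
  by apply: continuous_subspaceW (@u_within e); exact: (hdom_seg (edge_hdom e)).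
by move=> h x; apply: cvg_norm; exact: h.
Qed.

(** On a half-line, once [u] is nonzero at some [x1], decay reduces the search to a compact interval
    containing [x1]. *)
Lemma edge_max e a : edge_dom e a -> exists x0, [/\ edge_dom e x0, a <= x0 &
  forall x, edge_dom e x -> a <= x -> `|u e x| <= `|u e x0|].
Proof.
move=> Da; have a0 : 0 <= a by case: (edge_hdom e) => _ _ + _; apply.
case E: (tgt G e) => [v|].
  have Dl := edge_dom_len E.
  have al : a <= len G e by move: Da; rewrite (edge_domE _ E) => /andP[].
  have [c] := EVT_max al (abs_within a0 Dl).
  rewrite in_itv/= => /andP[ac cl] Hc; exists c; split => //.
    by rewrite (edge_domE _ E) cl (le_trans a0).
  by move=> x; rewrite (edge_domE _ E) => /andP[_ xl] ax; apply: Hc; rewrite in_itv/= ax.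
have he : is_halfline e by apply/eqP.
case: (pselect (forall x, a <= x -> u e x = 0)) => [z|/existsNP[x1 /not_implyP[ax1 u1]]].
  by exists a; split => // x _ ax; rewrite z// normr0.
have d0 : 0 < `|u e x1| by rewrite normr_gt0; exact/eqP.
have [X X0 HX] := decay he d0.
pose b := Num.max X x1.
have x1b : x1 <= b by rewrite le_max lexx orbT.
have Db : edge_dom e b by apply: half_dom => //; rewrite le_max X0.
have [c] := EVT_max (le_trans ax1 x1b) (abs_within a0 Db).
rewrite in_itv/= => /andP[ac cb] Hc; exists c; split => //.
  by apply: half_dom => //; exact: le_trans ac.
move=> x _ ax; case: (leP x b) => xb; first by apply: Hc; rewrite in_itv/= ax.
apply: (@le_trans _ _ `|u e x1|).
  by apply: HX; apply: le_trans (ltW xb); rewrite le_max lexx.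
by apply: Hc; rewrite in_itv/= ax1.
Qed.

Lemma pred_max (P : pred 'I_(nE G)) (i0 : 'I_(nE G)) : P i0 -> exists e0 x0,
  [/\ P e0, edge_dom e0 x0 & forall e x, P e -> edge_dom e x -> `|u e x| <= `|u e0 x0|].
Proof.
move=> Pi; have /choice[c Hc] e := edge_max (edge_dom0 e).
pose e0 := [arg max_(i > i0 | P i) `|u i (c i)|]%O.
have [j Pj Hj] : extremum_spec >=%O P (fun i => `|u i (c i)|) e0 by exact: arg_maxP.
exists j, (c j); have [Dj _ _] := Hc j; split => // e x Pe Dx.
apply: le_trans (Hj e Pe); have [_ _ h] := Hc e; apply: h => //.
by case: (edge_hdom e) => _ _ + _; apply.
Qed.

Lemma min_level : exists2 m, 0 <= m &
  (forall e v, tgt G e = Some v -> exists2 y, 0 <= y <= len G e & `|u e y| <= m) /\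
  (m = 0 \/ exists e v, [/\ tgt G e = Some v & forall x, edge_dom e x -> m <= `|u e x|]).
Proof.
have ex e : exists y, forall v, tgt G e = Some v -> 0 <= y <= len G e /\
    forall x, edge_dom e x -> `|u e y| <= `|u e x|.
  case E: (tgt G e) => [v|]; last by exists 0.
  have l0 : 0 <= len G e by apply/ltW/(len_gt0 (m := G)); rewrite E.
  have [c] := EVT_min l0 (abs_within (lexx 0) (edge_dom_len E)).
  rewrite in_itv/= => cl Hc; exists c => w _; split => // x.
  by rewrite (edge_domE _ E) => Dx; apply: Hc; rewrite in_itv.
have [c Hc] := choice ex.
case: (pickP (fun e => ~~ is_halfline e)) => [i0 Pi|none].
  pose e0 := [arg max_(i > i0 | ~~ is_halfline i) `|u i (c i)|]%O.
  have [j Pj Hj] : extremum_spec >=%O (fun e => ~~ is_halfline e) (fun i => `|u i (c i)|) e0.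
    exact: arg_maxP.
  exists `|u j (c j)| => //; split.
    move=> e v E; have [cl _] := Hc e v E; exists (c e) => //; apply: Hj.
    by rewrite /is_halfline E.
  right; move: Pj; rewrite /is_halfline; case E: (tgt G j) => [v|]// _.
  by exists j, v; split => //; have [] := Hc j v E.
(* No bounded edge exists, so no level is lost. *)
exists 0 => //; split; last by left.
by move=> e v E; have := none e; rewrite /is_halfline E.
Qed.

End OneFunction.
End GraphFunctions.

#[local] Hint Resolve edge_dom_measurable : core.

(** * Energy estimates *)

Section Scaling.
Context {R : realType} (G : mgraph R).
Local Notation fam := ('I_(nE G) -> R -> R).
Implicit Types (u g : fam) (k : R).

Lemma N2Z k u : (forall e, rint (edge_dom e) (fun x => u e x ^+ 2)) ->
  N2 (fun e x => k * u e x) = k ^+ 2 * N2 u.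
Proof.
move=> u2; rewrite /N2 /normsq mulr_sumr; apply: eq_bigr => e _.
by rewrite -RIZ//; apply: eq_RI => x _; rewrite exprMn.
Qed.

Lemma N6Z k u : (forall e, rint (edge_dom e) (fun x => u e x ^+ 6)) ->
  N6 (fun e x => k * u e x) = k ^+ 6 * N6 u.
Proof.
move=> u6; rewrite /N6 mulr_sumr; apply: eq_bigr => e _.
by rewrite -RIZ//; apply: eq_RI => x _; rewrite exprMn.
Qed.

Lemma H1Z k u g : H1 u g -> H1 (fun e x => k * u e x) (fun e x => k * g e x).
Proof.
move=> H; split.
  have [phi [p1 p2]] := vertex_values H; exists (fun v => k * phi v) => e.
  by rewrite p1; split => // v E; rewrite (p2 e v E).
move=> e; have hD := edge_hdom e; have hp := H1_wpair e H.
have [mg g2 U] := wpair_lin k 0 hD hp hp.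
have mk : lmfun (edge_dom e) (fun x => k * g e x).
  by have [mg' _ _] := hp; apply: measurable_funM.
split => //.
- apply: (@eq_rint _ _ (fun x => k ^+ 2 * g e x ^+ 2)) => //; first by move=> x _; rewrite exprMn.
  by apply: rintZ => //; exact: H1_g2 H.
- apply: (@eq_rint _ _ (fun x => k ^+ 2 * u e x ^+ 2)) => //; first by move=> x _; rewrite exprMn.
  by apply: rintZ => //; exact: H1_u2 H.
- move=> x Dx; have := U x Dx; rewrite !mul0r !addr0 => ->; congr (_ + _).
  by apply: eq_RI => z _; rewrite mul0r addr0.
Qed.

End Scaling.

Section Estimates.
Context {R : realType} (G : mgraph R).
Local Notation fam := ('I_(nE G) -> R -> R).
Variables (u g : fam).
Hypothesis H : H1 u g.
Hypothesis cn : gconnected G.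
Hypothesis nc : noncompact G.
Local Notation q := (N2 u).
Local Notation s3 := (Num.sqrt (3 : R)).

Let u2 e := H1_u2 e H.
Let u6 e := H1_u6 H cn nc e.
#[local] Hint Resolve u2 u6 : core.

Lemma muR_half_action (M : R) : 2 * (M ^+ 4 * pi / (8 * s3)) = M ^+ 4 * muR / 6.
Proof.
rewrite /muR; have s30 : 0 < s3 by exact: sqrt3_gt0.
have E : s3 ^+ 2 = 3 by exact: sqrt3_sqr.
rewrite (_ : M ^+ 4 * (pi * s3 / 2) / 6 = M ^+ 4 * pi * s3 ^+ 2 / (12 * s3)); last first.
  by field; rewrite gt_eqF.
by rewrite E; field; rewrite gt_eqF.
Qed.

Lemma potential_pointwise (t M : R) : `|t| <= M ->
  psi0 M `|t| ^+ 2 = (M ^+ 4 * t ^+ 2 - t ^+ 6) / 3.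
Proof.
move=> tM; rewrite psi0_sqr real_normK ?num_real//.
have t4 : `|t| ^+ 4 <= M ^+ 4 by rewrite ler_pXn2r ?nnegrE// (le_trans _ tM).
rewrite -normrX ger0_norm in t4 *; last by rewrite (exprM _ 2 2) sqr_ge0.
by rewrite (max_idPr _) ?subr_ge0//; field.
Qed.

(** No bound on [|t|] is assumed: this serves bounded edges, where [|u|] may exceed the maximum [M]
    over the half-lines. *)
Lemma potential_le0 (t M : R) : psi0 M `|t| ^+ 2 <= M ^+ 4 * t ^+ 2 / 3.
Proof.
have := psi0_calibration M => -[_ _ /(_ `|t| (normr_ge0 _))].
by rewrite real_normK ?num_real// mulrAC.
Qed.

Lemma potential_sum (M : R) : (forall e x, edge_dom e x -> `|u e x| <= M) ->
  \sum_e RI (edge_dom e) (fun x => psi0 M `|u e x| ^+ 2) = (M ^+ 4 * q - N6 u) / 3.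
Proof.
move=> uM; rewrite /N2 /normsq /N6 mulr_sumr -sumrB mulr_suml; apply: eq_bigr => e _.
transitivity (RI (edge_dom e) (fun x => (M ^+ 4 / 3) * u e x ^+ 2 + (- 3^-1) * u e x ^+ 6)).
  by apply: eq_RI => x Dx; rewrite potential_pointwise; [field|exact: uM].
rewrite RID//; [|exact: rintZ..].
by rewrite !RIZ//; field.
Qed.

Section Global.
Hypothesis nt : no_terminal_point G.
Variables (e0 : 'I_(nE G)) (x0 M m : R).
Hypothesis D0 : edge_dom e0 x0.
Hypothesis M0 : 0 < M.
Hypothesis uM : forall e x, edge_dom e x -> `|u e x| <= M.
Hypothesis u0 : `|u e0 x0| = M.
Hypothesis m0 : 0 <= m.
Hypothesis low : forall e v, tgt G e = Some v ->
  exists2 y, 0 <= y <= len G e & `|u e y| <= m.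

(** The total action equals [En u g + M^4 q / 6] and dominates two crossings of the levels between
    [m] and [M]; the missing levels below [m] cost at most [M^2 m^2 / sqrt 3]. *)
Lemma energy_ge_A : M ^+ 4 * (muR - q) / 6 - M ^+ 2 * m ^+ 2 / s3 <= En u g.
Proof.
have cal := psi0_calibration M; have s30 : 0 < s3 by exact: sqrt3_gt0.
have b0 := prim_psi0_homo M (lexx 0) m0.
have low' e v : tgt G e = Some v ->
    exists2 y, 0 <= y <= len G e & prim (psi0 M) `|u e y| <= prim (psi0 M) m.
  by move=> /low[y yl uy]; exists y => //; apply: prim_psi0_homo.
have := two_preimages_bound H cal nt b0 low' D0.
rewrite (sum_action H cal) u0 potential_sum//.
have := prim_psi0_ge M0; have := prim_psi0_le M m0.
have := muR_half_action M; rewrite /En.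
have -> : M ^+ 2 * m ^+ 2 / (2 * s3) = M ^+ 2 * m ^+ 2 / s3 / 2 by field; rewrite gt_eqF.
set X := (M ^+ 2 * m ^+ 2 / s3); set Y := (M ^+ 4 * pi / (8 * s3)).
lra.
Qed.

(** The terms are, in order: the full double crossing, the loss below [m], the loss from [psi0] to
    [psi1], and the gain on [e1]. The last factor is a lower bound for the length of the part of
    [e1] where [|u| <= b]. *)
Lemma energy_ge_B e1 v1 b : tgt G e1 = Some v1 ->
  (forall x, edge_dom e1 x -> m <= `|u e1 x|) -> 0 < b -> 2 * b ^+ 4 <= M ^+ 4 ->
  M ^+ 4 * (muR - q) / 6 - M ^+ 2 * m ^+ 2 / s3 - m * M ^+ 2 * pi / s3
   + M ^+ 4 * m ^+ 2 / (12 * (1 + b ^+ 2)) * (len G e1 - q / b ^+ 2) <= En u g.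
Proof.
move=> E1 um b0 bM.
have mM : m <= M by apply: le_trans (uM (edge_dom0 e1)); apply: um; exact: edge_dom0.
have cal := psi1_calibration M m0; have s30 : 0 < s3 by exact: sqrt3_gt0.
have lv := prim_psi1_homo M m (lexx 0) m0.
have low' e v : tgt G e = Some v ->
    exists2 y, 0 <= y <= len G e & prim (psi1 M m) `|u e y| <= prim (psi1 M m) m.
  by move=> /low[y yl uy]; exists y => //; apply: prim_psi1_homo.
have := two_preimages_bound H cal nt lv low' D0.
rewrite (sum_action H cal) u0.
pose c := M ^+ 4 * m ^+ 2 / (6 * (1 + b ^+ 2)).
have b20 : 0 < b ^+ 2 by rewrite exprn_gt0.
have c0 : 0 <= c.
  by rewrite /c divr_ge0 ?mulr_ge0 ?sqr_ge0 ?exprn_ge0 ?(ltW M0)//; lra.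
have gain : \sum_e RI (edge_dom e) (fun x => psi1 M m `|u e x| ^+ 2)
    <= (M ^+ 4 * q - N6 u) / 3 - c * (len G e1 - q / b ^+ 2).
  rewrite -(potential_sum uM) (bigD1 e1)//= [X in _ <= X - _](bigD1 e1)//= addrAC lerD//; last first.
    apply: ler_sum => e _; apply: le_RI => //.
    - exact: (psi_rint H cal e).
    - exact: (psi_rint H (psi0_calibration M) e).
    - by move=> x _; exact: psi1_gain.
  have q1 : RI (edge_dom e1) (fun x => u e1 x ^+ 2) <= q.
    rewrite /N2 /normsq (bigD1 e1)//= lerDl; apply: sumr_ge0 => i _.
    by apply: RI_ge0 => x _; rewrite sqr_ge0.
  apply: (@le_trans _ _ (RI (edge_dom e1) (fun x => psi0 M `|u e1 x| ^+ 2) -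
      c * (len G e1 - RI (edge_dom e1) (fun x => u e1 x ^+ 2) / b ^+ 2))); last first.
    rewrite lerD2l lerN2 ler_wpM2l// lerD2l lerN2 ler_pM2r ?invr_gt0//.
  rewrite lerBrDr.
  have dE : edge_dom e1 = `[0, len G e1]%classic by rewrite /edge_dom E1.
  have l0 : 0 <= len G e1 by apply/ltW/(len_gt0 (m := G)); rewrite E1.
  have ci k : rint (edge_dom e1) (fun=> k) by rewrite dE; exact: rint_cst.
  have ki k : RI (edge_dom e1) (fun=> k) = k * len G e1 by rewrite dE RI_cst// subr0.
  have -> : c * (len G e1 - RI (edge_dom e1) (fun x => u e1 x ^+ 2) / b ^+ 2) =
      RI (edge_dom e1) (fun x => c + (- (c / b ^+ 2)) * u e1 x ^+ 2).
    rewrite RID//; last exact: rintZ.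
    by rewrite ki RIZ//; field; rewrite gt_eqF.
  rewrite -RID//; last 2 first.
  - exact: (psi_rint H cal e1).
  - by apply: rintD => //; exact: rintZ.
  apply: le_RI => //.
  - apply: rintD => //; first exact: (psi_rint H cal e1).
    by apply: rintD => //; exact: rintZ.
  - exact: (psi_rint H (psi0_calibration M) e1).
  - move=> x Dx; apply: le_trans (psi1_gain_mid m0 (um x Dx) b0 bM).
    rewrite -/c real_normK ?num_real// lerD2l le_eqVlt; apply/orP; left; apply/eqP.
    by field; rewrite gt_eqF.
have := prim_psi0_ge M0; have := prim_psi0_le M m0; have := prim_psi1_ge m0 mM.
have := muR_half_action M; rewrite /En.
have -> : M ^+ 2 * m ^+ 2 / (2 * s3) = M ^+ 2 * m ^+ 2 / s3 / 2 by field; rewrite gt_eqF.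
have -> : m * M ^+ 2 * pi / (2 * s3) = m * M ^+ 2 * pi / s3 / 2 by field; rewrite gt_eqF.
have -> : M ^+ 4 * m ^+ 2 / (12 * (1 + b ^+ 2)) * (len G e1 - q / b ^+ 2) =
    c * (len G e1 - q / b ^+ 2) / 2.
  by rewrite /c; field; rewrite !gt_eqF// ltr_pwDl// ltW.
move: gain; set X := (M ^+ 2 * m ^+ 2 / s3); set Y := (M ^+ 4 * pi / (8 * s3)).
set Z := (m * M ^+ 2 * pi / s3); set W := c * _.
lra.
Qed.

End Global.

(** Here [M] is the maximum over the half-lines only, where [two_halflines_bound] loses no levels.
    On bounded edges the negative sixth-power term is simply dropped, so the estimate keeps only the
    half-line part of [N6 u]. *)
Lemma halfline_estimate : (1 < nhalflines G)%N ->
  q <= muR ->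
  \sum_(e | is_halfline e) RI (edge_dom e) (fun x => u e x ^+ 6) <= 3 * N2 g.
Proof.
move=> h2 qR.
have /card_gt0P[i0] : (0 < nhalflines G)%N by exact: ltnW.
rewrite inE => hi0.
have [e0 [x0 [he0 D0 uM]]] := pred_max H hi0.
set M := `|u e0 x0| in uM.
have [j hj ij] : exists2 j, is_halfline j & e0 != j.
  move: h2; rewrite /nhalflines (cardD1 e0) inE he0 ltnS => /card_gt0P[j].
  by rewrite !inE => /andP[ne hj]; exists j; rewrite // eq_sym.
have x00 : 0 <= x0 by move: D0; rewrite edge_dom_half.
have cal := psi0_calibration M.
have := two_halflines_bound H cal cn he0 hj ij x00.
rewrite (sum_action H cal) -/M.
have S : \sum_e RI (edge_dom e) (fun x => psi0 M `|u e x| ^+ 2) <=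
    (M ^+ 4 * q - \sum_(e | is_halfline e) RI (edge_dom e) (fun x => u e x ^+ 6)) / 3.
  rewrite /N2 /normsq [X in X - _](_ : _ = M ^+ 4 *
     (\sum_(e | is_halfline e) RI (edge_dom e) (fun x => u e x ^+ 2)) + M ^+ 4 *
     (\sum_(e | ~~ is_halfline e) RI (edge_dom e) (fun x => u e x ^+ 2))); last first.
    by rewrite -mulrDr (bigID (@is_halfline R G)).
  rewrite addrAC !mulr_sumr -sumrB mulrDl !mulr_suml [leLHS](bigID (@is_halfline R G))/=.
  apply: lerD; apply: ler_sum => e he.
    apply: (@le_trans _ _ (RI (edge_dom e) (fun x => (M ^+ 4 / 3) * u e x ^+ 2 + (- 3^-1) * u e x ^+ 6))).
      apply: le_RI => //; first exact: (psi_rint H cal e).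
        by apply: rintD => //; exact: rintZ.
      by move=> x Dx; rewrite potential_pointwise; [lra|exact: uM].
    by rewrite RID//; [|exact: rintZ..]; rewrite !RIZ//; lra.
  apply: (@le_trans _ _ (RI (edge_dom e) (fun x => (M ^+ 4 / 3) * u e x ^+ 2))).
    apply: le_RI => //; [exact: (psi_rint H cal e)|exact: rintZ|].
    by move=> x Dx; apply: (le_trans (potential_le0 _ _)); lra.
  by rewrite RIZ//; lra.
have [M0|Mn] := eqVneq M 0.
  move=> _; rewrite big1; first by rewrite mulr_ge0// N2_ge0.
  move=> e he; rewrite (@eq_RI _ _ _ (fun=> 0 * 0)) => [|x Dx].
    by rewrite RIZ ?mul0r//; exact: integrable0.
  have := uM e x he Dx; rewrite M0 normr_le0 => /eqP ->.
  by rewrite expr0n/= mul0r.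
have M0 : 0 < M by rewrite lt0r Mn /M normr_ge0.
have := prim_psi0_ge M0; have := muR_half_action M.
have : 0 <= M ^+ 4 * (muR - q) by rewrite mulr_ge0 ?subr_ge0 ?exprn_ge0 ?(ltW M0).
by set Y := (M ^+ 4 * pi / (8 * s3)); lra.
Qed.

(** A tail starting from a value at most [r] climbs to its maximum and returns to 0, so only the
    levels below [r] are missed, once. Stating the loss with [B] makes it uniform along a bounded
    sequence. *)
Lemma tail_estimate e (a r B : R) : is_halfline e -> 0 <= a -> `|u e a| <= r ->
  (forall x, edge_dom e x -> `|u e x| <= B) -> q <= muR ->
  - (B ^+ 2 * r ^+ 2 / (2 * s3)) <= RI `[a, +oo[ (fun x => g e x ^+ 2) / 2
    - RI `[a, +oo[ (fun x => u e x ^+ 6) / 6.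
Proof.
move=> he a0 ua uB qR.
have Da : edge_dom e a by exact: half_dom.
have [x0 [D0 ax0 uM]] := edge_max H Da.
set M := `|u e x0| in uM.
have sub : `[a, +oo[ `<=` edge_dom e.
  by move=> z; rewrite /= in_itv/= andbT => az; apply: half_dom => //; exact: le_trans az.
have mt : lmset (`[a, +oo[ : set R) by [].
have s30 : 0 < s3 by exact: sqrt3_gt0.
have g2t : rint `[a, +oo[ (fun x => g e x ^+ 2) by exact: rintS (H1_g2 e H).
have u2t : rint `[a, +oo[ (fun x => u e x ^+ 2) by exact: rintS (u2 e).
have u6t : rint `[a, +oo[ (fun x => u e x ^+ 6) by exact: rintS (u6 e).
have r0 : 0 <= r by exact: le_trans ua.
have B0 : 0 <= B by exact: le_trans (uB _ Da).
have MB : M <= B by exact: uB.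
have [M0|Mn] := eqVneq M 0.
  have -> : RI `[a, +oo[ (fun x => u e x ^+ 6) = 0.
    rewrite (@eq_RI _ _ _ (fun=> 0 * 0)) => [|x Dx].
      by rewrite RIZ ?mul0r//; exact: integrable0.
    have ax : a <= x by move: Dx; rewrite /= in_itv/= andbT.
    have := uM x (sub _ Dx) ax; rewrite M0 normr_le0 => /eqP ->.
    by rewrite expr0n/= mul0r.
  have : 0 <= RI `[a, +oo[ (fun x => g e x ^+ 2) by apply: RI_ge0 => x _; rewrite sqr_ge0.
  have : 0 <= B ^+ 2 * r ^+ 2 / (2 * s3).
    by rewrite divr_ge0 ?mulr_ge0 ?sqr_ge0// ltW.
  lra.
have M0 : 0 < M by rewrite lt0r Mn /M normr_ge0.
have cal := psi0_calibration M.
have := tail_variation H cal he a0 ax0.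
have -> : RI `[a, +oo[ (action (psi0 M) (u e) (g e)) =
    RI `[a, +oo[ (fun x => g e x ^+ 2) / 2 + (M ^+ 4 * RI `[a, +oo[ (fun x => u e x ^+ 2)
      - RI `[a, +oo[ (fun x => u e x ^+ 6)) / 6.
  transitivity (RI `[a, +oo[ (fun x => 2^-1 * g e x ^+ 2 +
      ((M ^+ 4 / 6) * u e x ^+ 2 + (- 6^-1) * u e x ^+ 6))).
    apply: eq_RI => x Dx; rewrite /action potential_pointwise; first by field.
    by apply: uM; [exact: sub|move: Dx; rewrite /= in_itv/= andbT].
  rewrite RID//; [|exact: rintZ|by apply: rintD => //; exact: rintZ].
  rewrite RID//; [|exact: rintZ..].
  by rewrite !RIZ//; lra.
have := prim_psi0_ge M0; have := prim_psi0_le M (normr_ge0 (u e a)).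
have := muR_half_action M.
have qt : RI `[a, +oo[ (fun x => u e x ^+ 2) <= muR.
  apply: le_trans qR.
  apply: (@le_trans _ _ (RI (edge_dom e) (fun x => u e x ^+ 2))).
    by apply: RI_sub => // x _; rewrite sqr_ge0.
  rewrite /N2 /normsq (bigD1 e)//= lerDl; apply: sumr_ge0 => i _.
  by apply: RI_ge0 => x _; rewrite sqr_ge0.
have : M ^+ 4 * RI `[a, +oo[ (fun x => u e x ^+ 2) <= M ^+ 4 * muR.
  by rewrite ler_pM2l// exprn_gt0.
have : M ^+ 2 * `|u e a| ^+ 2 / (2 * s3) <= B ^+ 2 * r ^+ 2 / (2 * s3).
  rewrite ler_pM2r ?invr_gt0 ?mulr_gt0//; apply: ler_pM; rewrite ?sqr_ge0//.
    by rewrite ler_pXn2r ?nnegrE// ltW.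
  by rewrite ler_pXn2r ?nnegrE.
rewrite -/M; set Y := (M ^+ 4 * pi / (8 * s3)); set X := (M ^+ 2 * _ / _).
lra.
Qed.

End Estimates.

(** * Truncated solitons *)

Section Trial.
Context {R : realType}.
Implicit Types (f F : R -> R) (x y : R).

Lemma derive_continuous f x d : is_derive x 1 f d -> {for x, continuous f}.
Proof.
move=> h; apply: differentiable_continuous; apply/derivable1_diffP; exact: ex_derive.
Qed.

Lemma RI_FTC F f a b : a <= b -> (forall x, is_derive x 1 F (f x)) -> continuous f ->
  RI `[a, b] f = F b - F a.
Proof.
rewrite le_eqVlt => /predU1P[->|ab] dF cf.
  by rewrite subrr set_itv1 /RI Rintegral_set1.
have cF : continuous F by move=> x; exact: derive_continuous (dF x).
rewrite /RI /Rintegral (@continuous_FTC2 R f F a b)//.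
- exact: continuous_subspaceT.
- split.
  + by move=> x _; have hx := dF x; exact: ex_derive.
  + by apply: cvg_at_right_filter; exact: cF.
  + by apply: cvg_at_left_filter; exact: cF.
- by move=> x _; rewrite derive1E; have hx := dF x; exact: derive_val.
Qed.

Lemma continuous_rint f a b : continuous f -> rint `[a, b] f.
Proof.
move=> cf; apply: continuous_compact_integrable; first exact: segment_compact.
exact: continuous_subspaceT.
Qed.

Section Bump.
(** With [y = lam x - a], the notations below are [S = sech (2y)], [th = tanh (2y)] and
    [V = sqrt S], a soliton of height 1 and width of order [1 / lam] centred at [a / lam]. It is cut
    to [[0, L]] and lowered by its end value so as to vanish at both ends. *)
Variables (a lam : R).
Hypothesis a1 : 1 <= a.
Hypothesis lam0 : 0 < lam.
Local Notation L := (2 * a / lam).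
Local Notation P := (fun x : R => expR (2 * lam * x - 2 * a)).
Local Notation Q := (fun x : R => expR (2 * a - 2 * lam * x)).
Local Notation S := (fun x : R => 2 / (P x + Q x)).
Local Notation th := (fun x : R => (P x - Q x) / (P x + Q x)).
Local Notation V := (fun x : R => Num.sqrt (S x)).

Lemma Q_inv x : Q x = (P x)^-1.
Proof. by rewrite -expRN opprB. Qed.

Lemma P_gt0 x : 0 < P x. Proof. exact: expR_gt0. Qed.

Lemma PQ_gt0 x : 0 < P x + Q x. Proof. by rewrite addr_gt0 ?expR_gt0. Qed.

Lemma S_gt0 x : 0 < S x. Proof. by rewrite divr_gt0 ?PQ_gt0. Qed.

Lemma S_le1 x : S x <= 1.
Proof.
rewrite ler_pdivrMr ?PQ_gt0// mul1r Q_inv.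
have p0 := P_gt0 x; set p := expR _ in p0 *.
have : 0 <= (p - 1) ^+ 2 / p by rewrite divr_ge0 ?sqr_ge0// ltW.
rewrite (_ : _ / p = p + p^-1 - 2); first lra.
by field; rewrite gt_eqF.
Qed.

Lemma der_P x : is_derive x 1 P (P x * (2 * lam * 1 - 0)).
Proof.
exact: (der_comp (is_derive_expR _) (der_sub (der_scale _ (der_id x)) (der_cst _ _))).
Qed.

Lemma der_Q x : is_derive x 1 Q (Q x * (0 - 2 * lam * 1)).
Proof.
exact: (der_comp (is_derive_expR _) (der_sub (der_cst _ _) (der_scale _ (der_id x)))).
Qed.

Lemma der_inv x : is_derive x 1 (fun x => (P x + Q x)^-1)
  (- (P x + Q x) ^- 2 * (P x * (2 * lam * 1 - 0) + Q x * (0 - 2 * lam * 1))).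
Proof.
have pq : P x + Q x != 0 by rewrite gt_eqF ?PQ_gt0.
exact: (@is_deriveV R (fun x => P x + Q x) x _ 1 pq (der_add (der_P x) (der_Q x))).
Qed.

Lemma der_S x : is_derive x 1 S (- 2 * lam * S x * th x).
Proof.
apply: is_derive_eq (der_scale 2 (der_inv x)) _ => /=.
have := PQ_gt0 x; set p := expR _; set q := expR _ => pq.
by field; rewrite gt_eqF.
Qed.

Lemma der_th x : is_derive x 1 th (2 * lam * S x ^+ 2).
Proof.
apply: is_derive_eq (der_mul (der_sub (der_P x) (der_Q x)) (der_inv x)) _ => /=.
have p0 := P_gt0 x; rewrite Q_inv; set p := expR _ in p0 *.
by field; rewrite !gt_eqF// addr_gt0// mulr_gt0.
Qed.

Lemma th_sqr x : th x ^+ 2 = 1 - S x ^+ 2.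
Proof.
have p0 := P_gt0 x; rewrite Q_inv; set p := expR _ in p0 *.
by field; rewrite !gt_eqF// addr_gt0// mulr_gt0.
Qed.

Lemma der_V x : is_derive x 1 V (- lam * V x * th x).
Proof.
apply: is_derive_eq (@der_comp _ Num.sqrt S x _ _ (is_derive1_sqrt (S_gt0 x)) (der_S x)) _.
have s0 : 0 < V x by rewrite sqrtr_gt0 S_gt0.
have e2 : V x ^+ 2 = S x by rewrite sqr_sqrtr// ltW// S_gt0.
rewrite -[X in _ * (_ * X * _)]e2; set v := Num.sqrt _ in s0 *; set t := (_ / _).
by field; rewrite gt_eqF.
Qed.

Lemma der_atan x : is_derive x 1 (fun x => lam^-1 * atan (P x)) (S x).
Proof.
apply: is_derive_eq (der_scale _ (@der_comp _ (@atan R) P x _ _ (is_derive1_atan (P x)) (der_P x))) _.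
have p0 := P_gt0 x; rewrite Q_inv; set p := expR _ in p0 *.
by field; rewrite !gt_eqF//; rewrite ltr_pwDl// ?sqr_ge0// mulr_gt0.
Qed.

(** A virial identity: the boundary values have the right sign, so the integral of [S] is at most
    twice that of [S^3]. This yields the gradient bound in [bump_grad]. *)
Lemma der_Sth x : is_derive x 1 (fun x => (2 * lam)^-1 * (S x * th x)) (2 * S x ^+ 3 - S x).
Proof.
apply: is_derive_eq (der_scale _ (der_mul (der_S x) (der_th x))) _.
have -> : 2 * S x ^+ 3 - S x = 2 * S x ^+ 3 - S x * (th x ^+ 2 + S x ^+ 2).
  by rewrite th_sqr; ring.
by set s := (2 / _); set t := (_ / _); field; rewrite gt_eqF.
Qed.

Lemma S_cont : continuous S. Proof. by move=> x; exact: derive_continuous (der_S x). Qed.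
Lemma V_cont : continuous V. Proof. by move=> x; exact: derive_continuous (der_V x). Qed.
Lemma th_cont : continuous th. Proof. by move=> x; exact: derive_continuous (der_th x). Qed.

(** The hyperbolic secant evaluated at [2 b], that is, the value of [S] at distance [b / lam] from
    the centre. *)
Definition sech (b : R) := 2 / (expR (2 * b) + expR (- (2 * b))).

Lemma sech_gt0 b : 0 < sech b.
Proof. by rewrite divr_gt0// addr_gt0 ?expR_gt0. Qed.

Lemma S_ge x b : 0 <= b -> `|lam * x - a| <= b -> sech b <= S x.
Proof.
rewrite ler_norml => b0 /andP[h1 h2].
rewrite /sech expRN ler_pM2l// lef_pV2 ?posrE ?addr_gt0 ?invr_gt0 ?expR_gt0// Q_inv.
have pB : P x <= expR (2 * b) by rewrite ler_expR; lra.
have pB' : (expR (2 * b))^-1 <= P x by rewrite -expRN ler_expR; lra.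
have p0 := P_gt0 x; have B0 := expR_gt0 (2 * b).
set p := expR _ in p0 pB pB' *; set B := expR (2 * b) in B0 pB pB' *.
have : 0 <= (B - p) * (p - B^-1) / p by rewrite divr_ge0 ?mulr_ge0 ?subr_ge0// ltW.
rewrite (_ : _ / p = B + B^-1 - (p + p^-1)); first lra.
by field; rewrite !gt_eqF.
Qed.

Lemma sech_le b : 0 < b -> sech b <= b^-1.
Proof.
move=> b0; rewrite /sech ler_pdivrMr ?addr_gt0 ?expR_gt0// ler_pdivlMl//.
have := expR_ge1Dx (2 * b); have := expR_gt0 (- (2 * b)); lra.
Qed.

Local Notation h := (Num.sqrt (sech a)).
Definition bump x := if 0 <= x <= L then V x - h else 0.
Definition dbump x := if 0 <= x <= L then - lam * V x * th x else 0.

Lemma L_gt0 : 0 < L. Proof. by rewrite divr_gt0//; have := a1; lra. Qed.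

Lemma S_left : S 0 = sech a.
Proof. by rewrite /= mulr0 sub0r subr0 /sech addrC. Qed.

Lemma S_right : S L = sech a.
Proof.
rewrite /= (_ : 2 * lam * L = 4 * a); last by field; rewrite gt_eqF.
rewrite /sech (_ : 4 * a - 2 * a = 2 * a); last by ring.
by rewrite (_ : 2 * a - 4 * a = - (2 * a)); last by ring.
Qed.

Lemma V_ge_h x : 0 <= x <= L -> h <= V x.
Proof.
move=> /andP[x0 xL]; rewrite ler_sqrt ?(ltW (S_gt0 _))//; apply: S_ge; first by have := a1; lra.
have : lam * x <= 2 * a by rewrite -ler_pdivlMl// mulrC.
have : 0 <= lam * x by rewrite mulr_ge0// ltW.
by rewrite ler_norml => ? ?; apply/andP; split; lra.
Qed.

Lemma V_le1 x : V x <= 1.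
Proof. by rewrite -[leRHS]sqrtr1 ler_sqrt// S_le1. Qed.

Lemma supported f : (forall x, ~~ (0 <= x <= L) -> f x = 0) -> rint `[0, L] f ->
  rint `[0, +oo[ f /\ RI `[0, +oo[ f = RI `[0, L] f.
Proof.
move=> f0 fi.
have E (T : Type) (z : T) (F : R -> T) : (forall x, ~~ (0 <= x <= L) -> F x = z) ->
    patch (fun=> z) `[0, +oo[ F = patch (fun=> z) `[0, L] F.
  move=> F0; apply/funext => x; rewrite /patch.
  case: ifPn => [/set_mem|/negP nx]; case: ifPn => [/set_mem|/negP nx'] //=.
    by rewrite in_itv/= andbT => _; apply: F0; apply/negP => xL; apply: nx'; apply/mem_set; rewrite /= in_itv.
  rewrite in_itv/= => /andP[x0 _]; exfalso; apply: nx; apply/mem_set.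
  by rewrite /= in_itv/= x0.
have [_ k1] := @integrable_mkcond _ (measurableTypeR R) R lebesgue_measure
  `[0, +oo[ (EFin \o f) (measurable_itv _).
have [k2 _] := @integrable_mkcond _ (measurableTypeR R) R lebesgue_measure
  `[0, L] (EFin \o f) (measurable_itv _).
split.
  apply: k1; move: (k2 fi); rewrite (E _ 0%E (EFin \o f))//.
  by move=> x /f0 /= ->.
by rewrite /RI Rintegral_mkcond [RHS]Rintegral_mkcond (E _ 0 f).
Qed.

Lemma eq_supported f F : (forall x, ~~ (0 <= x <= L) -> f x = 0) -> continuous F ->
  (forall x, 0 <= x <= L -> f x = F x) ->
  rint `[0, +oo[ f /\ RI `[0, +oo[ f = RI `[0, L] F.
Proof.
move=> f0 cF fF.
have e x : `[0, L]%classic x -> F x = f x by rewrite /= in_itv/= => /fF.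
have [h1 h2] := supported f0 (eq_rint (measurable_itv _) e (continuous_rint 0 L cF)).
by split => //; rewrite h2; apply: eq_RI => x /e.
Qed.

Lemma bumpE x : 0 <= x <= L -> bump x = V x - h. Proof. by rewrite /bump => ->. Qed.
Lemma dbumpE x : 0 <= x <= L -> dbump x = - lam * V x * th x. Proof. by rewrite /dbump => ->. Qed.
Lemma bump_out x : ~~ (0 <= x <= L) -> bump x = 0. Proof. by rewrite /bump => /negbTE ->. Qed.
Lemma dbump_out x : ~~ (0 <= x <= L) -> dbump x = 0. Proof. by rewrite /dbump => /negbTE ->. Qed.

Lemma continuous_pow f n : continuous f -> continuous (fun x => f x ^+ n).
Proof.
move=> cf x; apply: (@continuous_comp _ _ _ f (fun r => r ^+ n)); first exact: cf.
exact: exprn_continuous.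
Qed.

Lemma bumpV_cont : continuous (fun x => V x - h).
Proof. by move=> x; apply: cvgB; [exact: V_cont|exact: cvg_cst]. Qed.

Lemma der_V_cont : continuous (fun x => - lam * V x * th x).
Proof.
move=> x; apply: cvgM; last exact: th_cont.
by apply: cvgM; [exact: cvg_cst|exact: V_cont].
Qed.

Lemma bump0 : bump 0 = 0.
Proof. by rewrite /bump; case: ifP => // _; rewrite S_left subrr. Qed.

Lemma bump_wpair : wpair `[0, +oo[ bump dbump.
Proof.
have [di _] := eq_supported dbump_out der_V_cont dbumpE.
have L0 := ltW L_gt0.
split.
- exact: rint_meas di.
- have [] // := @eq_supported (fun x => dbump x ^+ 2) _ _ (@continuous_pow _ 2 der_V_cont) _.
    by move=> x /dbump_out ->; rewrite expr0n.
  by move=> x /dbumpE ->.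
- move=> x; rewrite /= in_itv/= andbT => x0; rewrite bump0 add0r.
  have seg y : 0 <= y -> y <= L -> RI `[0, y] dbump = V y - h.
    move=> y0 yL; rewrite (@eq_RI _ _ _ (fun x => - lam * V x * th x)).
      by rewrite (RI_FTC y0 der_V der_V_cont) S_left.
    by move=> z; rewrite /= in_itv/= => /andP[z0 zy]; rewrite dbumpE// z0 (le_trans zy).
  case: (leP x L) => xL; first by rewrite bumpE ?x0// seg.
  rewrite bump_out; last by rewrite negb_and -!ltNge xL orbT.
  rewrite (@RI_cat _ 0 L x) ?(ltW xL)//; last first.
    by apply: rintS di => // z; rewrite /= !in_itv/= andbT => /andP[].
  rewrite seg// S_right subrr add0r.
  (* [dbump] need not vanish at [L] itself, so the endpoint is removed before comparing with 0. *)
  have -> : RI `[L, x] dbump = RI `]L, x] dbump.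
    rewrite /RI Rintegral_itv_obnd_cbnd//.
    apply: rintS di => // z; rewrite /= !in_itv/= andbT => /andP[/ltW Lz _].
    exact: le_trans Lz.
  rewrite (@eq_RI _ _ _ (fun=> 0)) ?/RI ?Rintegral_cst ?mul0r//.
  move=> z; rewrite /= in_itv/= => /andP[Lz _]; apply: dbump_out.
  by rewrite negb_and -!ltNge Lz orbT.
Qed.

(** The quantity shared by both sides of the energy: the gradient term is at most [lam^2] times it,
    and the sixth-power term equals it up to the truncation error. *)
Definition bump_J := RI `[0, L] (fun x => S x ^+ 3).

Lemma bump_S_int : RI `[0, L] S <= pi / (2 * lam).
Proof.
rewrite (RI_FTC (ltW L_gt0) der_atan S_cont).
have h1 : atan (P L) < pi / 2 by exact: atan_ltpi2.
have h2 : 0 <= atan (P 0) by rewrite -[leLHS](@atan0 R) le_atan// ltW// P_gt0.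
rewrite -mulrBr (_ : pi / (2 * lam) = lam^-1 * (pi / 2)); last by field; rewrite gt_eqF.
by rewrite ler_pM2l ?invr_gt0//; lra.
Qed.

Let mL : lmset (`[0, L] : set R). Proof. by []. Qed.

Lemma S3_rint : rint `[0, L] (fun x => S x ^+ 3).
Proof. exact: (continuous_rint _ _ (@continuous_pow _ 3 S_cont)). Qed.

Lemma bump_J_le : bump_J <= pi / (2 * lam).
Proof.
apply: le_trans bump_S_int; apply: le_RI => //.
- exact: S3_rint.
- exact: (continuous_rint _ _ S_cont).
- by move=> x _; rewrite -[leRHS]expr1 ler_wiXn2l ?S_le1// ltW// S_gt0.
Qed.

(** On this core [S >= sech 1], which gives lower bounds on mass and [bump_J] independent of the cut
    [a]. *)
Lemma middle_sub : `[(a - 1) / lam, (a + 1) / lam] `<=` `[0, L].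
Proof.
move=> x; rewrite /= !in_itv/= => /andP[h1 h2]; apply/andP; split.
  by apply: le_trans h1; rewrite divr_ge0 ?(ltW lam0)//; have := a1; lra.
by apply: (le_trans h2); rewrite ler_pM2r ?invr_gt0//; have := a1; lra.
Qed.

Lemma middle_S x : `[(a - 1) / lam, (a + 1) / lam]%classic x -> sech 1 <= S x.
Proof.
rewrite /= in_itv/= ler_pdivrMr// ler_pdivlMr// => /andP[h1 h2]; apply: S_ge => //.
by rewrite ler_norml mulrC; apply/andP; split; lra.
Qed.

Lemma middle_len : (a + 1) / lam - (a - 1) / lam = 2 / lam.
Proof. by field; rewrite gt_eqF. Qed.

Lemma middle_le : (a - 1) / lam <= (a + 1) / lam.
Proof. by rewrite ler_pM2r ?invr_gt0//; lra. Qed.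

Lemma bump_J_ge : 2 * sech 1 ^+ 3 / lam <= bump_J.
Proof.
apply: (@le_trans _ _ (RI `[(a - 1) / lam, (a + 1) / lam] (fun x => S x ^+ 3))); last first.
  apply: (RI_sub mL (measurable_itv _) middle_sub S3_rint).
  by move=> x _; rewrite exprn_ge0// ltW// S_gt0.
have -> : 2 * sech 1 ^+ 3 / lam = RI `[(a - 1) / lam, (a + 1) / lam] (fun=> sech 1 ^+ 3).
  by rewrite RI_cst ?middle_le// middle_len; ring.
apply: le_RI => //; first exact: rint_cst.
  exact: (continuous_rint _ _ (@continuous_pow _ 3 S_cont)).
move=> x /middle_S hx.
have s0 : S x \in Num.nneg by rewrite nnegrE; exact: ltW (S_gt0 x).
have c0 : sech 1 \in Num.nneg by rewrite nnegrE; exact: ltW (sech_gt0 1).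
exact: (lerXn2r 3 c0 s0 hx).
Qed.

Lemma bump2 : rint `[0, +oo[ (fun x => bump x ^+ 2) /\
  RI `[0, +oo[ (fun x => bump x ^+ 2) = RI `[0, L] (fun x => (V x - h) ^+ 2).
Proof.
apply: (@eq_supported (fun x => bump x ^+ 2)).
- by move=> x /bump_out ->; rewrite expr0n.
- exact: (@continuous_pow _ _ bumpV_cont).
- by move=> x /bumpE ->.
Qed.

Lemma bump6 : rint `[0, +oo[ (fun x => bump x ^+ 6) /\
  RI `[0, +oo[ (fun x => bump x ^+ 6) = RI `[0, L] (fun x => (V x - h) ^+ 6).
Proof.
apply: (@eq_supported (fun x => bump x ^+ 6)).
- by move=> x /bump_out ->; rewrite expr0n.
- exact: (@continuous_pow _ _ bumpV_cont).
- by move=> x /bumpE ->.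
Qed.

Lemma bump_mass_le : RI `[0, +oo[ (fun x => bump x ^+ 2) <= pi / (2 * lam).
Proof.
have [_ ->] := bump2; apply: le_trans bump_S_int; apply: le_RI => //.
- exact: (continuous_rint _ _ (@continuous_pow _ _ bumpV_cont)).
- exact: (continuous_rint _ _ S_cont).
- move=> x; rewrite /= in_itv/= => /V_ge_h hx.
  have e2 : V x ^+ 2 = S x by rewrite sqr_sqrtr// ltW// S_gt0.
  have h0 := sqrtr_ge0 (sech a).
  have aux (v k : R) : 0 <= k -> k <= v -> (v - k) ^+ 2 <= v ^+ 2.
    by move=> k0 kv; apply: lerXn2r; rewrite ?nnegrE; lra.
  by rewrite -[leRHS]e2; exact: aux h0 hx.
Qed.

Lemma bump_mass_ge : 2 * h <= Num.sqrt (sech 1) ->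
  sech 1 / (2 * lam) <= RI `[0, +oo[ (fun x => bump x ^+ 2).
Proof.
move=> h2; have [_ ->] := bump2.
apply: (@le_trans _ _ (RI `[(a - 1) / lam, (a + 1) / lam] (fun x => (V x - h) ^+ 2))); last first.
  apply: (RI_sub mL (measurable_itv _) middle_sub (continuous_rint _ _ (@continuous_pow _ _ bumpV_cont))).
  by move=> x _; rewrite sqr_ge0.
have -> : sech 1 / (2 * lam) = RI `[(a - 1) / lam, (a + 1) / lam] (fun=> sech 1 / 4).
  by rewrite RI_cst ?middle_le// middle_len; field; rewrite gt_eqF.
apply: le_RI => //; first exact: rint_cst.
  exact: (continuous_rint _ _ (@continuous_pow _ _ bumpV_cont)).
move=> x /middle_S hx.
have k0 := sqrtr_ge0 (sech 1).
have k2 : Num.sqrt (sech 1) ^+ 2 = sech 1 by rewrite sqr_sqrtr// ltW// sech_gt0.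
have kv : Num.sqrt (sech 1) <= V x by rewrite ler_sqrt// ltW// S_gt0.
have aux (k v j : R) : 0 <= k -> 2 * j <= k -> k <= v -> k ^+ 2 / 4 <= (v - j) ^+ 2.
  move=> ? ? ?; rewrite (_ : k ^+ 2 / 4 = (k / 2) ^+ 2); last by field.
  by apply: lerXn2r; rewrite ?nnegrE; lra.
by have := aux _ _ _ k0 h2 kv; rewrite k2.
Qed.

Lemma bump_grad : RI `[0, +oo[ (fun x => dbump x ^+ 2) <= lam ^+ 2 * bump_J.
Proof.
have E x : (- lam * V x * th x) ^+ 2 = lam ^+ 2 * (S x - S x ^+ 3).
  have e2 : V x ^+ 2 = S x by rewrite sqr_sqrtr// ltW// S_gt0.
  have aux (p v t s : R) : v ^+ 2 = s -> t ^+ 2 = 1 - s ^+ 2 ->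
      (- p * v * t) ^+ 2 = p ^+ 2 * (s - s ^+ 3).
    move=> vs ts; rewrite (_ : (- p * v * t) ^+ 2 = p ^+ 2 * (v ^+ 2 * t ^+ 2)); last by ring.
    by rewrite vs ts; ring.
  exact: aux e2 (th_sqr x).
have [_ ->] : rint `[0, +oo[ (fun x => dbump x ^+ 2) /\
    RI `[0, +oo[ (fun x => dbump x ^+ 2) = RI `[0, L] (fun x => (- lam * V x * th x) ^+ 2).
  apply: (@eq_supported (fun x => dbump x ^+ 2)).
  - by move=> x /dbump_out ->; rewrite expr0n.
  - exact: (@continuous_pow _ _ der_V_cont).
  - by move=> x /dbumpE ->.
have : 0 <= RI `[0, L] (fun x => 2 * S x ^+ 3 - S x).
  have cS3 : continuous (fun x => 2 * S x ^+ 3 - S x).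
    move=> x; apply: cvgB; last exact: S_cont.
    by apply: cvgM; [exact: cvg_cst|exact: (@continuous_pow _ 3 S_cont)].
  rewrite (RI_FTC (ltW L_gt0) der_Sth cS3) -mulrBr mulr_ge0 ?invr_ge0 ?mulr_ge0 ?(ltW lam0)//.
  rewrite S_left S_right -mulrBr mulr_ge0 ?(ltW (sech_gt0 _))//.
  have tL : 0 <= th L.
    rewrite divr_ge0 ?(ltW (PQ_gt0 _))// subr_ge0 ler_expR.
    rewrite (_ : 2 * lam * L = 4 * a); [by have := a1; lra|by field; rewrite gt_eqF].
  have t0 : th 0 <= 0.
    rewrite mulr_le0_ge0 ?invr_ge0 ?(ltW (PQ_gt0 _))// subr_le0 ler_expR mulr0; have := a1; lra.
  lra.
have Si := continuous_rint 0 L S_cont.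
have S3i := S3_rint.
have -> : RI `[0, L] (fun x => 2 * S x ^+ 3 - S x) = 2 * bump_J - RI `[0, L] S.
  transitivity (RI `[0, L] (fun x => 2 * S x ^+ 3 + (-1) * S x)).
    by apply: eq_RI => x _; ring.
  rewrite (RID mL (rintZ 2 mL S3i) (rintZ (-1) mL Si)).
  by rewrite (RIZ 2 mL S3i) (RIZ (-1) mL Si) mulN1r.
move=> h1; rewrite (eq_RI (fun x _ => E x)).
have -> : RI `[0, L] (fun x => lam ^+ 2 * (S x - S x ^+ 3)) = lam ^+ 2 * (RI `[0, L] S - bump_J).
  transitivity (RI `[0, L] (fun x => lam ^+ 2 * S x + (- lam ^+ 2) * S x ^+ 3)).
    by apply: eq_RI => x _; ring.
  rewrite (RID mL (rintZ _ mL Si) (rintZ _ mL S3i)).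
  by rewrite (RIZ _ mL Si) (RIZ _ mL S3i) -/bump_J mulNr mulrBr.
by rewrite ler_pM2l ?exprn_gt0//; lra.
Qed.

(** Since [0 <= h <= V <= 1], lowering [V] by [h] changes the sixth power by at most
    [6 h V^5 <= 6 h V^2], and [V^2 = S] has integral at most [pi / (2 lam)]. *)
Lemma bump_L6 : bump_J - 3 * pi * h / lam <= RI `[0, +oo[ (fun x => bump x ^+ 6).
Proof.
have [_ ->] := bump6.
have Si := continuous_rint 0 L S_cont.
have S3i := S3_rint.
apply: (@le_trans _ _ (RI `[0, L] (fun x => S x ^+ 3 + (- (6 * h)) * S x))).
  rewrite (RID mL S3i (rintZ _ mL Si)) (RIZ _ mL Si) -/bump_J lerD2l mulNr lerN2.
  have -> : 3 * pi * h / lam = 6 * h * (pi / (2 * lam)) by field; rewrite gt_eqF.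
  by rewrite ler_wpM2l ?bump_S_int// mulr_ge0 ?sqrtr_ge0.
apply: le_RI => //; first by apply: rintD => //; exact: rintZ.
  exact: (continuous_rint _ _ (@continuous_pow _ _ bumpV_cont)).
move=> x; rewrite /= in_itv/= => /V_ge_h hx.
have e2 : V x ^+ 2 = S x by rewrite sqr_sqrtr// ltW// S_gt0.
have v1 := V_le1 x; have h0 := sqrtr_ge0 (sech a).
suff aux (v k : R) : 0 <= k -> k <= v -> v <= 1 ->
    (v ^+ 2) ^+ 3 + (- (6 * k)) * v ^+ 2 <= (v - k) ^+ 6.
  by have := aux _ _ h0 hx v1; rewrite e2.
move=> {}h0 kv {}v1; have v0 : 0 <= v by exact: le_trans kv.
have b3 : v ^+ 3 - 3 * k * v ^+ 2 <= (v - k) ^+ 3.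
  rewrite (_ : (v - k) ^+ 3 = v ^+ 3 - 3 * k * v ^+ 2 + k ^+ 2 * (3 * v - k)); last by ring.
  by rewrite lerDl mulr_ge0 ?sqr_ge0//; lra.
have v3 : v ^+ 5 <= v ^+ 2 by rewrite ler_wiXn2l.
have b6 : v ^+ 6 - 6 * k * v ^+ 5 <= (v - k) ^+ 6.
  case: (leP 0 (v ^+ 3 - 3 * k * v ^+ 2)) => sg.
    apply: (@le_trans _ _ ((v ^+ 3 - 3 * k * v ^+ 2) ^+ 2)).
      rewrite (_ : (v ^+ 3 - 3 * k * v ^+ 2) ^+ 2 =
        v ^+ 6 - 6 * k * v ^+ 5 + (3 * k * v ^+ 2) ^+ 2); last by ring.
      by rewrite lerDl sqr_ge0.
    rewrite (exprM _ 3 2); apply: lerXn2r; rewrite ?nnegrE//.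
    by rewrite exprn_ge0 ?subr_ge0.
  apply: (@le_trans _ _ 0); last by rewrite exprn_ge0 ?subr_ge0.
  rewrite (_ : v ^+ 6 - 6 * k * v ^+ 5 = v ^+ 3 * (v ^+ 3 - 3 * k * v ^+ 2 - 3 * k * v ^+ 2)); last by ring.
  rewrite mulr_ge0_le0 ?exprn_ge0//.
  have : 0 <= 3 * k * v ^+ 2 by rewrite !mulr_ge0 ?sqr_ge0.
  lra.
apply: le_trans b6; rewrite -exprM lerD2l mulNr lerN2 ler_wpM2l//.
by rewrite mulr_ge0.
Qed.

End Bump.

Lemma bump_exists (eta lam : R) : 0 < eta -> 2 * eta <= Num.sqrt (sech 1) -> 0 < lam ->
  exists (U dU : R -> R) (J : R), [/\ wpair `[0, +oo[ U dU /\ U 0 = 0,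
    rint `[0, +oo[ (fun x => U x ^+ 2) /\
    sech 1 / (2 * lam) <= RI `[0, +oo[ (fun x => U x ^+ 2) <= pi / (2 * lam),
    RI `[0, +oo[ (fun x => dU x ^+ 2) <= lam ^+ 2 * J,
    J - 3 * pi * eta / lam <= RI `[0, +oo[ (fun x => U x ^+ 6) &
    2 * sech 1 ^+ 3 / lam <= J <= pi / (2 * lam)].
Proof.
move=> e0 e1 l0; have e20 : 0 < eta ^- 2 by rewrite invr_gt0 exprn_gt0.
(* Since [sech a <= 1 / a], the end value of the truncated soliton is at most [eta]. *)
pose a := 1 + eta ^- 2.
have a1 : 1 <= a by rewrite /a; lra.
have a0 : 0 < a by lra.
have ha : Num.sqrt (sech a) <= eta.
  rewrite -[leRHS]ger0_norm ?(ltW e0)// -sqrtr_sqr ler_sqrt ?sqr_ge0//.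
  apply: (le_trans (sech_le a0)); rewrite -[leRHS]invrK lef_pV2 ?posrE// /a; lra.
exists (bump a lam), (dbump a lam), (bump_J a lam); split.
- by split; [exact: bump_wpair|exact: bump0].
- split; first by case: (bump2 a lam).
  by rewrite bump_mass_le// andbT; apply: bump_mass_ge => //; lra.
- exact: bump_grad.
- apply: le_trans (bump_L6 a1 l0); rewrite lerD2l lerN2 ler_pM2r ?invr_gt0//.
  by rewrite ler_wpM2l// mulr_ge0// ltW// pi_gt0.
- by rewrite bump_J_ge// bump_J_le.
Qed.

End Trial.

(** * Compactness *)

Section Compactness.
Context {R : realType}.

(** An ultrafilter gives limits at all [t] at once, replacing diagonal extraction. What survives
    without the filter is that any finite set of points is approximated along some arbitrarily large
    index. *)
Lemma ultra_limit (T : Type) (a : nat -> T -> R) (B : R) :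
  (forall n t, `|a n t| <= B) -> exists l : T -> R,
  (forall t, `|l t| <= B) /\
  forall (I : finType) (t : I -> T) (r : R) (N : nat), 0 < r ->
    exists2 n, (N <= n)%N & forall i, `|a n (t i) - l (t i)| <= r.
Proof.
move=> aB.
have [U [UU sU]] := ultraFilterLemma (@eventually_filter).
have FU : ProperFilter U by exact: ultra_proper.
have ex t : exists l, `|l| <= B /\ forall r, 0 < r -> U [set n | `|a n t - l| <= r].
  have cB : compact (`[- B, B]%classic : set R) by exact: segment_compact.
  have UB : fmap (fun n => a n t) U `[- B, B]%classic.
    by rewrite /fmap /=; apply: filterE => n; rewrite /= in_itv/= -ler_norml.
  have [l [lB Ul]] := cB _ _ UB; exists l; split; first by move: lB; rewrite /= in_itv/= -ler_norml.
  move=> r r0; have [//|nU] := in_ultra_setVsetC [set n | `|a n t - l| <= r] UU.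
  have : fmap (fun n => a n t) U [set y | ~ (`|y - l| <= r)] by [].
  move=> /Ul/(_ (nbhsx_ballx l _ r0))[y [ny]]; rewrite /ball/= distrC => /ltW ly.
  by exfalso.
have [l Hl] := choice ex.
exists l; split; first by move=> t; case: (Hl t).
move=> I t r N r0.
have UN : U [set n | (N <= n)%N] by apply: sU; exists N.
have UI : \forall n \near U, forall i, `|a n (t i) - l (t i)| <= r.
  by apply: filter_forall => i; case: (Hl (t i)) => _; exact.
by have [n [Nn Hn]] := filter_ex (filterI UN UI); exists n.
Qed.

(** Freezing [u] beyond [b] discards the gradient of the tail without changing [u] on [[0, b]]. *)
Lemma trunc_wpair (D : set R) (u g : R -> R) (b : R) : hdom D -> wpair D u g -> D b ->
  wpair D (fun x => u (Num.min x b)) (fun x => if x <= b then g x else 0) /\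
  RI D (fun x => (if x <= b then g x else 0) ^+ 2) = RI `[0, b] (fun x => g x ^+ 2).
Proof.
move=> hD hp Db; have [mD D0 Dge Dd] := hD; have [mg g2 U] := hp.
have b0 := Dge _ Db.
have DE : D = `[0, b]%classic `|` (D `&` `]b, +oo[).
  apply/seteqP; split=> [x Dx|x [|[]]//]; last exact: (hdom_seg hD (lexx 0) Db).
  case: (leP x b) => xb; [left|right]; first by rewrite /= in_itv/= xb Dge.
  by split => //=; rewrite in_itv/= xb.
have mo : lmset (D `&` `]b, +oo[) by exact: measurableI.
have mh : lmfun D (fun x => if x <= b then g x else 0).
  rewrite DE; apply/(measurable_funU _ (measurable_itv `[0, b]) mo); split.
    apply: (@eq_measurable_fun _ _ _ _ _ g).
      by move=> x /set_mem; rewrite /= in_itv/= => /andP[_ ->].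
    exact: (lmfunS mD (hdom_seg hD (lexx 0) Db) mg).
  apply: (@eq_measurable_fun _ _ (measurableTypeR R) _ _ (fun=> 0 : R)); last exact: measurable_cst.
  by move=> x /set_mem[_]; rewrite /= in_itv/= andbT ltNge => /negbTE ->.
have h2 : rint D (fun x => (if x <= b then g x else 0) ^+ 2).
  apply: (@rint_le _ _ _ (fun x => g x ^+ 2)) => //; first exact: measurable_funX.
  by move=> x _; rewrite ger0_norm ?sqr_ge0//; case: ifP => // _; rewrite expr0n sqr_ge0.
have dis x : `[0, b]%classic x -> (D `&` `]b, +oo[) x -> False.
  by rewrite /= !in_itv/= andbT => /andP[_ xb] [_]; rewrite ltNge xb.
split; last first.
  rewrite {1}DE RI_setU//; last by rewrite -DE.
  rewrite [X in _ + X](@eq_RI _ _ _ (fun=> 0)) => [|x [_] /=]; last first.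
    by rewrite in_itv/= andbT ltNge => /negbTE ->; rewrite expr0n.
  rewrite [X in _ + X]/RI Rintegral_cst// mul0r addr0; apply: eq_RI => x /=.
  by rewrite in_itv/= => /andP[_ ->].
split => // x Dx.
have x0 := Dge _ Dx.
have E y : y <= b -> RI `[0, y] (fun x => if x <= b then g x else 0) = RI `[0, y] g.
  move=> yb; apply: eq_RI => z; rewrite /= in_itv/= => /andP[_ zy].
  by rewrite (le_trans zy yb).
rewrite (min_idPl b0); case: (leP x b) => xb; first by rewrite E// -U.
have hp' : wpair D (fun x => RI `[0, x] (fun x => if x <= b then g x else 0))
    (fun x => if x <= b then g x else 0).
  by split => // y Dy; rewrite set_itv1 [X in _ = X + _]/RI Rintegral_set1 add0r.
rewrite (@RI_cat _ 0 b x _ b0 (ltW xb) (wpair_rint hD hp' (lexx 0) Dx)) E//.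
have -> : RI `[b, x] (fun x => if x <= b then g x else 0) = 0.
  have i : rint `]b, x] (fun x => if x <= b then g x else 0).
    apply: rintS (wpair_rint hD hp' b0 Dx) => //; apply: subset_itvr; by rewrite bnd_simp.
  rewrite /RI -(Rintegral_itv_obnd_cbnd i).
  rewrite -[LHS]/(RI `]b, x] (fun x => if x <= b then g x else 0)).
  rewrite (@eq_RI _ _ _ (fun=> 0)) => [|z /=]; last by rewrite in_itv/= ltNge => /andP[/negbTE ->].
  by rewrite /RI Rintegral_cst// mul0r.
by rewrite addr0 -U.
Qed.

Lemma RI_split_half (f : R -> R) (b : R) : 0 <= b -> rint `[0, +oo[ f ->
  RI `[0, +oo[ f = RI `[0, b] f + RI `[b, +oo[ f.
Proof.
move=> b0 fi.
have i : rint `]b, +oo[ f.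
  by apply: rintS fi => //; apply: subset_itvr; rewrite bnd_simp.
have : RI `[0, +oo[ f - RI `[0, b] f = RI `]b, +oo[ f.
  by apply: Rintegral_itvB => //; rewrite bnd_simp.
rewrite /RI (Rintegral_itv_obnd_cbnd i) => <-; lra.
Qed.

Lemma RI_approx (D : set R) (f : R -> R) (r : R) : lmset D ->
  (forall x, D x -> 0 <= x) -> (forall x, D x -> 0 <= f x) -> rint D f -> 0 < r ->
  exists N : nat, forall n, (N <= n)%N -> RI D f <= RI (D `&` `[0, n%:R]) f + r.
Proof.
move=> mD D0 f0 fi r0; apply: contrapT => hn.
have mI (n : nat) : lmset (D `&` `[0, n%:R]) by exact: measurableI.
have sI (n : nat) : D `&` `[0, n%:R] `<=` D by move=> x [].
have fin (n : nat) : rint (D `&` `[0, n%:R]) f by exact: rintS fi.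
have key (n : nat) : RI (D `&` `[0, n%:R]) f <= RI D f - r.
  apply: contrapT => /negP; rewrite -ltNge => lt; apply: hn; exists n => k nk.
  have : RI (D `&` `[0, n%:R]) f <= RI (D `&` `[0, k%:R]) f.
    apply: RI_sub => //; last by move=> x [Dx _]; exact: f0.
    move=> x [Dx] /=; rewrite !in_itv/= => /andP[-> xn]; split => //.
    by rewrite (le_trans xn)// ler_nat.
  lra.
have [_] := RI_bounded mD (rint_meas fi) D0 f0 (fun n => conj (fin n) (key n)).
lra.
Qed.

Lemma pow_lip (n : nat) (B a b : R) : `|a| <= B -> `|b| <= B ->
  `|a ^+ n.+1 - b ^+ n.+1| <= n.+1%:R * B ^+ n * `|a - b|.
Proof.
move=> aB bB; have B0 : 0 <= B by exact: le_trans aB.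
rewrite subrXX normrM mulrC ler_wpM2r//.
apply: (le_trans (ler_norm_sum _ _ _)).
apply: (@le_trans _ _ (\sum_(i < n.+1) B ^+ n)); last by rewrite sumr_const card_ord mulr_natl.
apply: ler_sum => i _; rewrite normrM !normrX.
have -> : B ^+ n = B ^+ (n.+1.-1 - i) * B ^+ i.
  by rewrite -exprD subnK//= -ltnS.
by apply: ler_pM; rewrite ?exprn_ge0//; apply: lerXn2r; rewrite ?nnegrE.
Qed.

End Compactness.

(** * Limits of bounded sequences on the graph *)

Section GraphCompactness.
Context {R : realType} (G : mgraph R).
Local Notation fam := ('I_(nE G) -> R -> R).
Hypothesis cn : gconnected G.
Hypothesis nc : noncompact G.
Variables (un gn : nat -> fam) (mu B A l : R).
Hypothesis Hn : forall n, H1 (un n) (gn n).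
Hypothesis mass : forall n, N2 (un n) = mu.
Hypothesis mu_le_muR : mu <= muR.
Hypothesis B0 : 0 <= B.
Hypothesis bnd : forall n e x, edge_dom e x -> `|un n e x| <= B.
Hypothesis grad : forall n, N2 (gn n) <= A.
Hypothesis en : forall r : R, 0 < r -> exists N, forall n, (N <= n)%N -> En (un n) (gn n) <= l + r.

Lemma edge_le_N2 (w : fam) e : RI (edge_dom e) (fun x => w e x ^+ 2) <= N2 w.
Proof.
rewrite /N2 /normsq (bigD1 e)//= lerDl; apply: sumr_ge0 => i _.
by apply: RI_ge0 => x _; rewrite sqr_ge0.
Qed.

Local Notation modulus r := (r ^+ 2 / (4 * (A + 1))).

Lemma A_ge0 : 0 <= A. Proof. exact: le_trans (N2_ge0 _) (grad 0%N). Qed.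

Lemma modulus_gt0 (r : R) : 0 < r -> 0 < modulus r.
Proof. by move=> r0; rewrite divr_gt0 ?exprn_gt0//; have := A_ge0; lra. Qed.

Lemma equicontinuous n e (r x y : R) : 0 < r -> edge_dom e x -> edge_dom e y ->
  `|y - x| <= modulus r -> `|un n e y - un n e x| <= r.
Proof.
move=> r0 Dx Dy; apply: (wpair_ucont (edge_hdom e) (H1_wpair e (Hn n)) _ r0) => //.
exact: le_trans (edge_le_N2 _ _) (grad n).
Qed.

Lemma local_limit : exists u : fam, [/\ (forall e x, edge_dom e x -> `|u e x| <= B),
  (exists phi : 'I_(nV G) -> R, forall e, u e 0 = phi (src G e) /\
      (forall v, tgt G e = Some v -> u e (len G e) = phi v)),
  (forall e r x y, 0 < r -> edge_dom e x -> edge_dom e y ->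
     `|y - x| <= modulus r -> `|u e y - u e x| <= r) &
  forall (r X : R) N, 0 < r -> exists2 n, (N <= n)%N &
    forall e x, edge_dom e x -> x <= X -> `|un n e x - u e x| <= r].
Proof.
have /choice[phi Hphi] n := vertex_values (Hn n).
pose T := ('I_(nE G) * R + 'I_(nV G))%type.
(* The default 0 keeps the bound [B] off the edges, and at vertices incident to no edge, where
   [phi n] is unconstrained. *)
pose a n (t : T) := match t with
  | inl p => if `[< edge_dom p.1 p.2 >] then un n p.1 p.2 else 0
  | inr v => if `|phi n v| <= B then phi n v else 0 end.
have aB n t : `|a n t| <= B.
  case: t => [[e x]|v] /=.
    by case: asboolP => [/(bnd n)//|_]; rewrite normr0.
  by case: ifP => // _; rewrite normr0.
have [ll [lB ll_lim]] := ultra_limit aB.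
have ain n e x : edge_dom e x -> a n (inl (e, x)) = un n e x.
  by move=> Dx /=; case: asboolP.
have two (t1 t2 : T) (r : R) : 0 < r -> exists n,
    `|a n t1 - ll t1| <= r /\ `|a n t2 - ll t2| <= r.
  move=> r0; have [n _ Hnn] := ll_lim _ (fun b : bool => if b then t1 else t2) r 0%N r0.
  by exists n; split; [exact: (Hnn true)|exact: (Hnn false)].
exists (fun e x => ll (inl (e, x))); split.
- by move=> e x _; exact: lB.
- exists (fun v => ll (inr v)).
  have glue e x v : edge_dom e x -> (forall n, un n e x = phi n v) ->
      ll (inl (e, x)) = ll (inr v).
    move=> Dx E; apply/eqP; rewrite -subr_eq0 -normr_le0; apply/ler_addgt0Pr => r r0.
    have r2 : 0 < r / 2 by lra.
    have [n []] := two (inl (e, x)) (inr v) _ r2.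
    rewrite ain// /a -E (bnd n Dx) add0r !ler_norml => /andP[? ?] /andP[? ?].
    by apply/andP; split; lra.
  move=> e; split=> [|v E]; apply: glue.
  + exact: edge_dom0.
  + by move=> n; case: (Hphi n) => + _; exact.
  + exact: edge_dom_len E.
  + by move=> n; case: (Hphi n) => _; exact.
- move=> e r x y r0 Dx Dy xy; apply/ler_addgt0Pr => s s0.
  have s2 : 0 < s / 2 by lra.
  have [n []] := two (inl (e, x)) (inl (e, y)) _ s2.
  rewrite !ain//; have := equicontinuous n r0 Dx Dy xy.
  rewrite !ler_norml => /andP[? ?] /andP[? ?] /andP[? ?].
  by apply/andP; split; lra.
- move=> r X N r0; have r3 : 0 < r / 3 by lra.
  have d0 := modulus_gt0 r3; set d := modulus (r / 3) in d0.
  (* The grid [d * i] for [i < K] has a point within [d] on the left of each [x] of [[0, X]]. *)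
  pose K := (Num.truncn (X / d)).+1.
  have [n Nn HI] := ll_lim _ (fun p : 'I_(nE G) * 'I_K => inl (p.1, d * p.2%:R) : T) (r / 3) N r3.
  exists n => // e x Dx xX.
  have [_ _ Dge Ddown] := edge_hdom e; have x0 := Dge _ Dx.
  have xd : 0 <= x / d by rewrite divr_ge0// ltW.
  have /andP[i1 i2] := truncn_itv xd.
  have iK : (Num.truncn (x / d) < K)%N.
    by rewrite /K ltnS; apply: le_truncn; rewrite ler_pM2r ?invr_gt0.
  pose z := d * (Num.truncn (x / d))%:R.
  have zx : z <= x by rewrite /z mulrC -ler_pdivlMr.
  have xz : x <= z + d.
    by apply/ltW; rewrite /z -[X in _ + X]mulr1 -mulrDr natr1 mulrC -ltr_pdivrMr.
  have Dz : edge_dom e z by apply: Ddown Dx _; rewrite zx mulr_ge0// ltW.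
  have h1 : `|un n e x - un n e z| <= r / 3.
    by apply: equicontinuous => //; rewrite ger0_norm ?subr_ge0//; rewrite -/d; lra.
  have h2 := HI (e, Ordinal iK); rewrite ain// -/z in h2.
  have h3 : `|ll (inl (e, x)) - ll (inl (e, z))| <= r / 3.
    apply/ler_addgt0Pr => s s0; have s2 : 0 < s / 2 by lra.
    have [k []] := two (inl (e, x)) (inl (e, z)) _ s2.
    have : `|un k e x - un k e z| <= r / 3.
      by apply: equicontinuous => //; rewrite ger0_norm ?subr_ge0//; rewrite -/d; lra.
    rewrite !ain// !ler_norml => /andP[? ?] /andP[? ?] /andP[? ?].
    by apply/andP; split; lra.
  move: h1 h2 h3; rewrite !ler_norml /= => /andP[? ?] /andP[? ?] /andP[? ?].
  by apply/andP; split; lra.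
Qed.

Lemma ler_of_mul (a b c : R) : (forall r, 0 < r -> a <= b + r * c) -> a <= b.
Proof.
move=> h; apply/ler_addgt0Pr => r r0.
have c1 : 0 < `|c| + 1 by rewrite ltr_pwDr.
apply: (le_trans (h _ (divr_gt0 r0 c1))); rewrite lerD2l mulrAC ler_pdivrMr// ler_pM2l//.
by rewrite (le_trans (ler_norm c))// lerDl.
Qed.

Lemma graph_compactness : exists u g, [/\ H1 u g, N2 u <= mu, En u g <= l &
  forall (r X : R) N, 0 < r -> exists2 n, (N <= n)%N &
    forall e x, edge_dom e x -> x <= X -> `|un n e x - u e x| <= r].
Proof.
have [u [uB glue equi loc]] := local_limit.
have u_meas e : lmfun (edge_dom e) (u e).
  have c : {within edge_dom e, continuous (u e)}.
    apply: ucont_within => x r Dx r0.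
    by exists (modulus r); [exact: modulus_gt0|move=> y Dy /ltW; exact: equi].
  exact: (subspace_continuous_measurable_fun (edge_dom_measurable e) c).
have seg_sub (e : 'I_(nE G)) X : edge_dom e X -> `[0, X] `<=` edge_dom e.
  by move=> DX; exact: (hdom_seg (edge_hdom e) (lexx 0) DX).
have mI e (n : nat) : lmset (edge_dom (G := G) e `&` `[0, n%:R]) by exact: measurableI.
have subI (e : 'I_(nE G)) (n : nat) : edge_dom e `&` `[0, n%:R] `<=` edge_dom e.
  by move=> x [].
have fint (e : 'I_(nE G)) (n : nat) k : rint (edge_dom e `&` `[0, n%:R]) (fun=> k : R).
  have sub : edge_dom e `&` `[0, n%:R] `<=` `[0, n%:R] by move=> x [].
  exact: (rintS (measurable_itv _) (mI e n) sub (rint_cst _ _ _)).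
have bint (f : R -> R) (e : 'I_(nE G)) (n : nat) (k : R) : lmfun (edge_dom e) f ->
    (forall x, edge_dom e x -> `|f x| <= k) -> rint (edge_dom e `&` `[0, n%:R]) f.
  move=> mf fk; apply: (@rint_le _ _ _ (fun=> k)) => //.
    by apply: (lmfunS (edge_dom_measurable e) _ mf) => x [].
  by move=> x [/fk].
have u2n e (n : nat) : rint (edge_dom e `&` `[0, n%:R]) (fun x => u e x ^+ 2).
  apply: (@bint _ _ _ (B ^+ 2)); first exact: measurable_funX.
  by move=> x Dx; rewrite normrX lerXn2r ?nnegrE// uB.
have sumn2 (n : nat) : \sum_e RI (edge_dom e `&` `[0, n%:R]) (fun x => u e x ^+ 2) <= mu.
  apply: (@ler_of_mul _ _ (2 * B * n%:R * (nE G)%:R)) => r r0.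
  have [k _ Hk] := loc r n%:R 0%N r0.
  rewrite -(mass k) /N2 /normsq.
  have -> : r * (2 * B * n%:R * (nE G)%:R) = \sum_(e < nE G) (2 * B * r * n%:R).
    by rewrite sumr_const card_ord -[RHS]mulr_natr; ring.
  rewrite -big_split/=; apply: ler_sum => e _.
  have uk2 : rint (edge_dom e `&` `[0, n%:R]) (fun x => un k e x ^+ 2).
    exact: (rintS (edge_dom_measurable e) (mI e n) (subI e n) (H1_u2 e (Hn k))).
  apply: (@le_trans _ _ (RI (edge_dom e `&` `[0, n%:R]) (fun x => un k e x ^+ 2 + 2 * B * r))).
    apply: le_RI => //; first by apply: rintD.
    move=> x [Dx]; rewrite /= in_itv/= => /andP[_ xn].
    have h1 := pow_lip 1 (uB e x Dx) (bnd k Dx).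
    have h2 : 2 * B ^+ 1 * `|u e x - un k e x| <= 2 * B * r.
      by rewrite expr1 ler_wpM2l ?mulr_ge0// distrC; exact: Hk.
    have := ler_norm (u e x ^+ 2 - un k e x ^+ 2); lra.
  rewrite RID// lerD//.
    apply: (RI_sub (edge_dom_measurable e) (mI e n) (subI e n) (H1_u2 e (Hn k))).
    by move=> x _; rewrite sqr_ge0.
  apply: (@le_trans _ _ (RI `[0, n%:R] (fun=> 2 * B * r))).
    have sub : edge_dom e `&` `[0, n%:R] `<=` `[0, n%:R] by move=> x [].
    apply: (RI_sub (measurable_itv _) (mI e n) sub (rint_cst _ _ _)) => x _.
    by rewrite !mulr_ge0// ltW.
  by rewrite RI_cst// subr0.
have u2e e : rint (edge_dom e) (fun x => u e x ^+ 2).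
  have bb (n : nat) : rint (edge_dom e `&` `[0, n%:R]) (fun x => u e x ^+ 2) /\
      RI (edge_dom e `&` `[0, n%:R]) (fun x => u e x ^+ 2) <= mu.
    split => //; apply: le_trans (sumn2 n); rewrite (bigD1 e)//= lerDl.
    by apply: sumr_ge0 => i _; apply: RI_ge0 => x _; rewrite sqr_ge0.
  have m2 : lmfun (edge_dom e) (fun x => u e x ^+ 2) by exact: measurable_funX.
  have dge x : edge_dom e x -> 0 <= x by case: (edge_hdom e) => _ _ + _; apply.
  have [] := RI_bounded (edge_dom_measurable e) m2 dge _ bb; last by [].
  by move=> x _; rewrite sqr_ge0.
have N2u : N2 u <= mu.
  apply: (@ler_of_mul _ _ (nE G)%:R) => r r0.
  have ex e : exists N : nat, forall n, (N <= n)%N ->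
      RI (edge_dom e) (fun x => u e x ^+ 2) <=
      RI (edge_dom e `&` `[0, n%:R]) (fun x => u e x ^+ 2) + r.
    apply: RI_approx => //; first by case: (edge_hdom e).
    by move=> x _; rewrite sqr_ge0.
  have [N HN] := choice ex; pose n := (\max_e N e)%N.
  apply: (@le_trans _ _ (\sum_e (RI (edge_dom e `&` `[0, n%:R]) (fun x => u e x ^+ 2) + r))).
    by apply: ler_sum => e _; apply: HN; exact: leq_bigmax.
  by rewrite big_split/= sumr_const card_ord mulr_natr lerD2r.
have u6e e : rint (edge_dom e) (fun x => u e x ^+ 6).
  apply: (@rint_le _ _ _ (fun x => B ^+ 4 * u e x ^+ 2)) => //; last exact: rintZ.
    exact: measurable_funX.
  move=> x Dx; rewrite normrX (exprD _ 4 2) -[u e x ^+ 2]real_normK ?num_real//.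
  by rewrite ler_wpM2r ?sqr_ge0// lerXn2r ?nnegrE// uB.
(* cut points: the far end of a bounded edge, a point of small value on a half-line *)
have cut k : exists b : 'I_(nE G) -> R, forall e, [/\ edge_dom e (b e),
    (forall v, tgt G e = Some v -> b e = len G e) &
    is_halfline e -> k%:R <= b e /\ `|u e (b e)| <= dyadic k].
  suff /choice : forall e, exists b, [/\ edge_dom e b,
    (forall v, tgt G e = Some v -> b = len G e) &
    is_halfline e -> k%:R <= b /\ `|u e b| <= dyadic k] by move=> [b Hb]; exists b.
  move=> e; case E: (tgt G e) => [v|].
    by exists (len G e); split=> [||]; [exact: edge_dom_len E|by []|rewrite /is_halfline E].
  have he : is_halfline e by apply/eqP.
  apply: contrapT => hn.
  have big x : k%:R <= x -> dyadic k <= `|u e x|.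
    move=> kx; rewrite leNgt; apply/negP => /ltW lt; apply: hn; exists x; split => //.
    by apply: half_dom => //; exact: le_trans kx.
  have dk := @dyadic_gt0 R k.
  (* If [|u| >= dyadic k] beyond [k], some [un n] stays above [dyadic k / 2] on a length [L] and
     would have mass at least [mu + 1]. *)
  pose L := (mu + 1) / (dyadic k / 2) ^+ 2.
  have mu0 : 0 <= mu by rewrite -(mass 0%N) N2_ge0.
  have dk2 : 0 < (dyadic k / 2 : R) ^+ 2 by rewrite exprn_gt0// divr_gt0.
  have L0 : 0 < L by rewrite divr_gt0//; lra.
  have r0 : 0 < dyadic k / 2 :> R by lra.
  have [n _ Hnn] := loc _ (k%:R + L) 0%N r0.
  have DL : edge_dom e (k%:R + L) by apply: half_dom => //; rewrite addr_ge0// ltW.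
  have : RI `[k%:R, k%:R + L] (fun=> (dyadic k / 2) ^+ 2) <=
      RI `[k%:R, k%:R + L] (fun x => un n e x ^+ 2).
    apply: le_RI => //; first exact: rint_cst.
      by apply: (rint_seg (edge_hdom e) _ DL) => //; exact: H1_u2 (Hn n).
    move=> x; rewrite /= in_itv/= => /andP[kx xL].
    rewrite -[un n e x ^+ 2]real_normK ?num_real// lerXn2r ?nnegrE// ?(ltW r0)//.
    have Dx : edge_dom e x by apply: half_dom => //; exact: le_trans kx.
    have := Hnn e x Dx xL; have := big x kx.
    have := ler_dist_dist (u e x) (un n e x); rewrite [`|u e x - _|]distrC.
    have := ler_norm (`|u e x| - `|un n e x|); lra.
  rewrite RI_cst; last lra.
  rewrite addrAC subrr add0r /L mulrC divfK ?gt_eqF// => h.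
  have : RI `[k%:R, k%:R + L] (fun x => un n e x ^+ 2) <= mu.
    rewrite -(mass n); apply: le_trans (edge_le_N2 _ e).
    by apply: (RI_seg (edge_hdom e)) => //; [exact: H1_u2 (Hn n)|move=> x _; rewrite sqr_ge0].
  lra.
have [b Hb] := choice cut.
pose X k := \sum_e b k e.
have b0 k e : 0 <= b k e.
  by case: (Hb k e) => Db _ _; case: (edge_hdom e) => _ _ + _; apply.
have bX k e : b k e <= X k.
  by rewrite /X (bigD1 e)//= lerDl; apply: sumr_ge0 => i _; exact: b0.
have X0 k : 0 <= X k by apply: sumr_ge0 => i _; exact: b0.
(* The accuracy must stay small after integration over a segment of length up to [X k], which grows
   with [k]. *)
pose rr k : R := dyadic k / (1 + X k).
have rr0 k : 0 < rr k by rewrite divr_gt0 ?dyadic_gt0// ltr_pwDl.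
have rrdl k : rr k <= dyadic k.
  by rewrite ler_pdivrMr ?ltr_pwDl// ler_peMr ?(ltW (dyadic_gt0 _))// lerDl.
have rrX k : rr k * X k <= dyadic k.
  rewrite /rr mulrAC ler_pdivrMr ?ltr_pwDl// ler_pM2l ?dyadic_gt0// lerDr//.
have /choice[nn Hnn] k : exists n, (k <= n)%N /\
    forall e x, edge_dom e x -> x <= X k -> `|un n e x - u e x| <= rr k.
  by have [n kn h] := loc _ (X k) k (rr0 k); exists n.
pose v k : fam := fun e x => un (nn k) e (Num.min x (b k e)).
pose h k : fam := fun e x => if x <= b k e then gn (nn k) e x else 0.
have vh k e : wpair (edge_dom e) (v k e) (h k e) /\
    RI (edge_dom e) (fun x => h k e x ^+ 2) = RI `[0, b k e] (fun x => gn (nn k) e x ^+ 2).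
  by apply: trunc_wpair; [exact: edge_hdom|exact: H1_wpair (Hn _)|case: (Hb k e)].
(* On a bounded edge the cut is the far end and nothing is discarded; on a half-line the value of
   [un] at the cut is at most [2 dyadic k], so the tail costs little. *)
have edge_est k e : RI (edge_dom e) (fun x => h k e x ^+ 2) / 2 <=
    (RI (edge_dom e) (fun x => gn (nn k) e x ^+ 2) / 2
      - RI (edge_dom e) (fun x => un (nn k) e x ^+ 6) / 6)
    + RI (edge_dom e) (fun x => u e x ^+ 6) / 6 + (B ^+ 5 + 2 * B ^+ 2) * dyadic k.
  have [_ ->] := vh k e; have [Db bl bh] := Hb k e.
  have u6n := H1_u6 (Hn (nn k)) cn nc e; have g2n := H1_g2 e (Hn (nn k)).
  have msg : lmset (`[0, b k e] : set R) by [].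
  have cmp : RI `[0, b k e] (fun x => un (nn k) e x ^+ 6) <=
      RI (edge_dom e) (fun x => u e x ^+ 6) + 6 * B ^+ 5 * dyadic k.
    apply: (@le_trans _ _ (RI `[0, b k e] (fun x => u e x ^+ 6 + 6 * B ^+ 5 * rr k))).
      apply: le_RI => //; first by apply: rintS u6n => //; exact: seg_sub.
        by apply: rintD => //; [apply: rintS (u6e e) => //; exact: seg_sub|exact: rint_cst].
      move=> x xb; have Dx := seg_sub _ _ Db _ xb.
      have xX : x <= X k by move: xb; rewrite /= in_itv/= => /andP[_ /le_trans]; apply.
      have [_ Hx] := Hnn k.
      have h1 := pow_lip 5 (bnd (nn k) Dx) (uB e x Dx).
      have h2 : 6 * B ^+ 5 * `|un (nn k) e x - u e x| <= 6 * B ^+ 5 * rr k.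
        by rewrite ler_wpM2l ?mulr_ge0 ?exprn_ge0//; exact: Hx.
      have := ler_norm (un (nn k) e x ^+ 6 - u e x ^+ 6); lra.
    rewrite RID//; [|by apply: rintS (u6e e) => //; exact: seg_sub|exact: rint_cst].
    rewrite lerD//.
      apply: RI_sub => //; first exact: seg_sub.
      by move=> x _; rewrite (exprM _ 3 2) sqr_ge0.
    rewrite RI_cst ?b0// subr0 -mulrA ler_wpM2l ?mulr_ge0 ?exprn_ge0//.
    by apply: le_trans (rrX k); rewrite ler_pM2l.
  have d0 := @dyadic_gt0 R k; have d1 := @dyadic_le1 R k.
  have B5 : 0 <= B ^+ 5 by rewrite exprn_ge0.
  have B2 : 0 <= B ^+ 2 * dyadic k by rewrite mulr_ge0 ?exprn_ge0// ltW.
  case: (boolP (is_halfline e)) => [he|]; last first.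
    rewrite /is_halfline; case E: (tgt G e) => [t|]// _.
    have dE : edge_dom e = `[0, b k e]%classic by rewrite (bl _ E) /edge_dom E.
    move: cmp; rewrite {2 3}dE; lra.
  have dE : edge_dom e = `[0, +oo[%classic by move/eqP: he => he; rewrite /edge_dom he.
  have [kb ub] := bh he.
  have unb : `|un (nn k) e (b k e)| <= 2 * dyadic k.
    have [_ /(_ e _ Db (bX k e))] := Hnn k; have := rrdl k.
    have := ler_norm (`|un (nn k) e (b k e)| - `|u e (b k e)|).
    have := ler_dist_dist (un (nn k) e (b k e)) (u e (b k e)); lra.
  have q : N2 (un (nn k)) <= muR by rewrite mass.
  have := tail_estimate (Hn (nn k)) cn nc he (b0 k e) unb (bnd (nn k) (e := e)) q.
  have : RI (edge_dom e) (fun x => gn (nn k) e x ^+ 2) =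
      RI `[0, b k e] (fun x => gn (nn k) e x ^+ 2) + RI `[b k e, +oo[ (fun x => gn (nn k) e x ^+ 2).
    by rewrite dE; apply: RI_split_half => //; rewrite -dE.
  have : RI (edge_dom e) (fun x => un (nn k) e x ^+ 6) =
      RI `[0, b k e] (fun x => un (nn k) e x ^+ 6) + RI `[b k e, +oo[ (fun x => un (nn k) e x ^+ 6).
    by rewrite dE; apply: RI_split_half => //; rewrite -dE.
  have : B ^+ 2 * (2 * dyadic k) ^+ 2 / (2 * Num.sqrt 3) <= 2 * (B ^+ 2 * dyadic k).
    have s1 : 1 <= Num.sqrt (3 : R) by rewrite -[leLHS]sqrtr1 ler_sqrt// ler1n.
    rewrite ler_pdivrMr; last lra.
    have : dyadic k ^+ 2 <= dyadic k :> R by rewrite expr2 ler_piMl// ltW.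
    have : 0 <= B ^+ 2 by rewrite sqr_ge0.
    nra.
  lra.
have lim e x : edge_dom e x -> forall r : R, 0 < r -> exists K, forall k, (K <= k)%N ->
    `|v k e x - u e x| <= r.
  move=> Dx r r0; have [J1 HJ1] := dyadic_small r0.
  have x0 : 0 <= x by case: (edge_hdom e) => _ _ + _; apply.
  have [J2 HJ2] : exists J2, x <= J2%:R.
    by exists (Num.truncn x).+1; apply/ltW; have /andP[] := truncn_itv x0.
  exists (maxn J1 J2) => k; rewrite geq_max => /andP[k1 k2].
  have [Db bl bh] := Hb k e.
  have xb : x <= b k e.
    case: (boolP (is_halfline e)) => [/bh[kb _]|].
      by apply: le_trans kb; apply: (le_trans HJ2); rewrite ler_nat.
    rewrite /is_halfline; case E: (tgt G e) => [t|]// _.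
    by rewrite (bl _ E); move: Dx; rewrite (edge_domE _ E) => /andP[].
  rewrite /v (min_idPl xb); have [_ Hx] := Hnn k.
  apply: (le_trans (Hx e x Dx (le_trans xb (bX k e)))).
  exact: le_trans (rrdl k) (HJ1 k k1).
have nb (r : R) : 0 < r -> exists K, forall k, (K <= k)%N ->
    normsq (edge_dom (G := G)) (h k) <= 2 * l + N6 u / 3 + r.
  move=> r0; have r2 : 0 < r / 4 by lra.
  have [N HN] := en r2.
  have C0 : 0 < 1 + (nE G)%:R * (B ^+ 5 + 2 * B ^+ 2).
    by rewrite ltr_pwDl// mulr_ge0// addr_ge0 ?mulr_ge0 ?exprn_ge0.
  have [J HJ] := dyadic_small (divr_gt0 r2 C0).
  exists (maxn N J) => k; rewrite geq_max => /andP[k1 k2].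
  have [kn _] := Hnn k; have E := HN _ (leq_trans k1 kn).
  have : normsq (edge_dom (G := G)) (h k) / 2 <= En (un (nn k)) (gn (nn k)) + N6 u / 6
      + (nE G)%:R * (B ^+ 5 + 2 * B ^+ 2) * dyadic k.
    rewrite /normsq /En /N2 /N6 /normsq !mulr_suml -sumrB -big_split/=.
    have -> : (nE G)%:R * (B ^+ 5 + 2 * B ^+ 2) * dyadic k =
        \sum_(e < nE G) ((B ^+ 5 + 2 * B ^+ 2) * dyadic k).
      by rewrite sumr_const card_ord -[RHS]mulr_natl mulrA.
    by rewrite -big_split/=; apply: ler_sum => e _; exact: edge_est.
  have : (1 + (nE G)%:R * (B ^+ 5 + 2 * B ^+ 2)) * dyadic k <= r / 4.
    by rewrite mulrC -ler_pdivlMr//; exact: HJ.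
  have := @dyadic_gt0 R k; lra.
have [g wg Ng] := weak_limit (@edge_hdom R G) (fun k e => (vh k e).1) lim nb.
exists u, g; split => //.
- split; first exact: glue.
  move=> e; have [mg g2 U] := wg e; split => //; exact: u2e.
- rewrite /En /N2; lra.
Qed.

End GraphCompactness.

(** * Ground states *)

Section GroundStates.
Context {R : realType} (G : mgraph R).
Local Notation fam := ('I_(nE G) -> R -> R).
Hypothesis cn : gconnected G.
Hypothesis nc : noncompact G.

Definition extend (e0 : 'I_(nE G)) (U : R -> R) : fam := fun e x => if e == e0 then U x else 0.

Lemma RI0 (D : set R) : lmset D -> rint D (fun=> 0) /\ RI D (fun=> 0) = 0.
Proof.
by move=> mD; split; [exact: integrable0|rewrite /RI Rintegral_cst// mul0r].
Qed.

Lemma extend_sum e0 U n : is_halfline e0 ->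
  \sum_e RI (edge_dom e) (fun x => extend e0 U e x ^+ n.+1) = RI `[0, +oo[ (fun x => U x ^+ n.+1).
Proof.
move=> /eqP he; rewrite (bigD1 e0)//= big1 ?addr0.
  rewrite /extend eqxx.
  by congr RI; rewrite /edge_dom he.
move=> e /negbTE ne; rewrite /extend ne.
rewrite (@eq_RI _ _ _ (fun=> 0)); last by move=> x _; rewrite expr0n.
by have [] := RI0 (edge_dom_measurable e).
Qed.

Lemma extend_H1 e0 U dU : is_halfline e0 -> wpair `[0, +oo[ U dU -> U 0 = 0 ->
  rint `[0, +oo[ (fun x => U x ^+ 2) -> H1 (extend e0 U) (extend e0 dU).
Proof.
move=> he [mU dU2 UU] U0 U2; have dE : edge_dom e0 = `[0, +oo[%classic.
  by move/eqP: he => he; rewrite /edge_dom he.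
split.
  exists (fun=> 0) => e; rewrite /extend; case: eqP => [->|_]; last by split.
  split => // v E; by move: he; rewrite /is_halfline E.
move=> e; rewrite /extend; case: eqP => [->|_]; first by rewrite dE.
have [i0 _] := RI0 (edge_dom_measurable e).
have i2 : rint (edge_dom e) (fun=> 0 ^+ 2) by apply: eq_rint i0 => // x _; rewrite expr0n.
split; [exact: measurable_cst|exact: i2|exact: i2|].
by move=> x _; have [_ ] := @RI0 `[0, x] (measurable_itv _); rewrite /RI => ->; rewrite addr0.
Qed.

Lemma H1mu_scale (u g : fam) (mu : R) : H1 u g -> 0 < N2 u -> 0 < mu ->
  let k2 := mu / N2 u in
  exists u' g' : fam, [/\ H1mu mu u' g', H1 u' g', N2 u' = mu, N2 g' = k2 * N2 g & N6 u' = k2 ^+ 3 * N6 u].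
Proof.
move=> H q0 mu0 k2; have k20 : 0 < k2 by rewrite divr_gt0.
have e2 : Num.sqrt k2 ^+ 2 = k2 by rewrite sqr_sqrtr// ltW.
have H' := H1Z (Num.sqrt k2) H.
have q' : N2 (fun e x => Num.sqrt k2 * u e x) = mu.
  rewrite N2Z; last by move=> e; exact: H1_u2 H.
  by rewrite e2 divfK// gt_eqF.
exists (fun e x => Num.sqrt k2 * u e x), (fun e x => Num.sqrt k2 * g e x); split => //.
- by split => //; rewrite (H1_L2 H') q'.
- by rewrite N2Z ?e2// => e; exact: H1_g2 H.
- by rewrite N6Z ?(exprM _ 2 3) ?e2// => e; exact: (H1_u6 H cn nc e).
Qed.

Lemma N6_ge0 (u : fam) : 0 <= N6 u.
Proof.
by apply: sumr_ge0 => e _; apply: RI_ge0 => x _; rewrite (exprM _ 3 2) sqr_ge0.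
Qed.

(* The trial functions are truncated solitons, concentrated by the factor [lam]. *)
Lemma trial_family (mu : R) : 0 < mu -> exists2 c, 0 < c & forall lam, 0 < lam ->
  exists u g : fam, H1mu mu u g /\ En u g <= c * lam ^+ 2.
Proof.
move=> mu0; have [e0 he] := nc.
pose k := sech (1 : R); have k0 : 0 < k by exact: sech_gt0.
pose eta := Num.sqrt k / 2.
have eta0 : 0 < eta by rewrite divr_gt0// sqrtr_gt0.
have p0 := pi_gt0 R.
exists (mu * pi / (2 * k)); first by rewrite divr_gt0 ?mulr_gt0.
move=> lam l0; have e1 : 2 * eta <= Num.sqrt k by rewrite /eta; lra.
have [U [dU [J [[wp U0] [U2 /andP[m1 m2]] gr _ /andP[_ J2]]]]] := bump_exists eta0 e1 l0.
have H := extend_H1 he wp U0 U2.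
have q : N2 (extend e0 U) = RI `[0, +oo[ (fun x => U x ^+ 2) by exact: (extend_sum U 1 he).
have A : N2 (extend e0 dU) = RI `[0, +oo[ (fun x => dU x ^+ 2) by exact: (extend_sum dU 1 he).
have q0 : 0 < N2 (extend e0 U).
  by rewrite q; apply: lt_le_trans m1; rewrite divr_gt0// mulr_gt0.
have [u [g [Hmu H' _ Ng _]]] := H1mu_scale H q0 mu0.
exists u, g; split => //; rewrite /En Ng q A.
have := N6_ge0 u; move: q0; rewrite q; set Q := RI _ _ in m1 m2 * => q0 n6.
apply: (@le_trans _ _ (mu / Q * (lam ^+ 2 * (pi / (2 * lam))) / 2)).
  have : mu / Q * RI `[0, +oo[ (fun x => dU x ^+ 2) <= mu / Q * (lam ^+ 2 * (pi / (2 * lam))).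
    rewrite ler_pM2l ?divr_gt0//; apply: (le_trans gr).
    by rewrite ler_pM2l// exprn_gt0.
  lra.
have Qi : Q^-1 <= 2 * lam / k.
  by rewrite -[leRHS]invrK lef_pV2 ?posrE ?invr_gt0 ?divr_gt0 ?mulr_gt0// invf_div.
have -> : mu / Q * (lam ^+ 2 * (pi / (2 * lam))) / 2 = Q^-1 * (mu * lam * pi / 4).
  by field; rewrite !gt_eqF.
have -> : mu * pi / (2 * k) * lam ^+ 2 = 2 * lam / k * (mu * lam * pi / 4).
  by field; rewrite gt_eqF.
by rewrite ler_pM2r// divr_gt0// !mulr_gt0.
Qed.

(** Rescaling to mass [mu] multiplies squares by [K2], with [K2 ^+ 2 >= 3 rho lam^2] and
    [rho = (mu / muR)^2 > 1]. The energy is then at most [K2 / 2] times [lam^2 (J - rho J)] plus a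
    truncation error. *)
Lemma trial_supercritical (mu : R) : muR < mu -> exists2 c, 0 < c & forall lam, 0 < lam ->
  exists u g : fam, H1mu mu u g /\ En u g <= - (c * lam ^+ 2).
Proof.
move=> muRl; have [e0 he] := nc; have p0 := pi_gt0 R.
have s30 : 0 < Num.sqrt (3 : R) by rewrite sqrtr_gt0.
have mR0 : 0 < muR :> R by rewrite /muR divr_gt0// mulr_gt0.
have mu0 : 0 < mu := lt_trans mR0 muRl.
pose k := sech (1 : R); have k0 : 0 < k by exact: sech_gt0.
pose rho := (mu / muR) ^+ 2.
have rho1 : 1 < rho.
  have : 1 < mu / muR by rewrite ltr_pdivlMr// mul1r.
  rewrite /rho; nra.
have k30 : 0 < k ^+ 3 by rewrite exprn_gt0.
(* The second bound lets the truncation error absorb at most half of the gain, since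
   [lam * J >= 2 k^3]. *)
pose eta := Num.min (Num.sqrt k / 2) ((rho - 1) * k ^+ 3 / (3 * pi * rho)).
have r1 : 0 < rho - 1 by lra.
have r0 : 0 < rho by lra.
have den0 : 0 < 3 * pi * rho by apply: mulr_gt0 => //; apply: mulr_gt0.
have eta0 : 0 < eta.
  rewrite lt_min; apply/andP; split; first by rewrite divr_gt0// sqrtr_gt0.
  have h1 : 0 < (rho - 1) * k ^+ 3 by exact: mulr_gt0.
  exact: divr_gt0.
have e1 : 2 * eta <= Num.sqrt k.
  have : eta <= Num.sqrt k / 2 by rewrite ge_min lexx.
  lra.
have e2 : 3 * pi * rho * eta <= (rho - 1) * k ^+ 3.
  have : eta <= (rho - 1) * k ^+ 3 / (3 * pi * rho) by rewrite ge_min lexx orbT.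
  by rewrite ler_pdivlMr; [rewrite mulrC|].
exists (mu / pi * ((rho - 1) * k ^+ 3)).
  by apply: mulr_gt0; [exact: divr_gt0|exact: mulr_gt0].
move=> lam l0.
have [U [dU [J [[wp U0] [U2 /andP[m1 m2]] gr L6 /andP[J1 _]]]]] := bump_exists eta0 e1 l0.
have H := extend_H1 he wp U0 U2.
have q : N2 (extend e0 U) = RI `[0, +oo[ (fun x => U x ^+ 2) by exact: (extend_sum U 1 he).
have A : N2 (extend e0 dU) = RI `[0, +oo[ (fun x => dU x ^+ 2) by exact: (extend_sum dU 1 he).
have B : N6 (extend e0 U) = RI `[0, +oo[ (fun x => U x ^+ 6) by exact: (extend_sum U 5 he).
have q0 : 0 < N2 (extend e0 U).
  by rewrite q; apply: lt_le_trans m1; rewrite divr_gt0// mulr_gt0.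
have B0 := N6_ge0 (extend e0 U); rewrite B in B0.
have [u [g [Hmu H' _ Ng N6']]] := H1mu_scale H q0 mu0.
exists u, g; split => //; rewrite /En Ng N6' q A B.
move: q0; rewrite q; set Q := RI _ _ in m1 m2 * => q0.
set a := RI _ (fun x => dU x ^+ 2) in gr *; set b := RI _ (fun x => U x ^+ 6) in L6 B0 *.
pose K2 := mu / Q; rewrite -/K2.
have K20 : 0 < K2 by rewrite divr_gt0.
have K2l : 2 * lam * mu / pi <= K2.
  rewrite /K2 ler_pdivlMr// mulrAC ler_pdivrMr//.
  by move: m2; rewrite ler_pdivlMr ?mulr_gt0//; nra.
have K4 : 3 * rho * lam ^+ 2 <= K2 ^+ 2.
  have -> : 3 * rho * lam ^+ 2 = (2 * lam * mu / pi) ^+ 2.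
    have s32 := @sqrt3_sqr R; rewrite /rho /muR.
    transitivity (3 * (2 * lam * mu / pi) ^+ 2 / (Num.sqrt 3 ^+ 2)); last by rewrite s32; lra.
    have aux (p t : R) : 0 < p -> 0 < t -> 3 * (mu / (p * t / 2)) ^+ 2 * lam ^+ 2 =
        3 * (2 * lam * mu / p) ^+ 2 / t ^+ 2 by move=> ? ?; field; rewrite !gt_eqF.
    exact: aux p0 s30.
  by rewrite lerXn2r ?nnegrE ?(ltW K20)// divr_ge0 ?mulr_ge0 ?ltW.
have bnd : a - K2 ^+ 2 / 3 * b <= - (lam * ((rho - 1) * k ^+ 3)).
  apply: (@le_trans _ _ (lam ^+ 2 * J - rho * lam ^+ 2 * (J - 3 * pi * eta / lam))).
    apply: lerB => //; apply: (@le_trans _ _ (rho * lam ^+ 2 * b)).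
      have rl : 0 < rho * lam ^+ 2 by rewrite mulr_gt0// exprn_gt0.
      by rewrite ler_pM2l.
    by rewrite ler_wpM2r//; lra.
  have -> : lam ^+ 2 * J - rho * lam ^+ 2 * (J - 3 * pi * eta / lam) =
      lam * (3 * pi * rho * eta) - lam * ((rho - 1) * (lam * J)).
    by field; rewrite gt_eqF.
  rewrite -mulrBr -[leRHS]mulrN ler_pM2l//.
  have : 2 * k ^+ 3 <= lam * J by rewrite [leRHS]mulrC -ler_pdivrMr.
  nra.
have -> : K2 * a / 2 - K2 ^+ 3 * b / 6 = K2 / 2 * (a - K2 ^+ 2 / 3 * b) by field.
apply: (@le_trans _ _ (K2 / 2 * - (lam * ((rho - 1) * k ^+ 3)))).
  by rewrite ler_pM2l ?divr_gt0.
have -> : mu / pi * ((rho - 1) * k ^+ 3) * lam ^+ 2 =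
    (2 * lam * mu / pi) / 2 * (lam * ((rho - 1) * k ^+ 3)).
  have aux (p t : R) : 0 < p -> mu / p * t * lam ^+ 2 = (2 * lam * mu / p) / 2 * (lam * t).
    by move=> ?; field; rewrite gt_eqF.
  exact: aux.
rewrite mulrN lerN2 ler_pM2r ?mulr_gt0//; lra.
Qed.

Lemma groundE_le (mu : R) (u g : fam) : H1mu mu u g -> (groundE G mu <= (En u g)%:E)%E.
Proof.
move=> Hu; apply: ereal_inf_lbound; exists u, g; split => //.
by rewrite (energyE (proj1 Hu) cn nc).
Qed.

Lemma groundE_ge (mu c : R) : (forall u g : fam, H1mu mu u g -> c <= En u g) ->
  (c%:E <= groundE G mu)%E.
Proof.
move=> h; apply: le_ereal_inf_tmp => _ [u [g [Hu ->]]].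
by rewrite (energyE (proj1 Hu) cn nc) lee_fin; exact: h.
Qed.

(** Letting [lam] tend to 0 spreads the trial functions along a half-line at vanishing energy
    cost. *)
Lemma groundE_le0 (mu : R) : 0 < mu -> (groundE G mu <= 0)%E.
Proof.
move=> mu0; have [c c0 Hc] := trial_family mu0.
apply/lee_addgt0Pr => r r0; rewrite add0e.
pose lam := Num.min 1 (r / c).
have l0 : 0 < lam by rewrite lt_min ltr01/= divr_gt0.
have [u [g [Hu Eu]]] := Hc lam l0.
apply: (le_trans (groundE_le Hu)); rewrite lee_fin (le_trans Eu)//.
have l1 : lam <= 1 by rewrite ge_min lexx.
have : lam <= r / c by rewrite ge_min lexx orbT.
rewrite ler_pdivlMr// => h; nra.
Qed.

Lemma N2_eq0 (u g : fam) : H1 u g -> N2 u * N2 g = 0 ->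
  forall e x, edge_dom e x -> u e x = 0.
Proof.
move=> H q0 e x Dx; have := sup_bound H cn nc Dx; rewrite q0 mulr0 => h.
have : u e x ^+ 4 == 0 by rewrite eq_le h (exprM _ 2 2) sqr_ge0.
by rewrite expf_eq0 => /andP[_ /eqP].
Qed.

Lemma N6_zero (u : fam) : (forall e x, edge_dom e x -> u e x = 0) -> N6 u = 0.
Proof.
move=> z; rewrite /N6 big1// => e _; rewrite (@eq_RI _ _ _ (fun=> 0)).
  by have [] := RI0 (edge_dom_measurable e).
by move=> x Dx; rewrite z// expr0n.
Qed.

Lemma N2_zero (u : fam) : (forall e x, edge_dom e x -> u e x = 0) -> N2 u = 0.
Proof.
move=> z; rewrite /N2 /normsq big1// => e _; rewrite (@eq_RI _ _ _ (fun=> 0)).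
  by have [] := RI0 (edge_dom_measurable e).
by move=> x Dx; rewrite z// expr0n.
Qed.

Lemma N6_le (u g : fam) (B4 : R) : H1 u g -> (forall e x, edge_dom e x -> u e x ^+ 4 <= B4) ->
  N6 u <= B4 * N2 u.
Proof.
move=> H uB; rewrite /N6 /N2 /normsq mulr_sumr; apply: ler_sum => e _.
have u2 := H1_u2 e H; rewrite -RIZ//; apply: le_RI => //.
- exact: (H1_u6 H cn nc e).
- exact: rintZ.
- by move=> x Dx; rewrite (exprD _ 4 2) ler_wpM2r ?sqr_ge0// uB.
Qed.

(** Finiteness of the supremum comes from [sup_bound], which gives 16, and positivity from one
    truncated soliton. The quotient is defined on nonzero functions because [sup_bound] makes both
    factors of its denominator positive. *)
Lemma best_constant : exists2 K, 0 < K & [/\ KG G = K%:E,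
  (forall u g : fam, H1 u g -> N6 u <= K * (N2 u ^+ 2 * N2 g)) &
  forall r, 0 < r -> exists u g : fam, [/\ H1 u g, 0 < N2 u, 0 < N2 g &
    (K - r) * (N2 u ^+ 2 * N2 g) <= N6 u]].
Proof.
pose S := [set r : R | exists u g : fam, [/\ H1 u g,
      (exists e x, edge_dom e x /\ u e x <> 0%R) &
      r = (fine (L6pow u) / ((fine (L2sq u)) ^+ 2 * fine (L2sq g)))%R]].
have SE (u g : fam) : H1 u g -> fine (L6pow u) / ((fine (L2sq u)) ^+ 2 * fine (L2sq g)) =
    N6 u / (N2 u ^+ 2 * N2 g).
  by move=> H; rewrite (H1_L6 H cn nc) (H1_L2 H) (H1_L2g H).
have den (u g : fam) : H1 u g -> (exists e x, edge_dom e x /\ u e x <> 0%R) ->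
    0 < N2 u /\ 0 < N2 g.
  move=> H [e [x [Dx ux]]]; split; rewrite lt0r N2_ge0 andbT; apply/eqP => q0;
    by apply: ux; apply: (N2_eq0 H) => //; rewrite q0 ?mul0r ?mulr0.
have S16 r : S r -> r <= 16.
  move=> [u [g [H nz ->]]]; rewrite SE//; have [q0 a0] := den _ _ H nz.
  rewrite ler_pdivrMr ?mulr_gt0 ?exprn_gt0//.
  apply: (le_trans (N6_le H (fun e x Dx => sup_bound H cn nc Dx))).
  by rewrite le_eqVlt; apply/orP; left; apply/eqP; ring.
have [r0 [Sr0 r00]] : exists r, S r /\ 0 < r.
  have [e0 he] := nc; have k0 := sech_gt0 (1 : R); have p0 := pi_gt0 R.
  (* At [lam = 1] the truncation error is at most [sech 1 ^+ 3], half of the lower bound for [J], so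
     the sixth power is positive. *)
  pose eta := Num.min (Num.sqrt (sech 1) / 2) (sech (1 : R) ^+ 3 / (3 * pi)).
  have eta0 : 0 < eta.
    rewrite lt_min; apply/andP; split; first by rewrite divr_gt0// sqrtr_gt0.
    by apply: divr_gt0; rewrite ?exprn_gt0 ?mulr_gt0.
  have e1 : 2 * eta <= Num.sqrt (sech 1).
    have : eta <= Num.sqrt (sech 1) / 2 by rewrite ge_min lexx.
    lra.
  have e2 : 3 * pi * eta <= sech 1 ^+ 3.
    have : eta <= sech 1 ^+ 3 / (3 * pi) by rewrite ge_min lexx orbT.
    by rewrite ler_pdivlMr; [rewrite mulrC|apply: mulr_gt0].
  have [U [dU [J [[wp U0] [U2 /andP[m1 m2]] gr L6 /andP[J1 _]]]]] := bump_exists eta0 e1 ltr01.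
  have H := extend_H1 he wp U0 U2.
  have B : N6 (extend e0 U) = RI `[0, +oo[ (fun x => U x ^+ 6) by exact: (extend_sum U 5 he).
  have B0 : 0 < N6 (extend e0 U).
    rewrite B; move: L6 J1; rewrite !divr1; have := exprn_gt0 3 k0; lra.
  have nz : exists e x, edge_dom e x /\ extend e0 U e x <> 0%R.
    apply: contrapT => hn; move: B0; rewrite N6_zero ?ltxx// => e x Dx.
    by apply: contrapT => ux; apply: hn; exists e, x.
  have [q0 a0] := den _ _ H nz.
  exists (N6 (extend e0 U) / (N2 (extend e0 U) ^+ 2 * N2 (extend e0 dU))); split.
    by exists (extend e0 U), (extend e0 dU); split => //; rewrite SE.
  by rewrite divr_gt0 ?mulr_gt0 ?exprn_gt0.
have KE : KG G = ereal_sup [set r%:E | r in S] by [].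
have K16 : (KG G <= 16%:E)%E.
  by rewrite KE; apply: ge_ereal_sup => _ [r Sr <-]; rewrite lee_fin; exact: S16.
have Kge r : S r -> (r%:E <= KG G)%E.
  by move=> Sr; rewrite KE; apply: ereal_sup_ubound; exists r.
have Kfin : KG G \is a fin_num.
  rewrite fin_numE; apply/andP; split.
    by apply/eqP => h; have := Kge _ Sr0; rewrite h.
  by apply/eqP => h; move: K16; rewrite h.
exists (fine (KG G)).
  by apply: (lt_le_trans r00); rewrite -lee_fin fineK// Kge.
split; first by rewrite fineK.
- move=> u g H; have [nz|z] := pselect (exists e x, edge_dom e x /\ u e x <> 0%R); last first.
    have z' e x : edge_dom e x -> u e x = 0.
      by move=> Dx; apply: contrapT => ux; apply: z; exists e, x.
    by rewrite (N6_zero z') (N2_zero z') expr0n/= mul0r mulr0.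
  have [q0 a0] := den _ _ H nz.
  rewrite -ler_pdivrMr ?mulr_gt0 ?exprn_gt0// -SE// -lee_fin fineK//.
  by apply: Kge; exists u, g.
- move=> r r0'; apply: contrapT => hn.
  have : (KG G <= (fine (KG G) - r)%:E)%E.
    rewrite {1}KE; apply: ge_ereal_sup => _ [s [u [g [H nz ->]]] <-].
    rewrite lee_fin SE//; have [q0 a0] := den _ _ H nz.
    rewrite ler_pdivrMr ?mulr_gt0 ?exprn_gt0// leNgt; apply/negP => /ltW lt.
    by apply: hn; exists u, g.
  rewrite -{1}(fineK Kfin) lee_fin; lra.
Qed.

End GroundStates.

(** * Boundedness and existence of minimizers *)

Section Existence.
Context {R : realType} (G : mgraph R).
Local Notation fam := ('I_(nE G) -> R -> R).
Hypothesis cn : gconnected G.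
Hypothesis nc : noncompact G.
Hypothesis nt : no_terminal_point G.

Lemma shortest_edge : exists2 ell : R, 0 < ell &
  forall e v, tgt G e = Some v -> ell <= len G e.
Proof.
exists (\big[Num.min/1]_(e | ~~ is_halfline e) len G e).
  apply: (big_ind (fun x => 0 < x)) => // [x y x0 y0|e he]; first by rewrite lt_min x0.
  exact: (len_gt0 (m := G)).
by move=> e v E; apply: bigmin_le_cond; rewrite /is_halfline E.
Qed.

Lemma inv_sqrt3 (x : R) : 0 <= x -> x / Num.sqrt 3 <= x.
Proof.
move=> x0; rewrite ler_pdivrMr ?sqrt3_gt0// ler_peMr//.
by rewrite -[leLHS]sqrtr1 ler_sqrt// ler1n.
Qed.

Lemma global_max (u g : fam) : H1 u g -> exists e0 x0, edge_dom e0 x0 /\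
  forall e x, edge_dom e x -> `|u e x| <= `|u e0 x0|.
Proof.
move=> H; have [i hi] := nc.
have [e0 [x0 [_ D0 M0]]] := pred_max (P := predT) H (isT : predT i).
by exists e0, x0; split => // e x; exact: M0.
Qed.

(** Estimate A forces [c <= M^2 m^2]. With [y = m M^2], estimate B gives [kap y^2 < pi y + M^2 m^2];
    for large [M] the last term is at most [kap y^2 / 2], so [y < Y] and [M^2 <= y^2 / c] is
    bounded. *)
Lemma max_bound (mu c : R) : 0 < mu -> mu <= muR -> 0 < c ->
  exists2 M1, 0 <= M1 & forall u g : fam, H1 u g -> N2 u = mu -> En u g <= - c ->
    forall e x, edge_dom e x -> `|u e x| <= M1.
Proof.
move=> mu0 muR' c0; have [ell l0 Hl] := shortest_edge; have p0 := pi_gt0 R.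
(* Chosen so that [mu / b^2 = ell / 2]: at least half of the shortest bounded edge contributes to
   the gain, whence the value of [kap]. *)
pose b2 := 2 * mu / ell; pose b := Num.sqrt b2.
have b20 : 0 < b2 by rewrite divr_gt0// mulr_gt0.
have b0 : 0 < b by rewrite sqrtr_gt0.
have bb : b ^+ 2 = b2 by rewrite sqr_sqrtr// ltW.
pose kap := ell / (24 * (1 + b2)).
have k0 : 0 < kap by rewrite divr_gt0//; lra.
pose Y := 2 * pi / kap.
have Y0 : 0 < Y by rewrite divr_gt0// mulr_gt0.
(* The summands serve in turn [2 b^4 <= M^4], the absorption of [M^2 m^2], and the final
   contradiction. *)
pose Z := 2 * b2 + 2 / kap + Y ^+ 2 / c.
have k20 : 0 < 2 / kap by rewrite divr_gt0.
have Yc : 0 < Y ^+ 2 / c by rewrite divr_gt0// exprn_gt0.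
exists (Z + 1); first by rewrite /Z; lra.
move=> u g H q E; have [e0 [x0 [D0 uM]]] := global_max H.
move=> e x Dx; apply: (le_trans (uM e x Dx)) => {e x Dx}.
move M_eq : `|u e0 x0| uM => M uM.
have M00 : 0 <= M by rewrite -M_eq.
rewrite leNgt; apply/negP => MZ.
have M0 : 0 < M by rewrite /Z in MZ; lra.
have M1' : 1 < M by rewrite /Z in MZ; lra.
have M2 : Z < M ^+ 2 by nra.
have [m m0 [low hi]] := min_level H.
have eA := energy_ge_A H cn nc nt D0 M0 uM M_eq m0 low.
have M2m : c <= M ^+ 2 * m ^+ 2.
  have h : 0 <= M ^+ 4 * (muR - N2 u) by rewrite mulr_ge0 ?exprn_ge0 ?(ltW M0)// q subr_ge0.
  have := @inv_sqrt3 (M ^+ 2 * m ^+ 2) _; rewrite mulr_ge0 ?sqr_ge0// => /(_ isT).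
  lra.
case: hi => [m00|[e1 [v1 [E1 um]]]].
  by move: M2m; rewrite m00 expr0n/= mulr0; lra.
have bM : 2 * b ^+ 4 <= M ^+ 4.
  rewrite (exprM b 2 2) (exprM M 2 2) bb.
  have : 2 * b2 <= M ^+ 2 by rewrite /Z in M2; lra.
  nra.
have eB := energy_ge_B H cn nc nt D0 M0 uM M_eq m0 low E1 um b0 bM.
rewrite q in eB; have h : 0 <= M ^+ 4 * (muR - mu) by rewrite mulr_ge0 ?exprn_ge0 ?subr_ge0 ?(ltW M0).
have i1 := @inv_sqrt3 (M ^+ 2 * m ^+ 2) (mulr_ge0 (sqr_ge0 _) (sqr_ge0 _)).
have i2 : m * M ^+ 2 * pi / Num.sqrt 3 <= m * M ^+ 2 * pi.
  by apply: inv_sqrt3; rewrite !mulr_ge0 ?sqr_ge0// ltW.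
have gain : kap * (m * M ^+ 2) ^+ 2 <=
    M ^+ 4 * m ^+ 2 / (12 * (1 + b ^+ 2)) * (len G e1 - mu / b ^+ 2).
  have -> : kap * (m * M ^+ 2) ^+ 2 = M ^+ 4 * m ^+ 2 / (12 * (1 + b ^+ 2)) * (ell / 2).
    by rewrite bb /kap; field; rewrite gt_eqF//; lra.
  rewrite ler_wpM2l ?divr_ge0 ?mulr_ge0 ?sqr_ge0 ?exprn_ge0 ?(ltW M0)//.
    by rewrite bb; lra.
  have -> : mu / b ^+ 2 = ell / 2 by rewrite bb /b2; field; rewrite !gt_eqF.
  by have := Hl _ _ E1; lra.
have y0 : 0 < m * M ^+ 2.
  rewrite mulr_gt0 ?exprn_gt0// lt0r m0 andbT; apply/eqP => m00.
  by move: M2m; rewrite m00 expr0n/= mulr0; lra.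
set y := m * M ^+ 2 in gain y0 i2 eB.
have yM : M ^+ 2 * m ^+ 2 * M ^+ 2 = y ^+ 2 by rewrite /y; ring.
have M20 : 0 < M ^+ 2 by rewrite exprn_gt0.
have half : M ^+ 2 * m ^+ 2 <= kap / 2 * y ^+ 2.
  rewrite -yM.
  have : 1 <= kap / 2 * M ^+ 2.
    have : 2 / kap <= M ^+ 2 by rewrite /Z in M2; lra.
    by rewrite ler_pdivrMr//; lra.
  have : 0 <= M ^+ 2 * m ^+ 2 by rewrite mulr_ge0 ?sqr_ge0.
  nra.
have yY : y < Y.
  rewrite /Y ltr_pdivlMr//.
  have : kap / 2 * y ^+ 2 < pi * y by lra.
  rewrite expr2 mulrA ltr_pM2r//; lra.
have : M ^+ 2 <= Y ^+ 2 / c.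
  rewrite ler_pdivlMr//; apply: (@le_trans _ _ (y ^+ 2)).
    by rewrite -yM mulrC ler_pM2r.
  by rewrite lerXn2r ?nnegrE ?ltW.
by rewrite /Z in M2; lra.
Qed.

Lemma energy_lower_bound (mu : R) : 0 < mu -> mu <= muR -> (-oo < groundE G mu)%E.
Proof.
move=> mu0 muR'; have [M1 M10 HM] := max_bound mu0 muR' ltr01.
apply: (@lt_le_trans _ _ (- (1 + M1 ^+ 4 * mu))%:E); first by rewrite ltNyr.
apply: groundE_ge => // u g [H L]; have q : N2 u = mu.
  by move: L; rewrite (H1_L2 H) => -[].
have p4 : 0 <= M1 ^+ 4 * mu by rewrite mulr_ge0 ?exprn_ge0// ltW.
case: (leP (En u g) (-1)) => E; last lra.
have n6 : N6 u <= M1 ^+ 4 * mu.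
  rewrite -q; apply: (N6_le cn nc H) => e x Dx.
  rewrite -[u e x ^+ 4]ger0_norm; last by rewrite (exprM _ 2 2) sqr_ge0.
  by rewrite normrX lerXn2r ?nnegrE//; exact: HM H q E e x Dx.
by have := N2_ge0 g; rewrite /En; lra.
Qed.

(** Scaling by [k = mu / N2 u >= 1] multiplies the gradient term by [k] and the sixth-power term by
    [k^3 >= k], so the new energy is at most [k l <= l]. *)
Lemma attained_of_le (mu l : R) (u g : fam) : H1 u g -> 0 < N2 u -> N2 u <= mu ->
  En u g <= l -> l <= 0 -> (groundE G mu = l%:E) -> attained G mu.
Proof.
move=> H q0 qmu El l0 gE; have mu0 := lt_le_trans q0 qmu.
have [u' [g' [Hmu H' _ Ng N6']]] := H1mu_scale cn nc H q0 mu0.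
exists u', g'; split => //; apply/eqP; rewrite eq_le; apply/andP; split; last first.
  by apply: ereal_inf_lbound; exists u', g'.
rewrite (energyE H' cn nc) gE lee_fin /En Ng N6'.
set k := mu / N2 u; have k1 : 1 <= k by rewrite ler_pdivlMr// mul1r.
have n6 := N6_ge0 u; move: El; rewrite /En.
have : k * N6 u <= k ^+ 3 * N6 u.
  by rewrite ler_wpM2r// -[leLHS]expr1 ler_weXn2l.
move=> h El.
have : k * (N2 g / 2 - N6 u / 6) <= k * l by rewrite ler_pM2l//; lra.
nra.
Qed.

Lemma ground_state_subcritical (mu : R) : 0 < mu -> mu <= muR -> (groundE G mu < 0)%E ->
  attained G mu.
Proof.
move=> mu0 muR' neg; have low := energy_lower_bound mu0 muR'.
have fin : groundE G mu \is a fin_num.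
  by rewrite fin_numE; apply/andP; split; apply/eqP => h; move: low neg; rewrite h.
set l := fine (groundE G mu).
have gE : groundE G mu = l%:E by rewrite /l fineK.
have l0 : l < 0 by move: neg; rewrite gE lte_fin.
have c0 : 0 < - l / 2 by lra.
have [M1 M10 HM] := max_bound mu0 muR' c0.
(* The cap [- l / 2] keeps every energy below [l / 2 < 0], so that [max_bound] applies to the whole
   sequence. *)
have ex n : exists p : fam * fam, H1mu mu p.1 p.2 /\ En p.1 p.2 <= l + Num.min (dyadic n) (- l / 2).
  have r0 : 0 < Num.min (dyadic n) (- l / 2) by rewrite lt_min dyadic_gt0.
  apply: contrapT => hn.
  have : ((l + Num.min (dyadic n) (- l / 2))%:E <= groundE G mu)%E.
    apply: groundE_ge => // u g Hu; rewrite leNgt; apply/negP => /ltW lt.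
    by apply: hn; exists (u, g).
  rewrite gE lee_fin; lra.
have [p Hp] := choice ex.
have Hn n : H1 (p n).1 (p n).2 by case: (Hp n) => -[].
have q n : N2 (p n).1 = mu by case: (Hp n) => -[H L] _; move: L; rewrite (H1_L2 H) => -[].
have En2 n : En (p n).1 (p n).2 <= - (- l / 2).
  have [_ E] := Hp n; apply: (le_trans E).
  have : Num.min (dyadic n) (- l / 2) <= - l / 2 by rewrite ge_min lexx orbT.
  lra.
have bnd n e x : edge_dom e x -> `|(p n).1 e x| <= M1 by exact: HM (Hn n) (q n) (En2 n) e x.
have n6 n : N6 (p n).1 <= M1 ^+ 4 * mu.
  rewrite -(q n); apply: (N6_le cn nc (Hn n)) => e x Dx.
  rewrite -[X in X <= _]ger0_norm; last by rewrite (exprM _ 2 2) sqr_ge0.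
  by rewrite normrX lerXn2r ?nnegrE//; exact: bnd.
have grad n : N2 (p n).2 <= M1 ^+ 4 * mu.
  have := En2 n; have := n6 n; have := N6_ge0 (p n).1; rewrite /En; lra.
have en (r : R) : 0 < r -> exists N, forall n, (N <= n)%N -> En (p n).1 (p n).2 <= l + r.
  move=> r0; have [J HJ] := dyadic_small r0; exists J => n /HJ h.
  have [_ E] := Hp n; apply: (le_trans E); rewrite lerD2l; apply: le_trans h.
  by rewrite ge_min lexx.
have [u [g [H qu Eu _]]] := graph_compactness cn nc Hn q muR' M10 bnd grad en.
apply: (attained_of_le H _ qu Eu (ltW l0) gE).
rewrite lt0r N2_ge0 andbT; apply/eqP => q0.
have z : forall e x, edge_dom e x -> u e x = 0 by apply: (N2_eq0 cn nc H); rewrite q0 mul0r.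
by move: Eu; rewrite /En (N6_zero z); have := N2_ge0 g; lra.
Qed.

(* On the half-lines alone the critical inequality holds with the constant of the line. *)
Lemma halfline_gn (u g : fam) (mu : R) : (1 < nhalflines G)%N -> H1 u g -> N2 u = mu -> 0 < mu ->
  \sum_(e | is_halfline e) RI (edge_dom e) (fun x => u e x ^+ 6) <=
  3 * (mu / muR) ^+ 2 * N2 g.
Proof.
move=> h2 H q mu0.
have mR0 : 0 < muR :> R by rewrite /muR divr_gt0// mulr_gt0 ?pi_gt0 ?sqrt3_gt0.
pose k2 := muR / mu; have k20 : 0 < k2 by rewrite divr_gt0.
have e2 : Num.sqrt k2 ^+ 2 = k2 by rewrite sqr_sqrtr// ltW.
have H' := H1Z (Num.sqrt k2) H.
have q' : N2 (fun e x => Num.sqrt k2 * u e x) <= muR.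
  rewrite N2Z; last by move=> e; exact: H1_u2 H.
  by rewrite e2 q divfK// gt_eqF.
have := halfline_estimate H' cn nc h2 q'.
rewrite N2Z ?e2; last by move=> e; exact: H1_g2 H.
rewrite (eq_bigr (fun e => k2 ^+ 3 * RI (edge_dom e) (fun x => u e x ^+ 6))); last first.
  move=> e _; rewrite -RIZ//; last exact: (H1_u6 H cn nc e).
  by apply: eq_RI => x _; rewrite exprMn (exprM _ 2 3) e2.
have i0 : 0 < k2^-1 ^+ 3 by rewrite exprn_gt0// invr_gt0.
rewrite -mulr_sumr -(ler_pM2l i0).
set S := \sum_(e | _) _.
have -> : k2^-1 ^+ 3 * (k2 ^+ 3 * S) = S by field; rewrite gt_eqF.
move/le_trans; apply.
rewrite le_eqVlt; apply/orP; left; apply/eqP.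
have aux (x y z : R) : 0 < x -> 0 < y -> (x / y)^-1 ^+ 3 * (3 * (x / y * z)) = 3 * (y / x) ^+ 2 * z.
  by move=> ? ?; field; rewrite !gt_eqF.
exact: aux.
Qed.

(** At zero ground energy a minimizing sequence may vanish, so near-optimizers of the
    Gagliardo-Nirenberg quotient are used instead. Estimate A and [m^2 ell <= mu] bound them. If
    their limit were 0, the bounded edges would contribute little to [N6], and the half-lines only
    the constant [3 (mu / muR)^2 < 3], against near-optimality. *)
Lemma ground_state_threshold (K mu : R) : (1 < nhalflines G)%N -> 0 < K -> 0 < mu ->
  K * mu ^+ 2 = 3 -> mu < muR -> groundE G mu = 0%E ->
  (forall r : R, 0 < r -> exists u g : fam, [/\ H1 u g, 0 < N2 u, 0 < N2 g &
    (K - r) * (N2 u ^+ 2 * N2 g) <= N6 u]) ->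
  attained G mu.
Proof.
move=> h2 K0 mu0 Kmu muR' gE opt; have [ell l0 Hl] := shortest_edge.
have mR0 : 0 < muR :> R := lt_trans mu0 muR'.
pose d := muR - mu; have d0 : 0 < d by rewrite subr_gt0.
(* The bound 1/2 lets the sixth power control the gradient; the other makes the quotient defect cost
   at most half of [M^4 d / 6] in estimate A. *)
pose rho := Num.min (2^-1) (d / (4 * mu)).
have rho0 : 0 < rho by rewrite lt_min invr_gt0 ltr0Sn/= divr_gt0// mulr_gt0.
have rho2 : rho <= 2^-1 by rewrite ge_min lexx.
have rhod : rho * mu <= d / 4.
  have : rho <= d / (4 * mu) by rewrite ge_min lexx orbT.
  by rewrite ler_pdivlMr ?mulr_gt0//; lra.
have ex n : exists p : fam * fam, [/\ H1 p.1 p.2, N2 p.1 = mu, 0 < N2 p.2 &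
    3 * (1 - rho * dyadic n) * N2 p.2 <= N6 p.1].
  have r0 : 0 < K * (rho * dyadic n) by rewrite !mulr_gt0// dyadic_gt0.
  have [u [g [H q0 a0 ug]]] := opt _ r0.
  have [u' [g' [_ H' q' Ng N6']]] := H1mu_scale cn nc H q0 mu0.
  exists (u', g'); split => //=; first by rewrite Ng mulr_gt0// divr_gt0.
  rewrite Ng N6'; have c0 : 0 < (mu / N2 u) ^+ 3 by rewrite exprn_gt0// divr_gt0.
  move: ug; rewrite -(ler_pM2l c0); apply: le_trans.
  rewrite le_eqVlt; apply/orP; left; apply/eqP; rewrite -Kmu.
  by field; rewrite gt_eqF.
have [p Hp] := choice ex.
have Hn n : H1 (p n).1 (p n).2 by case: (Hp n).
have q n : N2 (p n).1 = mu by case: (Hp n).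
have ga n : 0 < N2 (p n).2 by case: (Hp n).
have n6 n : 3 * (1 - rho * dyadic n) * N2 (p n).2 <= N6 (p n).1 by case: (Hp n).
have rd n : rho * dyadic n <= rho by rewrite ler_piMr ?dyadic_le1// ltW.
have rd0 n : 0 < rho * dyadic n by rewrite mulr_gt0// dyadic_gt0.
have E n : En (p n).1 (p n).2 <= rho * dyadic n * N2 (p n).2 / 2.
  have := n6 n; rewrite /En; lra.
(* What remains of estimate A is [M^2 d / 12 <= m^2], and [m^2 <= mu / ell]. *)
pose Z := 12 * mu / (ell * d).
have Z0 : 0 < Z by rewrite divr_gt0 ?mulr_gt0.
have gle n (M : R) : (forall e x, edge_dom e x -> `|(p n).1 e x| <= M) ->
    N2 (p n).2 <= 2 / 3 * (M ^+ 4 * mu).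
  move=> uM; have h : N6 (p n).1 <= M ^+ 4 * mu.
    rewrite -(q n); apply: (N6_le cn nc (Hn n)) => e x Dx.
    rewrite -[X in X <= _]ger0_norm; last by rewrite (exprM _ 2 2) sqr_ge0.
    by rewrite normrX lerXn2r ?nnegrE ?uM// (le_trans _ (uM e x Dx)).
  have : 3 * (1 - 2^-1) * N2 (p n).2 <= 3 * (1 - rho * dyadic n) * N2 (p n).2.
    by rewrite ler_pM2r// ler_pM2l// lerD2l lerN2 (le_trans (rd n)).
  have := n6 n; lra.
have bnd n e x : edge_dom e x -> `|(p n).1 e x| <= Z + 1.
  have [e0 [x0 [D0 uM]]] := global_max (Hn n).
  move=> Dx; apply: (le_trans (uM e x Dx)) => {e x Dx}.
  move M_eq : `|(p n).1 e0 x0| uM => M uM.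
  have M00 : 0 <= M by rewrite -M_eq.
  rewrite leNgt; apply/negP => MZ.
  have M0 : 0 < M by lra.
  have M1' : 1 < M by lra.
  have M2 : Z < M ^+ 2 by nra.
  have [m m0 [low hi]] := min_level (Hn n).
  have eA := energy_ge_A (Hn n) cn nc nt D0 M0 uM M_eq m0 low.
  have m2 : m ^+ 2 * ell <= mu.
    case: hi => [->|[e1 [v1 [E1 um]]]]; first by rewrite expr0n mul0r ltW.
    rewrite -(q n); apply: le_trans (edge_le_N2 _ e1).
    have dE : edge_dom e1 = `[0, len G e1]%classic by rewrite /edge_dom E1.
    have le0 : 0 <= len G e1 by apply: le_trans (Hl _ _ E1); exact: ltW.
    apply: (@le_trans _ _ (RI (edge_dom e1) (fun=> m ^+ 2))).
      by rewrite dE RI_cst// subr0 ler_wpM2l ?sqr_ge0//; exact: Hl E1.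
    apply: le_RI => //; first by rewrite dE; exact: rint_cst.
      exact: H1_u2 (Hn n).
    move=> x Dx; rewrite -[leRHS]real_normK ?num_real// lerXn2r ?nnegrE//; exact: um.
  have i1 := @inv_sqrt3 (M ^+ 2 * m ^+ 2) (mulr_ge0 (sqr_ge0 _) (sqr_ge0 _)).
  have M20 : 0 < M ^+ 2 by rewrite exprn_gt0.
  have M40 : 0 < M ^+ 4 by rewrite exprn_gt0.
  have h1 : rho * dyadic n * N2 (p n).2 <= rho * (2 / 3 * (M ^+ 4 * mu)).
    by apply: ler_pM; rewrite ?(ltW (rd0 n)) ?N2_ge0 ?rd ?gle.
  have h3 : M ^+ 4 * (rho * mu) <= M ^+ 4 * (d / 4) by rewrite ler_pM2l.
  have h4 : M ^+ 4 * d / 12 <= M ^+ 2 * m ^+ 2.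
    by have := E n; rewrite (q n) -/d in eA; lra.
  have h5 : M ^+ 2 * d / 12 <= m ^+ 2.
    by rewrite -(ler_pM2l M20); apply: le_trans h4; rewrite (exprD _ 2 2); lra.
  have : M ^+ 2 <= Z.
    rewrite /Z ler_pdivlMr ?mulr_gt0//.
    have : M ^+ 2 * d / 12 * ell <= mu by apply: le_trans m2; rewrite ler_pM2r.
    lra.
  lra.
have Z1 : 0 <= Z + 1 by lra.
pose A := 2 / 3 * ((Z + 1) ^+ 4 * mu).
have grad n : N2 (p n).2 <= A by apply: gle => e x; exact: bnd.
have A0 : 0 < A := lt_le_trans (ga 0%N) (grad 0%N).
have en (r : R) : 0 < r -> exists N, forall n, (N <= n)%N -> En (p n).1 (p n).2 <= 0 + r.
  move=> r0; have [J HJ] := dyadic_small (divr_gt0 r0 A0); exists J => n /HJ.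
  rewrite ler_pdivlMr// => h; rewrite add0r; apply: (le_trans (E n)).
  have : rho * dyadic n * N2 (p n).2 <= dyadic n * A.
    apply: ler_pM; rewrite ?(ltW (rd0 n)) ?N2_ge0//.
    by rewrite ler_piMl ?(ltW (dyadic_gt0 _))//; lra.
  lra.
have [u [g [H qu Eu loc]]] := graph_compactness cn nc Hn q (ltW muR') Z1 bnd grad en.
apply: (attained_of_le H _ qu Eu (lexx 0) gE).
rewrite lt0r N2_ge0 andbT; apply/eqP => q0.
have z : forall e x, edge_dom e x -> u e x = 0 by apply: (N2_eq0 cn nc H); rewrite q0 mul0r.
(* Vanishing is excluded by comparing terms proportional to [N2 (p n).2], since this gradient may
   itself tend to 0; this is why [sup_bound] is used for four of the six factors on the bounded
   edges. *)
pose Lam := \sum_(e | ~~ is_halfline e) len G e.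
have lenp e : ~~ is_halfline e -> 0 < len G e by move=> he; exact: (len_gt0 (m := G)).
have Lam0 : 0 <= Lam by apply: sumr_ge0 => e /lenp /ltW.
have lenL e : ~~ is_halfline e -> len G e <= Lam.
  by move=> he; rewrite /Lam (bigD1 e)//= lerDl; apply: sumr_ge0 => i /andP[/lenp/ltW].
pose gap := 1 - (mu / muR) ^+ 2.
have gap0 : 0 < gap.
  have : mu / muR < 1 by rewrite ltr_pdivrMr// mul1r.
  have : 0 < mu / muR by rewrite divr_gt0.
  rewrite /gap; nra.
pose r := Num.min 1 (gap / (16 * mu * Lam + 1)).
have c1 : 0 < 16 * mu * Lam + 1 by rewrite ltr_pwDr// !mulr_ge0// ltW.
have r0 : 0 < r by rewrite lt_min ltr01/= divr_gt0.
have r1 : r <= 1 by rewrite ge_min lexx.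
have rg : 16 * mu * Lam * r ^+ 2 <= gap.
  have h1 : r * (16 * mu * Lam + 1) <= gap.
    by rewrite -ler_pdivlMr// ge_min lexx orbT.
  have : 16 * mu * Lam * r ^+ 2 <= 16 * mu * Lam * r.
    by rewrite ler_wpM2l ?mulr_ge0 ?(ltW mu0)// expr2 ler_piMl// ltW.
  lra.
have [J HJ] := dyadic_small gap0.
have [n Jn Hcore] := loc _ Lam J r0.
have core : \sum_(e | ~~ is_halfline e) RI (edge_dom e) (fun x => (p n).1 e x ^+ 6)
    <= 16 * (mu * N2 (p n).2) * (Lam * r ^+ 2).
  rewrite /Lam mulr_suml mulr_sumr; apply: ler_sum => e he.
  have dE : edge_dom e = `[0, len G e]%classic.
    by move: he; rewrite /is_halfline /edge_dom; case: (tgt G e).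
  have -> : 16 * (mu * N2 (p n).2) * (len G e * r ^+ 2) =
      RI (edge_dom e) (fun=> 16 * (mu * N2 (p n).2) * r ^+ 2).
    by rewrite dE RI_cst ?(ltW (lenp _ he))// subr0; ring.
  apply: le_RI => //; first exact: (H1_u6 (Hn n) cn nc e).
    by rewrite dE; exact: rint_cst.
  move=> x Dx; rewrite (exprD _ 4 2); apply: ler_pM.
  - by rewrite (exprM _ 2 2) sqr_ge0.
  - by rewrite sqr_ge0.
  - by have := sup_bound (Hn n) cn nc Dx; rewrite q.
  - rewrite -[leLHS]real_normK ?num_real// lerXn2r ?nnegrE ?(ltW r0)//.
    have xL : x <= Lam.
      by apply: le_trans (lenL _ he); move: Dx; rewrite dE /= in_itv/= => /andP[].
    by have := Hcore e x Dx xL; rewrite z// subr0.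
have half := halfline_gn h2 (Hn n) (q n) mu0.
have tot : N6 (p n).1 <= 3 * (mu / muR) ^+ 2 * N2 (p n).2 + 16 * (mu * N2 (p n).2) * (Lam * r ^+ 2).
  by rewrite /N6 (bigID (@is_halfline R G))/= lerD.
have dn := HJ n Jn.
have rdn : rho * dyadic n <= gap / 2 by have := @dyadic_gt0 R n; nra.
have := n6 n; have a0 := ga n.
have : 16 * (mu * N2 (p n).2) * (Lam * r ^+ 2) <= gap * N2 (p n).2.
  by rewrite (_ : _ * (Lam * _) = 16 * mu * Lam * r ^+ 2 * N2 (p n).2); [rewrite ler_pM2r|ring].
have : rho * dyadic n * N2 (p n).2 <= gap / 2 * N2 (p n).2 by rewrite ler_pM2r.
have : 0 < gap * N2 (p n).2 by rewrite mulr_gt0.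
rewrite /gap in tot *; set s := (mu / muR) ^+ 2 in tot *; nra.
Qed.

End Existence.

(** * Sign of the ground energy and range of attainment *)

Theorem theorem7p4 (R : realType) (G : mgraph R) :
  gconnected G -> noncompact G -> no_terminal_point G -> ~ assumptionH G ->
  (1 < nhalflines G)%N ->
  muG G < muR ->
  (forall mu : R, muG G < mu <= muR ->
     (-oo < groundE G mu)%E /\ (groundE G mu < 0)%E) /\
  (forall mu : R, 0 < mu -> (attained G mu <-> muG G <= mu <= muR)).
Proof.
move=> cn nc nt _ h2 muGR.
have [K K0 [KE GN opt]] := best_constant cn nc.
have K3 : 0 < 3 / K by rewrite divr_gt0.
have mG : muG G = Num.sqrt (3 / K) by rewrite /muG KE.
have mG0 : 0 < muG G by rewrite mG sqrtr_gt0.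
have KmG : K * muG G ^+ 2 = 3 by rewrite mG sqr_sqrtr ?(ltW K3)// mulrC divfK// gt_eqF.
have neg mu : muG G < mu -> (groundE G mu < 0)%E.
  move=> mul; have mu0 := lt_trans mG0 mul.
  (* A function whose quotient reaches the midpoint of [3 / mu^2] and [K] has negative energy once
     scaled to mass [mu]. *)
  have r0 : 0 < (K - 3 / mu ^+ 2) / 2.
    rewrite divr_gt0// subr_gt0 ltr_pdivrMr ?exprn_gt0// -KmG ltr_pM2l//.
    by rewrite ltr_pXn2r ?nnegrE ?ltW.
  have [u [g [H q0 a0 ug]]] := opt _ r0.
  have [u' [g' [Hmu H' q' Ng N6']]] := H1mu_scale cn nc H q0 mu0.
  apply: (le_lt_trans (groundE_le cn nc Hmu)); rewrite lte_fin /En Ng N6'.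
  set k := mu / N2 u; have k0 : 0 < k by rewrite divr_gt0.
  have kq : k * N2 u = mu by rewrite /k divfK// gt_eqF.
  have h : 3 * N2 g < k ^+ 2 * N6 u.
    apply: (@lt_le_trans _ _ (k ^+ 2 * ((K - (K - 3 / mu ^+ 2) / 2) * (N2 u ^+ 2 * N2 g)))).
      have -> : k ^+ 2 * ((K - (K - 3 / mu ^+ 2) / 2) * (N2 u ^+ 2 * N2 g)) =
          ((K + 3 / mu ^+ 2) / 2 * (k * N2 u) ^+ 2) * N2 g by lra.
      rewrite ltr_pM2r// kq.
      have -> : (K + 3 / mu ^+ 2) / 2 * mu ^+ 2 = (K * mu ^+ 2 + 3) / 2.
        by field; rewrite gt_eqF.
      have : 3 < K * mu ^+ 2 by rewrite -KmG ltr_pM2l// ltr_pXn2r ?nnegrE ?ltW.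
      lra.
    by rewrite ler_pM2l// exprn_gt0.
  have : k * (3 * N2 g) < k * (k ^+ 2 * N6 u) by rewrite ltr_pM2l.
  rewrite (exprS k 2); lra.
split.
  move=> mu /andP[mul mur]; split; last exact: neg.
  by apply: energy_lower_bound => //; exact: lt_trans mul.
move=> mu mu0; split; last first.
  move=> /andP[mul mur]; move: mul; rewrite le_eqVlt => /predU1P[E|mul]; last first.
    by apply: ground_state_subcritical => //; exact: neg.
  rewrite -E; apply: (ground_state_threshold cn nc nt h2 K0 mG0 KmG muGR) => //.
  apply/eqP; rewrite eq_le; apply/andP; split; first exact: groundE_le0.
  apply: groundE_ge => // u g [H L]; have q : N2 u = muG G.
    by move: L; rewrite (H1_L2 H) => -[].
  by have := GN u g H; rewrite q mulrA KmG /En; lra.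
move=> [u [g [[H L] E]]].
have q : N2 u = mu by move: L; rewrite (H1_L2 H) => -[].
have EE : (En u g)%:E = groundE G mu by rewrite -E (energyE H cn nc).
(* Below [muG] the Gagliardo-Nirenberg inequality makes every energy positive while the infimum is
   at most 0; above [muR] concentrating trial functions beat any given energy. *)
rewrite leNgt [X in _ && X]leNgt; apply/andP; split; apply/negP => lt.
  have : En u g <= 0 by rewrite -lee_fin EE groundE_le0.
  have := GN u g H; rewrite q.
  have a0 : 0 < N2 g.
    rewrite lt0r N2_ge0 andbT; apply/eqP => a0.
    have z : forall e x, edge_dom e x -> u e x = 0 by apply: (N2_eq0 cn nc H); rewrite a0 mulr0.
    by move: mu0; rewrite -q (N2_zero z) ltxx.
  have : K * mu ^+ 2 < 3 by rewrite -KmG ltr_pM2l// ltr_pXn2r ?nnegrE ?ltW.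
  rewrite mulrA -(ltr_pM2r a0) /En; lra.
have [c c0 Hc] := trial_supercritical cn nc lt.
(* As [lam >= 1], [c lam^2 >= c lam = c + |En u g|], so the trial energy lies strictly below
   [En u g]. *)
pose lam := 1 + `|En u g| / c.
have l1 : 1 <= lam by rewrite lerDl divr_ge0// ltW.
have [u' [g' [Hu' Eu']]] := Hc lam (lt_le_trans ltr01 l1).
have := groundE_le cn nc Hu'; rewrite -EE lee_fin.
have : c * lam = c + `|En u g| by rewrite /lam mulrDr mulr1 mulrC divfK// gt_eqF.
have : lam <= lam ^+ 2 by rewrite -[leLHS]expr1 ler_weXn2l.
have := ler_norm (- En u g); rewrite normrN.
nra.
Qed.
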